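(* Let $S$ be a parabolic surface germ $z=f(x,y)$ in Monge form, with Taylor expansion at $0$ $$f(x,y)=\frac{a_{02}}{2}y^2+\sum_{i+j\ge 3}\frac{a_{ij}}{i!\,j!}x^iy^j\quad(a_{02}\neq 0),$$ and let $\mathbf v=(1,0,0)$. If $S$ satisfies one of the conditions (i)–(viii) below, then there exists a cylindrical surface germ $CS_{\mathbf v,\Gamma}$, with $\Gamma(y)=(0,y,\gamma(y))$, such that the contact function $F(x,y)=f(x,y)-\gamma(y)$ has, at $0$, one of the simple $\mathcal K$-singularities in the list given after the colon for that condition (note that the entry $E_*$ in the list of (v) is not simple): (i) $a_{30}\ne0$, $Q_{D_4}>0$: $A_2$, $D_{\ge4}$; (ii) $a_{30}\ne0$, $Q_{D_4}<0$: $A_2$, $D_4^+$; (iii) $a_{30}\ne0$, $Q_{D_4}=0$, $Q_{E_7}\ne0$: $A_2$, $D_4^+$, $E_6$, $E_7$; (iv) $a_{30}=0$, $a_{21}a_{40}\ne0$, $R_{A_4}\ne0$: $A_3$, $A_4$, $D_{\ge4}$; (v) $a_{30}\ne0$, $Q_{D_4}=0$, $Q_{E_7}=0$, $Q_{E_*}\ne0$: $A_2$, $D_4^+$, $E_6$, $E_8$, $E_*$; (vi) $a_{30}=0$, $a_{21}a_{40}\ne0$, $R_{A_4}=0$, $R_{A_6}\ne0$: $A_3$, $A_5$, $A_6$, $D_{\ge4}$; (vii) $a_{30}=a_{40}=0$, $a_{21}\ne0$: $A_3^-$, $D_{\ge4}$; (viii) $a_{30}=a_{21}=0$, $a_{12}a_{40}\ne0$: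 $A_3$, $D_5$.
   Context: All germs are smooth germs at the origin. A parabolic surface germ is a surface germ in Euclidean space $\mathbb R^3$ at a non-umbilical parabolic point (a point where the Gaussian curvature vanishes); without loss of generality it is the graph $z=f(x,y)$ in the Monge form displayed in the claim, and $\mathbf v=(1,0,0)$ is then its unique asymptotic direction at the origin. For a smooth function germ $\gamma:\mathbb R,0\to\mathbb R,0$ let $\Gamma(y)=(0,y,\gamma(y))$. The cylindrical surface germ with cylindrical direction $\mathbf v$ and base curve $\Gamma$ is $CS_{\mathbf v,\Gamma}:(x,y)\mapsto\Gamma(y)+x\mathbf v$, i.e. the surface $z=\gamma(y)$. Two function germs $g_1,g_2:\mathbb R^2,0\to\mathbb R,0$ are $\mathcal K$-equivalent if there are a diffeomorphism germ $\phi:\mathbb R^2,0\to\mathbb R^2,0$ and a nowhere vanishing smooth function germ $M$ on $\mathbb R^2,0$ with $M g_1=g_2\circ\phi$. The $5$-jets at $0$ of two such germs $g_1,g_2$ are $\mathcal K^5$-equivalent ($\sim_{\mathcal K^5}$) if some germ $\mathcal K$-equivalent to $g_1$ has the same $5$-jet at $0$ as $g_2$. The simple $\mathcal K$-singularities are the $\mathcal K$-classes of the normal forms $A_k^\pm$ ($k\ge1$): $x^2\pm y^{k+1}$; $D_k^\pm$ ($k\ge4$): $x^2y\pm y^{k-1}$; $E_6$: $x^3+y^4$; $E_7$: $x^3+xy^3$; $E_8$: $x^3+y^5$. When no superscript is written, either sign is allowed; $D_{\ge4}$ denotes the classes $D_k$ with $k\ge4$. The symbol $E_*$ means that the $5$-jet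 of $F$ at $0$ satisfies $j^5F\sim_{\mathcal K^5}x^3+xy^4$. Constants: $$Q_{D_4}=a_{21}^2-a_{12}a_{30},$$ $$Q_{E_7}=-a_{40}a_{21}^3+3a_{31}a_{30}a_{21}^2-3a_{22}a_{30}^2a_{21}+a_{13}a_{30}^3,$$ $$\begin{aligned}Q_{E_*}=&-3a_{21}^4a_{40}^2+a_{21}^3(12a_{31}a_{40}+a_{21}a_{50})a_{30}-2a_{21}^2(6a_{31}^2+3a_{22}a_{40}+2a_{21}a_{41})a_{30}^2\\&+6a_{21}(2a_{22}a_{31}+a_{21}a_{32})a_{30}^3+(-3a_{22}^2-4a_{21}a_{23})a_{30}^4+a_{14}a_{30}^5,\end{aligned}$$ $$R_{A_4}=-10a_{21}a_{31}a_{40}+5a_{12}a_{40}^2+3a_{21}^2a_{50},$$ $$\begin{aligned}R_{A_6}=&\,756a_{21}^3a_{50}^3-315a_{21}^2a_{50}(10a_{31}a_{50}+3a_{21}a_{60})a_{40}\\&+75a_{21}\bigl(56a_{31}^2a_{50}+21a_{21}a_{31}a_{60}+3a_{21}(14a_{41}a_{50}+a_{21}a_{70})\bigr)a_{40}^2\\&-175\bigl(10a_{31}^3+30a_{21}a_{31}a_{41}+9a_{21}(a_{22}a_{50}+a_{21}a_{51})\bigr)a_{40}^3\\&+2625(a_{22}a_{31}+a_{21}a_{32})a_{40}^4-875a_{13}a_{40}^5.\end{aligned}$$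
   Formalization: Every entry of each list is shown to be realized; in (v), E_* (5-jet equivalent to x^3+xy^4) is realized only if Q_{E_*}>0, while for Q_{E_*}<0 it is replaced by x^3-xy^4, since E_* then fails, e.g. for f=y^2/2+x^3/6-xy^4/24. *)

(* Defs.v *)
From Stdlib Require Import Reals Lra.
From Coquelicot Require Import Coquelicot.
Open Scope R_scope.

(** Germs at the origin are represented by total functions; every notion below
    only depends on their values near the origin. *)

Definition smooth1 (g : R -> R) : Prop :=
  locally 0 (fun t => forall n, ex_derive_n g n t).

Definition smooth2 (g : R -> R -> R) : Prop :=
  locally_2d (fun x y => forall n, ex_diff_n g n x y) 0 0.

(* smooth germs (R,0) -> (R,0) and (R^2,0) -> (R,0) *)
Definition germ1 (g : R -> R) : Prop := smooth1 g /\ g 0 = 0.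
Definition germ2 (g : R -> R -> R) : Prop := smooth2 g /\ g 0 0 = 0.

(* [(p, q)] are the components of a diffeomorphism germ (R^2,0) -> (R^2,0),
   with inverse germ [(p', q')] *)
Definition diffeo_germ (p q : R -> R -> R) : Prop :=
  germ2 p /\ germ2 q /\
  exists p' q' : R -> R -> R,
    germ2 p' /\ germ2 q' /\
    locally_2d (fun x y => p' (p x y) (q x y) = x /\ q' (p x y) (q x y) = y) 0 0 /\
    locally_2d (fun x y => p (p' x y) (q' x y) = x /\ q (p' x y) (q' x y) = y) 0 0.

Definition K_equiv (g1 g2 : R -> R -> R) : Prop :=
  exists p q M : R -> R -> R,
    diffeo_germ p q /\ smooth2 M /\
    locally_2d (fun x y => M x y <> 0) 0 0 /\
    locally_2d (fun x y => M x y * g1 x y = g2 (p x y) (q x y)) 0 0.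

(* [partial_derive i j] differentiates [i] times in x and [j] times in y *)
Definition same_jet (n : nat) (g1 g2 : R -> R -> R) : Prop :=
  forall i j : nat, (i + j <= n)%nat ->
    partial_derive i j g1 0 0 = partial_derive i j g2 0 0.

Definition K5_equiv (g1 g2 : R -> R -> R) : Prop :=
  exists g : R -> R -> R, germ2 g /\ K_equiv g1 g /\ same_jet 5 g g2.

Definition is_sign (s : R) : Prop := s = 1 \/ s = -1.

Definition nf_A (s : R) (k : nat) (x y : R) : R := x ^ 2 + s * y ^ (k + 1).
Definition nf_D (s : R) (k : nat) (x y : R) : R := x ^ 2 * y + s * y ^ (k - 1).
Definition nf_E6 (x y : R) : R := x ^ 3 + y ^ 4.
Definition nf_E7 (x y : R) : R := x ^ 3 + x * y ^ 3.
Definition nf_E8 (x y : R) : R := x ^ 3 + y ^ 5.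

(* without superscript, either sign is allowed *)
Definition sing_A (k : nat) (F : R -> R -> R) : Prop :=
  exists s, is_sign s /\ K_equiv F (nf_A s k).
Definition sing_A_minus (k : nat) (F : R -> R -> R) : Prop :=
  K_equiv F (nf_A (-1) k).
Definition sing_D (k : nat) (F : R -> R -> R) : Prop :=
  exists s, is_sign s /\ K_equiv F (nf_D s k).
Definition sing_D_plus (k : nat) (F : R -> R -> R) : Prop :=
  K_equiv F (nf_D 1 k).
Definition sing_E6 (F : R -> R -> R) : Prop := K_equiv F nf_E6.
Definition sing_E7 (F : R -> R -> R) : Prop := K_equiv F nf_E7.
Definition sing_E8 (F : R -> R -> R) : Prop := K_equiv F nf_E8.

(* Over the reals x^3 + x y^4 and x^3 - x y^4 are not K^5-equivalent:
   [sing_E_star] is E_*, and [sing_E_star_minus] is its other real form. *)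
Definition sing_E_star (F : R -> R -> R) : Prop :=
  K5_equiv F (fun x y => x ^ 3 + x * y ^ 4).
Definition sing_E_star_minus (F : R -> R -> R) : Prop :=
  K5_equiv F (fun x y => x ^ 3 - x * y ^ 4).

Definition base_curve (gamma : R -> R) (y : R) : R * R * R := (0, y, gamma y).

Definition v_dir : R * R * R := (1, 0, 0).

(* (x, y) |-> Gamma(y) + x v *)
Definition cyl_surface (v : R * R * R) (Gamma : R -> R * R * R) (x y : R)
  : R * R * R :=
  let '(v1, v2, v3) := v in
  let '(g1, g2, g3) := Gamma y in
  (g1 + x * v1, g2 + x * v2, g3 + x * v3).

(* The contact function of the graph z = f(x,y) with a parametrized surface:
   the equation f(X,Y) - Z = 0 of the graph, pulled back by the
   parametrization. *)
Definition contact (f : R -> R -> R) (C : R -> R -> R * R * R) (x y : R) : R :=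
  let '(X, Y, Z) := C x y in f X Y - Z.

Lemma contact_cyl (f : R -> R -> R) (gamma : R -> R) (x y : R) :
  contact f (cyl_surface v_dir (base_curve gamma)) x y = f x y - gamma y.
Proof.
unfold contact, cyl_surface, v_dir, base_curve.
replace (0 + x * 1) with x by ring.
replace (y + x * 0) with y by ring.
ring.
Qed.

(* some cylindrical surface germ in the direction [v_dir] has contact of
   type [sing] with the graph of [f] *)
Definition realizes (f : R -> R -> R) (sing : (R -> R -> R) -> Prop) : Prop :=
  exists gamma : R -> R,
    germ1 gamma /\ sing (contact f (cyl_surface v_dir (base_curve gamma))).

(* a_ij in the expansion sum a_ij / (i! j!) x^i y^j *)
Definition taylor_coef (f : R -> R -> R) (i j : nat) : R :=
  partial_derive i j f 0 0.

Definition parabolic_monge (f : R -> R -> R) : Prop :=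
  let a := taylor_coef f in
  germ2 f /\ a 1%nat 0%nat = 0 /\ a 0%nat 1%nat = 0 /\
  a 2%nat 0%nat = 0 /\ a 1%nat 1%nat = 0 /\ a 0%nat 2%nat <> 0.

Section Constants.

Variable a : nat -> nat -> R.

Let a12 := a 1%nat 2%nat.  Let a13 := a 1%nat 3%nat.  Let a14 := a 1%nat 4%nat.
Let a21 := a 2%nat 1%nat.  Let a22 := a 2%nat 2%nat.  Let a23 := a 2%nat 3%nat.
Let a30 := a 3%nat 0%nat.  Let a31 := a 3%nat 1%nat.  Let a32 := a 3%nat 2%nat.
Let a40 := a 4%nat 0%nat.  Let a41 := a 4%nat 1%nat.
Let a50 := a 5%nat 0%nat.  Let a51 := a 5%nat 1%nat.
Let a60 := a 6%nat 0%nat.  Let a70 := a 7%nat 0%nat.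

Definition Q_D4 : R := a21 ^ 2 - a12 * a30.

Definition Q_E7 : R :=
  - a40 * a21 ^ 3 + 3 * a31 * a30 * a21 ^ 2
  - 3 * a22 * a30 ^ 2 * a21 + a13 * a30 ^ 3.

Definition Q_Estar : R :=
  - 3 * a21 ^ 4 * a40 ^ 2
  + a21 ^ 3 * (12 * a31 * a40 + a21 * a50) * a30
  - 2 * a21 ^ 2 * (6 * a31 ^ 2 + 3 * a22 * a40 + 2 * a21 * a41) * a30 ^ 2
  + 6 * a21 * (2 * a22 * a31 + a21 * a32) * a30 ^ 3
  + (- 3 * a22 ^ 2 - 4 * a21 * a23) * a30 ^ 4
  + a14 * a30 ^ 5.

Definition R_A4 : R :=
  - 10 * a21 * a31 * a40 + 5 * a12 * a40 ^ 2 + 3 * a21 ^ 2 * a50.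

Definition R_A6 : R :=
  756 * a21 ^ 3 * a50 ^ 3
  - 315 * a21 ^ 2 * a50 * (10 * a31 * a50 + 3 * a21 * a60) * a40
  + 75 * a21 * (56 * a31 ^ 2 * a50 + 21 * a21 * a31 * a60
                + 3 * a21 * (14 * a41 * a50 + a21 * a70)) * a40 ^ 2
  - 175 * (10 * a31 ^ 3 + 30 * a21 * a31 * a41
           + 9 * a21 * (a22 * a50 + a21 * a51)) * a40 ^ 3
  + 2625 * (a22 * a31 + a21 * a32) * a40 ^ 4
  - 875 * a13 * a40 ^ 5.

End Constants.

(* Main.v *)
Require Import Defs.
From Stdlib Require Import Reals Lra Lia Arith Ranalysis5
  ClassicalEpsilon FunctionalExtensionality.
From Coquelicot Require Import Coquelicot.

(** Subtracting gamma(y) from f leaves the x-derivative of f untouched, so the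
    contact functions available are those with a prescribed f_x.  For each
    entry of the lists one gamma is chosen so that, in suitable coordinates,
    the contact function is a normal form up to unit factors.

    The reason why no infinite process occurs is that the coefficients in all
    expansions are smooth functions (Taylor expansions with integral
    remainder, [taylor_X]), and that a germ such as A X^3 + C Y^n with A and C
    nonvanishing functions is K-equivalent to x^3 + y^n at once: divide by C
    and absorb a root of A / C into X.  One or two coordinate changes of the
    kind Y + e X, with e a smooth function, lead to such a form, because the
    last of them only creates multiples of the two principal monomials, which
    modify the unit coefficients.  For instance
    A x^3 + B x^2 y^3 + D x y^3 + C y^4 loses its terms of degree one in x by
    completing the fourth power in y, then its terms of degree two by
    completing the cube in x ([E6_recognition]).  The other ingredient is the
    inverse function theorem ([inverse_function]), which makes coordinates
    out of pairs of germs with nonzero Jacobian.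

    When a30 <> 0, a parabola x = psi(y) can be chosen so that f_xx vanishes
    on it to order three; with x measured from it,
    f = r(y) + (k2 y^2 + k3 y^3 + p y^4) x + B y^3 x^2 + A x^3, where k2, k3
    and p(0) are nonzero multiples of Q_D4, Q_E7 and Q_E* ([cubic_expansion]).
    Replacing r by one of 0, y^2, ..., y^5 gives A_2, D_4, E_6, E_7, E_8 and
    E_*.

    The D series needs a smooth curve x = phi(y) on which f_x = 0 and f_xx has
    a simple zero; it exists when the quadratic part of f_x has a real simple
    root transversal to the x-axis, that is when Q_D4 > 0, and when a30 = 0
    and a21 <> 0.  With x measured from it, f = r(y) + x^2 (g x + m y) with
    m(0) <> 0, and replacing r by y^(k-1) gives D_k: this germ still vanishes
    on a smooth curve, and its quotient by the equation of that curve is of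
    type A_(k-3) ([D_recognition_critical_curve]).

    When a30 = 0, gamma can be chosen to leave a nonzero y^2 term c y^2 / 2,
    and eliminating y gives A_k, where k is read on the restriction of the
    contact function to an approximate critical curve
    y = eta2 x^2 + eta3 x^3.  The y^2-coefficient is tuned to kill the x^4
    term, the y^3-coefficient the x^6 term; what remains at orders five and
    seven is R_A4 and R_A6 up to nonzero factors ([realizes_A456]).  The D_5
    of the last case is the contact with gamma(y) = f(0,y). *)

Open Scope R_scope.

(** * Functions of class C^n on a square *)

Definition PX (f : R -> R -> R) (x y : R) : R := Derive (fun z => f z y) x.
Definition PY (f : R -> R -> R) (x y : R) : R := Derive (fun z => f x z) y.

Definition on_box (r : R) (P : R -> R -> Prop) : Prop :=
  forall x y, Rabs x < r -> Rabs y < r -> P x y.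

(** Pointwise differentiability is required on a whole square, because the
    partial derivatives must again be differentiable near each point; a square
    centred at 0 is stable under (x, y) |-> (t x, y) for t in [0, 1], which
    the integral remainders need. *)
Definition Cn (n : nat) (r : R) (f : R -> R -> R) : Prop :=
  on_box r (ex_diff_n f n).

Lemma on_box_loc r P x y : on_box r P -> Rabs x < r -> Rabs y < r -> locally_2d P x y.
Proof.
intros H hx hy.
assert (hd : 0 < Rmin (r - Rabs x) (r - Rabs y)) by (apply Rmin_pos; lra).
exists (mkposreal _ hd); simpl; intros u v hu hv.
pose proof (Rmin_l (r - Rabs x) (r - Rabs y)).
pose proof (Rmin_r (r - Rabs x) (r - Rabs y)).
apply H.
- replace u with ((u - x) + x) by ring. eapply Rle_lt_trans. apply Rabs_triang. lra.
- replace v with ((v - y) + y) by ring. eapply Rle_lt_trans. apply Rabs_triang. lra.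
Qed.

Lemma Cn_ext n r f g : on_box r (fun x y => f x y = g x y) -> Cn n r f -> Cn n r g.
Proof.
intros H Hf x y hx hy. apply ex_diff_n_ext_loc with f.
- apply on_box_loc with r; auto.
- apply Hf; auto.
Qed.

Lemma Cn_le n m r f : (m <= n)%nat -> Cn n r f -> Cn m r f.
Proof. intros H Hf x y hx hy. apply ex_diff_n_m with n; auto. Qed.

Lemma Cn_shrink n r s f : s <= r -> Cn n r f -> Cn n s f.
Proof. intros H Hf x y hx hy. apply Hf; lra. Qed.

Lemma Cn_cont n r f x y : Cn n r f -> Rabs x < r -> Rabs y < r -> continuity_2d_pt f x y.
Proof. intros H hx hy. specialize (H x y hx hy). destruct n; apply H. Qed.

Lemma Cn_PX n r f : Cn (S n) r f -> Cn n r (PX f).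
Proof. intros H x y hx hy. apply (H x y hx hy). Qed.
Lemma Cn_PY n r f : Cn (S n) r f -> Cn n r (PY f).
Proof. intros H x y hx hy. apply (H x y hx hy). Qed.

Lemma Cn_derX n r f x y : Cn (S n) r f -> Rabs x < r -> Rabs y < r ->
  is_derive (fun z => f z y) x (PX f x y).
Proof. intros H hx hy. apply Derive_correct. apply (H x y hx hy). Qed.
Lemma Cn_derY n r f x y : Cn (S n) r f -> Rabs x < r -> Rabs y < r ->
  is_derive (fun z => f x z) y (PY f x y).
Proof. intros H hx hy. apply Derive_correct. apply (H x y hx hy). Qed.

Lemma Cn_pred n r f : Cn (S n) r f -> Cn n r f.
Proof. apply Cn_le. lia. Qed.

Ltac cn := first [assumption | apply Cn_PX; assumption | apply Cn_PY; assumption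
                 | apply Cn_pred; assumption].

(** The tool behind every closure property: it reduces class C^(n+1) to class
    C^n of candidate partial derivatives, which are then handled by induction
    on n. *)
Lemma Cn_of_partials n r f fx fy :
  on_box r (continuity_2d_pt f) ->
  on_box r (fun x y => is_derive (fun z => f z y) x (fx x y)) ->
  on_box r (fun x y => is_derive (fun z => f x z) y (fy x y)) ->
  Cn n r fx -> Cn n r fy -> Cn (S n) r f.
Proof.
intros Hc Hx Hy Hfx Hfy x y hx hy.
split; [apply Hc; auto|].
split; [eexists; apply Hx; auto|].
split; [eexists; apply Hy; auto|].
split.
- refine (Cn_ext n r fx _ _ Hfx x y hx hy).
  intros u v hu hv. symmetry. apply is_derive_unique. apply Hx; auto.
- refine (Cn_ext n r fy _ _ Hfy x y hx hy).
  intros u v hu hv. symmetry. apply is_derive_unique. apply Hy; auto.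
Qed.

Lemma Cn_const n r c : Cn n r (fun _ _ => c).
Proof.
revert c; induction n; intros c.
- intros x y _ _. split; auto. apply continuity_2d_pt_const.
- apply Cn_of_partials with (fun _ _ => 0) (fun _ _ => 0); auto; intros x y _ _.
  + apply continuity_2d_pt_const.
  + apply (is_derive_const c).
  + apply (is_derive_const c).
Qed.

Lemma Cn_fst n r : Cn n r (fun x _ => x).
Proof.
destruct n.
- intros x y _ _. split; auto. apply continuity_2d_pt_id1.
- apply Cn_of_partials with (fun _ _ => 1) (fun _ _ => 0); try apply Cn_const; intros x y _ _.
  + apply continuity_2d_pt_id1.
  + apply (is_derive_id x).
  + apply (is_derive_const x).
Qed.
Lemma Cn_snd n r : Cn n r (fun _ y => y).
Proof.
destruct n.
- intros x y _ _. split; auto. apply continuity_2d_pt_id2.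
- apply Cn_of_partials with (fun _ _ => 0) (fun _ _ => 1); try apply Cn_const; intros x y _ _.
  + apply continuity_2d_pt_id2.
  + apply (is_derive_const y).
  + apply (is_derive_id y).
Qed.

Lemma Cn_plus n r f g : Cn n r f -> Cn n r g -> Cn n r (fun x y => f x y + g x y).
Proof.
revert f g; induction n; intros f g Hf Hg.
- intros x y hx hy. split; auto. apply continuity_2d_pt_plus; [apply (Hf x y)|apply (Hg x y)]; auto.
- apply Cn_of_partials with (fun x y => PX f x y + PX g x y) (fun x y => PY f x y + PY g x y).
  + intros x y hx hy. apply continuity_2d_pt_plus; eapply Cn_cont; eauto.
  + intros x y hx hy. apply (is_derive_plus (fun z => f z y) (fun z => g z y)); eapply Cn_derX; eauto.
  + intros x y hx hy. apply (is_derive_plus (fun z => f x z) (fun z => g x z)); eapply Cn_derY; eauto.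
  + apply IHn; apply Cn_PX; auto.
  + apply IHn; apply Cn_PY; auto.
Qed.

Lemma Cn_mult n r f g : Cn n r f -> Cn n r g -> Cn n r (fun x y => f x y * g x y).
Proof.
revert f g; induction n; intros f g Hf Hg.
- intros x y hx hy. split; auto. apply continuity_2d_pt_mult; [apply (Hf x y)|apply (Hg x y)]; auto.
- apply Cn_of_partials with (fun x y => PX f x y * g x y + f x y * PX g x y)
                  (fun x y => PY f x y * g x y + f x y * PY g x y).
  + intros x y hx hy. apply continuity_2d_pt_mult; eapply Cn_cont; eauto.
  + intros x y hx hy. apply (is_derive_mult (fun z => f z y) (fun z => g z y));
     try (eapply Cn_derX; eauto). intros; apply Rmult_comm.
  + intros x y hx hy. apply (is_derive_mult (fun z => f x z) (fun z => g x z));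
     try (eapply Cn_derY; eauto). intros; apply Rmult_comm.
  + apply Cn_plus; apply IHn; cn.
  + apply Cn_plus; apply IHn; cn.
Qed.

(** Continuous partial derivatives give total differentiability, hence the
    chain rule. *)
Lemma Cn_differentiable n r f x y : Cn (S n) r f -> Rabs x < r -> Rabs y < r ->
  differentiable_pt_lim f x y (PX f x y) (PY f x y).
Proof.
intros H hx hy. apply filterdiff_differentiable_pt_lim.
apply (is_derive_filterdiff f x y (PX f) (PY f x y)).
- apply (locally_2d_locally (fun u v => is_derive (fun z => f z v) u (PX f u v))).
  apply on_box_loc with r; auto. intros u v hu hv. eapply Cn_derX; eauto.
- eapply Cn_derY; eauto.
- apply (continuity_2d_pt_filterlim (PX f)). eapply (Cn_cont n); eauto. eapply Cn_PX; eauto.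
Qed.

Lemma cont_comp g p q x y :
  continuity_2d_pt g (p x y) (q x y) -> continuity_2d_pt p x y -> continuity_2d_pt q x y ->
  continuity_2d_pt (fun u v => g (p u v) (q u v)) x y.
Proof.
intros Hg Hp Hq eps. destruct (Hg eps) as [d Hd].
generalize (locally_2d_and _ _ _ _ (Hp d) (Hq d)).
apply locally_2d_impl. apply locally_2d_forall. intros u v [h1 h2]. apply Hd; auto.
Qed.

Lemma Cn_comp n r s g p q : Cn n s g -> Cn n r p -> Cn n r q ->
  on_box r (fun x y => Rabs (p x y) < s /\ Rabs (q x y) < s) ->
  Cn n r (fun x y => g (p x y) (q x y)).
Proof.
intros Hg Hp Hq Hb. revert g Hg Hp Hq.
induction n; intros g Hg Hp Hq.
- intros x y hx hy. split; auto. specialize (Hb x y hx hy) as [hb1 hb2].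
  apply cont_comp; [apply (Hg (p x y) (q x y))|apply (Hp x y)|apply (Hq x y)]; auto.
- assert (Hp' : Cn n r p) by cn.
  assert (Hq' : Cn n r q) by cn.
  apply Cn_of_partials with
   (fun x y => PX g (p x y) (q x y) * PX p x y + PY g (p x y) (q x y) * PX q x y)
   (fun x y => PX g (p x y) (q x y) * PY p x y + PY g (p x y) (q x y) * PY q x y).
  + intros x y hx hy. specialize (Hb x y hx hy) as [hb1 hb2]. apply cont_comp; eapply Cn_cont; eauto.
  + intros x y hx hy. specialize (Hb x y hx hy) as [hb1 hb2]. apply is_derive_Reals.
    apply (derivable_pt_lim_comp_2d g (fun t => p t y) (fun t => q t y)).
    * eapply Cn_differentiable; eauto.
    * apply is_derive_Reals. eapply Cn_derX; eauto.
    * apply is_derive_Reals. eapply Cn_derX; eauto.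
  + intros x y hx hy. specialize (Hb x y hx hy) as [hb1 hb2]. apply is_derive_Reals.
    apply (derivable_pt_lim_comp_2d g (fun t => p x t) (fun t => q x t)).
    * eapply Cn_differentiable; eauto.
    * apply is_derive_Reals. eapply Cn_derY; eauto.
    * apply is_derive_Reals. eapply Cn_derY; eauto.
  + apply Cn_plus; apply Cn_mult; try cn; apply IHn; cn.
  + apply Cn_plus; apply Cn_mult; try cn; apply IHn; cn.
Qed.

(** The derivative of 1/f is a polynomial in f' and 1/f itself, so the
    induction closes. *)
Lemma Cn_inv n r f : Cn n r f -> on_box r (fun x y => f x y <> 0) -> Cn n r (fun x y => / f x y).
Proof.
intros Hf Hn. revert Hf; induction n; intros Hf.
- intros x y hx hy. split; auto. apply continuity_2d_pt_inv; auto. apply (Hf x y); auto.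
- assert (Hi : Cn n r (fun x y => / f x y)) by (apply IHn; cn).
  apply Cn_of_partials with (fun x y => -1 * (PX f x y * (/ f x y * / f x y)))
                  (fun x y => -1 * (PY f x y * (/ f x y * / f x y))).
  + intros x y hx hy. apply continuity_2d_pt_inv; auto. eapply Cn_cont; eauto.
  + intros x y hx hy.
    replace (-1 * _) with (- PX f x y / (f x y) ^ 2) by (field; auto).
    apply (is_derive_inv (fun z => f z y)); auto. eapply Cn_derX; eauto.
  + intros x y hx hy.
    replace (-1 * _) with (- PY f x y / (f x y) ^ 2) by (field; auto).
    apply (is_derive_inv (fun z => f x z)); auto. eapply Cn_derY; eauto.
  + apply Cn_mult; [apply Cn_const|]. apply Cn_mult; [apply Cn_PX; auto|]. apply Cn_mult; auto.
  + apply Cn_mult; [apply Cn_const|]. apply Cn_mult; [apply Cn_PY; auto|]. apply Cn_mult; auto.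
Qed.

Lemma Cn_exp n r f : Cn n r f -> Cn n r (fun x y => exp (f x y)).
Proof.
induction n; intros Hf.
- intros x y hx hy. split; auto. apply (continuity_1d_2d_pt_comp exp).
  apply derivable_continuous_pt, derivable_pt_exp. apply (Hf x y); auto.
- assert (Hi : Cn n r (fun x y => exp (f x y))) by (apply IHn; cn).
  apply Cn_of_partials with (fun x y => PX f x y * exp (f x y)) (fun x y => PY f x y * exp (f x y)).
  + intros x y hx hy. apply (continuity_1d_2d_pt_comp exp).
    apply derivable_continuous_pt, derivable_pt_exp. eapply Cn_cont; eauto.
  + intros x y hx hy. apply (is_derive_comp exp (fun z => f z y)).
    apply is_derive_exp. eapply Cn_derX; eauto.
  + intros x y hx hy. apply (is_derive_comp exp (fun z => f x z)).
    apply is_derive_exp. eapply Cn_derY; eauto.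
  + apply Cn_mult; auto. apply Cn_PX; auto.
  + apply Cn_mult; auto. apply Cn_PY; auto.
Qed.

Lemma Cn_ln n r f : Cn n r f -> on_box r (fun x y => 0 < f x y) -> Cn n r (fun x y => ln (f x y)).
Proof.
intros Hf Hpos.
assert (Hc : on_box r (continuity_2d_pt (fun x y => ln (f x y)))).
{ intros x y hx hy. apply (continuity_1d_2d_pt_comp ln).
  - apply derivable_continuous_pt. exists (/ f x y). apply derivable_pt_lim_ln. apply Hpos; auto.
  - eapply Cn_cont; eauto. }
destruct n.
- intros x y hx hy. split; [apply Hc; assumption | exact I].
- assert (Hi : Cn n r (fun x y => / f x y)).
  { apply Cn_inv. apply Cn_le with (S n); [lia|assumption]. intros x y hx hy. specialize (Hpos x y hx hy). lra. }
  apply Cn_of_partials with (fun x y => PX f x y * / f x y) (fun x y => PY f x y * / f x y); auto.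
  + intros x y hx hy. apply (is_derive_comp ln (fun z => f z y)).
    apply is_derive_ln. apply Hpos; auto. eapply Cn_derX; eauto.
  + intros x y hx hy. apply (is_derive_comp ln (fun z => f x z)).
    apply is_derive_ln. apply Hpos; auto. eapply Cn_derY; eauto.
  + apply Cn_mult; auto. apply Cn_PX; auto.
  + apply Cn_mult; auto. apply Cn_PY; auto.
Qed.

(** The integral remainders: the Hadamard quotient (f(x,y) - f(0,y)) / x is
    the moment of order 0 of f_x. All orders are kept, because differentiating
    in x raises the order by one. *)
Definition moment (k : nat) (f : R -> R -> R) (x y : R) : R :=
  RInt (fun t => t ^ k * f (t * x) y) 0 1.

Lemma Rabs_scale_lt t x r : 0 <= t <= 1 -> Rabs x < r -> Rabs (t * x) < r.
Proof.
intros ht hx. rewrite Rabs_mult, (Rabs_pos_eq t) by lra.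
pose proof (Rabs_pos x). nra.
Qed.

Lemma moment_cont_t k f r x y t : Cn 0 r f -> Rabs x < r -> Rabs y < r -> 0 <= t <= 1 ->
  continuous (fun s => s ^ k * f (s * x) y) t.
Proof.
intros Hf hx hy ht. apply (continuous_mult (fun s => s ^ k) (fun s => f (s * x) y)).
- apply (ex_derive_continuous (V := R_NormedModule)). auto_derive. auto.
- apply continuity_pt_filterlim.
  intros eps he.
  destruct (Hf (t * x) y (Rabs_scale_lt _ _ _ ht hx) hy) as [Hc _].
  specialize (Hc (mkposreal eps he)). apply locally_2d_1d_const_y in Hc.
  assert (Hm : continuous (fun s => s * x) t) by (apply (ex_derive_continuous (V := R_NormedModule)); auto_derive; auto).
  specialize (Hm _ Hc). destruct Hm as [d Hd].
  exists d. split. apply cond_pos. intros s [_ hs]. apply Hd. exact hs.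
Qed.

Lemma moment_ex k f r x y : Cn 0 r f -> Rabs x < r -> Rabs y < r ->
  ex_RInt (fun t => t ^ k * f (t * x) y) 0 1.
Proof.
intros. apply (@ex_RInt_continuous R_CompleteNormedModule). intros t ht.
rewrite Rmin_left, Rmax_right in ht by lra.
eapply moment_cont_t; eauto.
Qed.

Lemma pow_unit_interval k t : 0 <= t <= 1 -> 0 <= t ^ k <= 1.
Proof. intros ht. induction k; simpl; [lra|]. nra. Qed.

(** Uniform continuity of f on a compact square makes the integrand uniformly
    close for all t. *)
Lemma moment_cont k f r : Cn 0 r f -> on_box r (continuity_2d_pt (moment k f)).
Proof.
intros Hf x y hx hy eps.
set (m := Rmax (Rabs x) (Rabs y)).
assert (hm : m < r) by (apply Rmax_lub_lt; auto).
pose proof (Rmax_l (Rabs x) (Rabs y)) as hmx. pose proof (Rmax_r (Rabs x) (Rabs y)) as hmy.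
fold m in hmx, hmy. pose proof (Rabs_pos x).
set (b := (m + r) / 2).
assert (he : 0 < eps / 2) by (destruct eps; simpl; lra).
destruct (uniform_continuity_2d f (-b) b (-b) b) with (eps := mkposreal _ he) as [d Hd].
{ intros u v hu hv. apply (Cn_cont 0 r); auto; unfold b in *; apply Rabs_def1; lra. }
assert (hd : 0 < Rmin d (b - m)) by (apply Rmin_pos; [apply cond_pos| unfold b; lra]).
exists (mkposreal _ hd); simpl; intros u v hu hv.
pose proof (Rmin_l d (b - m)). pose proof (Rmin_r d (b - m)).
assert (hu' : Rabs u < b).
{ replace u with ((u - x) + x) by ring. eapply Rle_lt_trans. apply Rabs_triang. lra. }
assert (hv' : Rabs v < b).
{ replace v with ((v - y) + y) by ring. eapply Rle_lt_trans. apply Rabs_triang. lra. }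
assert (hb : b < r) by (unfold b; lra).
unfold moment.
rewrite <- (RInt_minus (V := R_CompleteNormedModule)) by (eapply moment_ex; eauto; lra).
apply Rle_lt_trans with ((1 - 0) * (eps / 2)); [|destruct eps; simpl in *; lra].
apply abs_RInt_le_const; [lra| |].
- apply (ex_RInt_minus (V := R_CompleteNormedModule)); eapply moment_ex; eauto; lra.
- intros t ht. unfold minus, plus, opp; simpl.
  replace (_ + _) with (t ^ k * (f (t * u) v - f (t * x) y)) by ring.
  rewrite Rabs_mult, (Rabs_pos_eq (t ^ k)) by (apply pow_unit_interval; auto).
  assert (Rabs (f (t * u) v - f (t * x) y) < eps / 2).
  { assert (htx := Rabs_scale_lt t x b ht ltac:(lra)). assert (htu := Rabs_scale_lt t u b ht hu').
    assert (hyb : Rabs y < b) by lra.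
    apply Rabs_def2 in htx. apply Rabs_def2 in htu. apply Rabs_def2 in hyb. apply Rabs_def2 in hv'.
    apply Hd; try lra.
    replace (t * u - t * x) with (t * (u - x)) by ring. apply Rabs_scale_lt; auto; lra. }
  pose proof (pow_unit_interval k t ht). pose proof (Rabs_pos (f (t * u) v - f (t * x) y)). nra.
Qed.

(** Differentiation under the integral sign: the partial derivatives of a
    moment are moments of the partial derivatives. *)
Lemma Cn_moment n k r f : Cn n r f -> Cn n r (moment k f).
Proof.
revert k f; induction n; intros k f Hf.
- intros x y hx hy. split; auto. eapply moment_cont; eauto.
- assert (H0 : Cn 0 r f) by (eapply Cn_le; [|eauto]; lia).
  assert (HX0 : Cn 0 r (PX f)) by (eapply Cn_le; [|eapply Cn_PX; eauto]; lia).
  assert (HY0 : Cn 0 r (PY f)) by (eapply Cn_le; [|eapply Cn_PY; eauto]; lia).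
  apply Cn_of_partials with (moment (S k) (PX f)) (moment k (PY f)).
  + eapply moment_cont; eauto.
  + intros x y hx hy.
    assert (D : forall u t, Rabs (t * u) < r ->
      is_derive (fun z => t ^ k * f (t * z) y) u (t ^ S k * PX f (t * u) y)).
    { intros u t htu.
      replace (t ^ S k * PX f (t * u) y) with (t ^ k * (t * PX f (t * u) y)) by (simpl; ring).
      apply (is_derive_scal (fun z => f (t * z) y)).
      apply (is_derive_comp (fun z => f z y) (fun z => t * z)).
      - eapply Cn_derX; eauto.
      - evar_last. auto_derive; auto. ring. }
    assert (HL : locally x (fun u => Rabs u < r)).
    { assert (hd : 0 < r - Rabs x) by lra. exists (mkposreal _ hd). intros u hu.
      change (Rabs (u - x) < r - Rabs x) in hu.
      replace u with ((u - x) + x) by ring. eapply Rle_lt_trans. apply Rabs_triang. lra. }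
    evar_last. apply (is_derive_RInt_param (fun u t => t ^ k * f (t * u) y) 0 1 x).
    * revert HL. apply filter_imp. intros u hu t ht.
      rewrite Rmin_left, Rmax_right in ht by lra.
      eexists. apply D. apply Rabs_scale_lt; auto.
    * intros t ht. rewrite Rmin_left, Rmax_right in ht by lra.
      apply continuity_2d_pt_ext_loc with (fun u s => s ^ S k * PX f (s * u) y).
      -- assert (Hc : continuity_2d_pt (fun u s => s * u) x t).
         { apply continuity_2d_pt_mult. apply continuity_2d_pt_id2. apply continuity_2d_pt_id1. }
         assert (hd : 0 < r - Rabs (t * x)) by (pose proof (Rabs_scale_lt t x r ht hx); lra).
         specialize (Hc (mkposreal _ hd)). simpl in Hc.
         revert Hc. apply locally_2d_impl. apply locally_2d_forall. intros u s hs.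
         symmetry. apply is_derive_unique. apply D.
         replace (s * u) with ((s * u - t * x) + t * x) by ring.
         eapply Rle_lt_trans. apply Rabs_triang. lra.
      -- apply continuity_2d_pt_mult.
         ++ apply (continuity_1d_2d_pt_comp (fun s => s ^ S k) (fun _ s => s)).
            apply derivable_continuous_pt, derivable_pt_pow. apply continuity_2d_pt_id2.
         ++ apply (cont_comp (PX f) (fun u s => s * u) (fun _ _ => y)).
            ** eapply Cn_cont; eauto. apply Rabs_scale_lt; auto.
            ** apply continuity_2d_pt_mult. apply continuity_2d_pt_id2. apply continuity_2d_pt_id1.
            ** apply continuity_2d_pt_const.
    * revert HL. apply filter_imp. intros u hu. eapply moment_ex; eauto.
    * unfold moment. apply RInt_ext. intros t ht.
      rewrite Rmin_left, Rmax_right in ht by lra.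
      apply is_derive_unique. apply D. apply Rabs_scale_lt; auto; lra.
  + intros x y hx hy.
    assert (D : forall v t, Rabs v < r -> 0 <= t <= 1 ->
      is_derive (fun z => t ^ k * f (t * x) z) v (t ^ k * PY f (t * x) v)).
    { intros v t hv ht. apply (is_derive_scal (fun z => f (t * x) z)).
      eapply Cn_derY; eauto. apply Rabs_scale_lt; auto. }
    assert (HL : locally y (fun u => Rabs u < r)).
    { assert (hd : 0 < r - Rabs y) by lra. exists (mkposreal _ hd). intros u hu.
      change (Rabs (u - y) < r - Rabs y) in hu.
      replace u with ((u - y) + y) by ring. eapply Rle_lt_trans. apply Rabs_triang. lra. }
    evar_last. apply (is_derive_RInt_param (fun v t => t ^ k * f (t * x) v) 0 1 y).
    * revert HL. apply filter_imp. intros u hu t ht.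
      rewrite Rmin_left, Rmax_right in ht by lra.
      eexists. apply D; auto.
    * intros t ht. rewrite Rmin_left, Rmax_right in ht by lra.
      apply continuity_2d_pt_ext_loc with (fun v s => s ^ k * PY f (s * x) v).
      -- assert (Hc : continuity_2d_pt (fun u s => s * x) y t).
         { apply continuity_2d_pt_mult. apply continuity_2d_pt_id2. apply continuity_2d_pt_const. }
         assert (hd : 0 < r - Rabs (t * x)) by (pose proof (Rabs_scale_lt t x r ht hx); lra).
         specialize (Hc (mkposreal _ hd)). simpl in Hc.
         assert (Hv := continuity_2d_pt_id1 y t).
         assert (hd2 : 0 < r - Rabs y) by lra.
         specialize (Hv (mkposreal _ hd2)). simpl in Hv.
         generalize (locally_2d_and _ _ _ _ Hc Hv).
         apply locally_2d_impl. apply locally_2d_forall. intros v s [hs hv].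
         symmetry. apply is_derive_unique. apply (is_derive_scal (fun z => f (s * x) z)).
         eapply Cn_derY; eauto.
         ++ replace (s * x) with ((s * x - t * x) + t * x) by ring.
            eapply Rle_lt_trans. apply Rabs_triang. lra.
         ++ replace v with ((v - y) + y) by ring.
            eapply Rle_lt_trans. apply Rabs_triang. lra.
      -- apply continuity_2d_pt_mult.
         ++ apply (continuity_1d_2d_pt_comp (fun s => s ^ k) (fun _ s => s)).
            apply derivable_continuous_pt, derivable_pt_pow. apply continuity_2d_pt_id2.
         ++ apply (cont_comp (PY f) (fun u s => s * x) (fun v _ => v)).
            ** eapply Cn_cont; eauto. apply Rabs_scale_lt; auto.
            ** apply continuity_2d_pt_mult. apply continuity_2d_pt_id2. apply continuity_2d_pt_const.
            ** apply continuity_2d_pt_id1.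
    * revert HL. apply filter_imp. intros u hu. eapply moment_ex; eauto.
    * unfold moment. apply RInt_ext. intros t ht.
      rewrite Rmin_left, Rmax_right in ht by lra.
      apply is_derive_unique. apply D; auto; lra.
  + apply IHn. apply Cn_PX; auto.
  + apply IHn. apply Cn_PY; auto.
Qed.

(** The substitution s = t x turns the moment into a primitive of s^k f(s,y),
    divided by x^(k+1). *)
Lemma moment_FTC k f r x y : Cn 0 r f -> Rabs x < r -> Rabs y < r ->
  is_RInt (fun s => s ^ k * f s y) 0 x (x ^ S k * moment k f x y).
Proof.
intros Hf hx hy.
assert (H := RInt_correct _ _ _ (moment_ex k f r x y Hf hx hy)).
assert (Hex : ex_RInt (fun s => s ^ k * f s y) 0 x).
{ apply (@ex_RInt_continuous R_CompleteNormedModule). intros s hs.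
  assert (Rabs s < r).
  { apply Rabs_def2 in hx. unfold Rmin, Rmax in hs. destruct (Rle_dec 0 x); apply Rabs_def1; lra. }
  apply (continuous_mult (fun s => s ^ k) (fun s => f s y)).
  - apply (ex_derive_continuous (V := R_NormedModule)). auto_derive. auto.
  - apply continuity_pt_filterlim. intros eps he.
    destruct (Hf s y H0 hy) as [Hc _].
    specialize (Hc (mkposreal eps he)). apply locally_2d_1d_const_y in Hc. destruct Hc as [d Hd].
    exists d. split. apply cond_pos. intros u [_ hu]. apply Hd. exact hu. }
evar_last. apply (RInt_correct (V := R_CompleteNormedModule)), Hex.
transitivity (RInt (fun s => s ^ k * f s y) (x * 0 + 0) (x * 1 + 0)).
{ f_equal; ring. }
rewrite <- (RInt_comp_lin (V := R_CompleteNormedModule)).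
2:{ replace (x * 0 + 0) with 0 by ring. replace (x * 1 + 0) with x by ring. exact Hex. }
transitivity (RInt (fun t => scal (x ^ S k) (t ^ k * f (t * x) y)) 0 1).
- apply RInt_ext. intros t _. unfold scal; simpl; unfold mult; simpl.
  replace (x * t + 0) with (t * x) by ring. rewrite Rpow_mult_distr. ring.
- rewrite (RInt_scal (V := R_CompleteNormedModule)). reflexivity. eapply moment_ex; eauto.
Qed.

(** * Germs of smooth functions and their Taylor expansions *)

Definition near (P : R -> R -> Prop) : Prop := locally_2d P 0 0.

Lemma near_mp (P Q : R -> R -> Prop) : near P -> near (fun x y => P x y -> Q x y) -> near Q.
Proof. intros HP HQ. exact (locally_2d_impl _ _ _ _ HQ HP). Qed.
Lemma near_all (P : R -> R -> Prop) : (forall x y, P x y) -> near P.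
Proof. apply locally_2d_forall. Qed.
Lemma near_at (P : R -> R -> Prop) : near P -> P 0 0.
Proof. apply locally_2d_singleton. Qed.
Lemma near_box (P : R -> R -> Prop) : near P <-> exists r, 0 < r /\ on_box r P.
Proof.
split.
- intros [d Hd]. exists d. split. apply cond_pos.
  intros x y hx hy. apply Hd; rewrite Rminus_0_r; auto.
- intros [r [hr H]]. exists (mkposreal r hr). intros u v. simpl.
  rewrite !Rminus_0_r. apply H.
Qed.
Lemma on_box_shrink r s P : s <= r -> on_box r P -> on_box s P.
Proof. intros H HP x y hx hy. apply HP; lra. Qed.

Lemma smooth2_box f : smooth2 f <-> exists r, 0 < r /\ forall n, Cn n r f.
Proof.
split.
- intros H. apply near_box in H. destruct H as [r [hr H]]. exists r. split; auto.
  intros n x y hx hy. apply H; auto.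
- intros [r [hr H]]. apply near_box. exists r. split; auto. intros x y hx hy n. apply H; auto.
Qed.

Lemma smooth2_cont f : smooth2 f -> continuity_2d_pt f 0 0.
Proof. intros H. apply near_at in H. apply (H 0%nat). Qed.

Lemma smooth2_ext f g : near (fun x y => f x y = g x y) -> smooth2 f -> smooth2 g.
Proof.
intros H Hf. apply smooth2_box in Hf. destruct Hf as [r [hr Hf]].
apply near_box in H. destruct H as [s [hs H]]. apply smooth2_box.
exists (Rmin r s). split. apply Rmin_pos; auto. intros n.
apply Cn_ext with f.
- apply on_box_shrink with s; auto. apply Rmin_r.
- apply Cn_shrink with r; auto. apply Rmin_l.
Qed.

Lemma smooth2_lift1 f (g : R -> R -> R) :
  (forall n r, Cn n r f -> Cn n r g) -> smooth2 f -> smooth2 g.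
Proof.
intros H Hf. apply smooth2_box in Hf. destruct Hf as [r [hr Hf]].
apply smooth2_box. exists r. auto.
Qed.
Lemma smooth2_lift2 f1 f2 (g : R -> R -> R) :
  (forall n r, Cn n r f1 -> Cn n r f2 -> Cn n r g) -> smooth2 f1 -> smooth2 f2 -> smooth2 g.
Proof.
intros H Hf Hg. apply smooth2_box in Hf. destruct Hf as [r [hr Hf]].
apply smooth2_box in Hg. destruct Hg as [s [hs Hg]].
apply smooth2_box. exists (Rmin r s). split. apply Rmin_pos; auto.
intros n. apply H.
- apply Cn_shrink with r; auto. apply Rmin_l.
- apply Cn_shrink with s; auto. apply Rmin_r.
Qed.

Lemma smooth2_const c : smooth2 (fun _ _ => c).
Proof. apply smooth2_box. exists 1. split; [lra|]. intros n. apply Cn_const. Qed.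
Lemma smooth2_fst : smooth2 (fun x _ => x).
Proof. apply smooth2_box. exists 1. split; [lra|]. intros n. apply Cn_fst. Qed.
Lemma smooth2_snd : smooth2 (fun _ y => y).
Proof. apply smooth2_box. exists 1. split; [lra|]. intros n. apply Cn_snd. Qed.
Lemma smooth2_plus f g : smooth2 f -> smooth2 g -> smooth2 (fun x y => f x y + g x y).
Proof. apply smooth2_lift2. intros. apply Cn_plus; auto. Qed.
Lemma smooth2_mult f g : smooth2 f -> smooth2 g -> smooth2 (fun x y => f x y * g x y).
Proof. apply smooth2_lift2. intros. apply Cn_mult; auto. Qed.
Lemma smooth2_opp f : smooth2 f -> smooth2 (fun x y => - f x y).
Proof.
intros H. apply smooth2_ext with (fun x y => -1 * f x y).
apply near_all; intros; ring. apply smooth2_mult; auto. apply smooth2_const.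
Qed.
Lemma smooth2_minus f g : smooth2 f -> smooth2 g -> smooth2 (fun x y => f x y - g x y).
Proof. intros. apply smooth2_plus; auto. apply smooth2_opp; auto. Qed.
Lemma smooth2_pow f n : smooth2 f -> smooth2 (fun x y => f x y ^ n).
Proof.
intros H. induction n; simpl. apply smooth2_const. apply smooth2_mult; auto.
Qed.
Lemma smooth2_PX f : smooth2 f -> smooth2 (PX f).
Proof.
intros Hf. apply smooth2_box in Hf. destruct Hf as [r [hr Hf]].
apply smooth2_box. exists r. split; auto. intros n. apply Cn_PX; auto.
Qed.
Lemma smooth2_PY f : smooth2 f -> smooth2 (PY f).
Proof.
intros Hf. apply smooth2_box in Hf. destruct Hf as [r [hr Hf]].
apply smooth2_box. exists r. split; auto. intros n. apply Cn_PY; auto.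
Qed.
Lemma smooth2_moment k f : smooth2 f -> smooth2 (moment k f).
Proof. apply smooth2_lift1. intros. apply Cn_moment; auto. Qed.
Lemma smooth2_exp f : smooth2 f -> smooth2 (fun x y => exp (f x y)).
Proof. apply smooth2_lift1. intros. apply Cn_exp; auto. Qed.

Lemma near_bounded f s : smooth2 f -> f 0 0 = 0 -> 0 < s -> near (fun x y => Rabs (f x y) < s).
Proof.
intros Hf H0 hs. generalize (smooth2_cont f Hf (mkposreal s hs)).
apply locally_2d_impl. apply locally_2d_forall. intros u v. rewrite H0, Rminus_0_r. auto.
Qed.

Lemma near_comp P p q : near P -> smooth2 p -> smooth2 q -> p 0 0 = 0 -> q 0 0 = 0 ->
  near (fun x y => P (p x y) (q x y)).
Proof.
intros H Hp Hq p0 q0. apply near_box in H. destruct H as [s [hs H]].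
apply (near_mp _ _ (near_bounded p s Hp p0 hs)), (near_mp _ _ (near_bounded q s Hq q0 hs)).
apply near_all. intros x y h1 h2. apply H; auto.
Qed.

Lemma smooth2_comp g p q : smooth2 g -> smooth2 p -> smooth2 q -> p 0 0 = 0 -> q 0 0 = 0 ->
  smooth2 (fun x y => g (p x y) (q x y)).
Proof.
intros Hg Hp Hq p0 q0.
apply smooth2_box in Hg. destruct Hg as [s [hs Hg]].
assert (Hb : near (fun x y => Rabs (p x y) < s /\ Rabs (q x y) < s)).
{ apply locally_2d_and; apply near_bounded; auto. }
apply smooth2_box in Hp. destruct Hp as [r1 [hr1 Hp]].
apply smooth2_box in Hq. destruct Hq as [r2 [hr2 Hq]].
apply near_box in Hb. destruct Hb as [r3 [hr3 Hb]].
apply smooth2_box. exists (Rmin r1 (Rmin r2 r3)).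
split. repeat apply Rmin_pos; auto.
pose proof (Rmin_l r1 (Rmin r2 r3)). pose proof (Rmin_r r1 (Rmin r2 r3)).
pose proof (Rmin_l r2 r3). pose proof (Rmin_r r2 r3).
intros n. apply Cn_comp with s; auto.
- apply Cn_shrink with r1; auto.
- apply Cn_shrink with r2; auto; lra.
- apply on_box_shrink with r3; auto; lra.
Qed.

Lemma near_neq0 f : smooth2 f -> f 0 0 <> 0 -> near (fun x y => f x y <> 0).
Proof. intros Hf H0. apply continuity_2d_pt_neq_0; auto. apply smooth2_cont; auto. Qed.
Lemma near_pos f : smooth2 f -> 0 < f 0 0 -> near (fun x y => 0 < f x y).
Proof.
intros Hf H0. generalize (smooth2_cont f Hf (mkposreal _ H0)).
apply locally_2d_impl. apply locally_2d_forall. simpl. intros u v h.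
apply Rabs_def2 in h. lra.
Qed.

Lemma smooth2_inv f : smooth2 f -> f 0 0 <> 0 -> smooth2 (fun x y => / f x y).
Proof.
intros Hf H0. generalize (near_neq0 f Hf H0). intros Hn.
apply smooth2_box in Hf. destruct Hf as [r [hr Hf]].
apply near_box in Hn. destruct Hn as [s [hs Hn]].
apply smooth2_box. exists (Rmin r s). split. apply Rmin_pos; auto.
intros n. apply Cn_inv.
- apply Cn_shrink with r; auto. apply Rmin_l.
- apply on_box_shrink with s; auto. apply Rmin_r.
Qed.
Lemma smooth2_div f g : smooth2 f -> smooth2 g -> g 0 0 <> 0 -> smooth2 (fun x y => f x y / g x y).
Proof. intros. apply smooth2_mult; auto. apply smooth2_inv; auto. Qed.
Lemma smooth2_ln f : smooth2 f -> 0 < f 0 0 -> smooth2 (fun x y => ln (f x y)).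
Proof.
intros Hf H0. generalize (near_pos f Hf H0). intros Hn.
apply smooth2_box in Hf. destruct Hf as [r [hr Hf]].
apply near_box in Hn. destruct Hn as [s [hs Hn]].
apply smooth2_box. exists (Rmin r s). split. apply Rmin_pos; auto.
intros n. apply Cn_ln.
- apply Cn_shrink with r; auto. apply Rmin_l.
- apply on_box_shrink with s; auto. apply Rmin_r.
Qed.

Lemma exp_pow a n : exp a ^ n = exp (INR n * a).
Proof.
induction n; [simpl; rewrite Rmult_0_l, exp_0; auto|].
rewrite S_INR. simpl. rewrite IHn, <- exp_plus. f_equal. ring.
Qed.

(** Only meant for t > 0; written with exp and ln so that its smoothness
    follows from theirs. *)
Definition root (n : nat) (t : R) : R := exp (ln t / INR n).
Lemma root_pos n t : 0 < root n t.
Proof. apply exp_pos. Qed.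
Lemma root_pow n t : (0 < n)%nat -> 0 < t -> root n t ^ n = t.
Proof.
intros hn ht. unfold root. rewrite <- (exp_ln t) at 2 by auto.
rewrite exp_pow. f_equal. field. apply not_0_INR. lia.
Qed.
Lemma smooth2_root n f : smooth2 f -> 0 < f 0 0 -> smooth2 (fun x y => root n (f x y)).
Proof.
intros Hf H0. apply smooth2_exp. apply smooth2_mult. apply smooth2_ln; auto. apply smooth2_const.
Qed.

Ltac smooth := repeat (cbv beta;
  match goal with
  | |- smooth2 (fun _ _ => ?c) => apply (smooth2_const c)
  | |- smooth2 (fun x _ => x) => apply smooth2_fst
  | |- smooth2 (fun _ y => y) => apply smooth2_snd
  | H : smooth2 ?f |- smooth2 ?f => exact H
  | H : smooth2 ?f |- smooth2 (fun x y => ?f x y) => exact H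
  | |- smooth2 (fun x y => @?f x y + @?g x y) => apply (smooth2_plus f g)
  | |- smooth2 (fun x y => @?f x y - @?g x y) => apply (smooth2_minus f g)
  | |- smooth2 (fun x y => @?f x y * @?g x y) => apply (smooth2_mult f g)
  | |- smooth2 (fun x y => - @?f x y) => apply (smooth2_opp f)
  | |- smooth2 (fun x y => @?f x y ^ ?n) => apply (smooth2_pow f n)
  | |- smooth2 (fun x y => @?f x y / @?g x y) => apply (smooth2_div f g)
  | |- smooth2 (fun x y => / @?f x y) => apply (smooth2_inv f)
  | |- smooth2 (fun x y => root ?n (@?f x y)) => apply (smooth2_root n f)
  | H : smooth2 ?g |- smooth2 (fun x y => ?g (@?p x y) (@?q x y)) => apply (smooth2_comp g p q H)
  end); try assumption.

Lemma germ2_fst : germ2 (fun x _ => x).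
Proof. split; [apply smooth2_fst | reflexivity]. Qed.
Lemma germ2_snd : germ2 (fun _ y => y).
Proof. split; [apply smooth2_snd | reflexivity]. Qed.
Lemma germ2_comp g p q : germ2 g -> germ2 p -> germ2 q -> germ2 (fun x y => g (p x y) (q x y)).
Proof.
intros [Hg g0] [Hp p0] [Hq q0]. split. apply smooth2_comp; auto. rewrite p0, q0; auto.
Qed.

(** Functions of one variable are treated throughout as functions of (x, y)
    that do not depend on x; this translates back. *)
Lemma smooth1_of_smooth2 g : smooth2 (fun _ y => g y) -> smooth1 g.
Proof.
intros H. apply locally_2d_1d_const_x in H. unfold smooth1. revert H. apply filter_imp. intros t H n.
destruct n; simpl; auto.
apply (ex_diff_n_ex_deriv_inf_2 (S n) 0 n ltac:(lia) (fun _ y => g y) 0 t (H (S n))).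
Qed.

Lemma smooth2_derX f : smooth2 f -> near (fun x y => is_derive (fun z => f z y) x (PX f x y)).
Proof.
intros H. apply smooth2_box in H. destruct H as [r [hr H]]. apply near_box. exists r. split; auto.
intros x y hx hy. eapply (Cn_derX 0); eauto.
Qed.
Lemma smooth2_derY f : smooth2 f -> near (fun x y => is_derive (fun z => f x z) y (PY f x y)).
Proof.
intros H. apply smooth2_box in H. destruct H as [r [hr H]]. apply near_box. exists r. split; auto.
intros x y hx hy. eapply (Cn_derY 0); eauto.
Qed.

Lemma smooth2_partial f i j : smooth2 f -> smooth2 (partial_derive i j f).
Proof.
intros H. induction i.
- induction j. exact H. apply (smooth2_PY _ IHj).
- apply (smooth2_PX _ IHi).
Qed.

Lemma is_derive_taylor_poly (c : nat -> R) n x :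
  is_derive (fun z => sum_f_R0 (fun i => c i / INR (fact i) * z ^ i) (S n)) x
    (sum_f_R0 (fun i => c (S i) / INR (fact i) * x ^ i) n).
Proof.
induction n.
- simpl. auto_derive; auto. field.
- change (is_derive (fun z => sum_f_R0 (fun i => c i / INR (fact i) * z ^ i) (S n)
      + c (S (S n)) / INR (fact (S (S n))) * z ^ (S (S n))) x
   (sum_f_R0 (fun i => c (S i) / INR (fact i) * x ^ i) n
      + c (S (S n)) / INR (fact (S n)) * x ^ (S n))).
  apply (is_derive_plus (fun z => sum_f_R0 (fun i => c i / INR (fact i) * z ^ i) (S n))); auto.
  replace (c (S (S n)) / INR (fact (S n))) with (c (S (S n)) / INR (fact (S (S n))) * INR (S (S n))).
  { generalize (c (S (S n)) / INR (fact (S (S n)))). intros k.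
    evar_last. apply (is_derive_scal (fun z => z ^ (S (S n)))).
    apply (is_derive_pow (fun z => z)). apply (is_derive_id x). simpl pred.
    unfold one; simpl. ring. }
  replace (INR (fact (S (S n)))) with (INR (S (S n)) * INR (fact (S n)))
    by (rewrite <- mult_INR; reflexivity).
  field. split; [apply INR_fact_neq_0 | apply not_0_INR; lia].
Qed.

Definition dX (f : R -> R -> R) (i : nat) (x y : R) : R := Derive_n (fun z => f z y) i x.
Definition dY (f : R -> R -> R) (j : nat) (x y : R) : R := Derive_n (fun z => f x z) j y.

Lemma moment_der k f r x y : Cn 0 r f -> Rabs x < r -> Rabs y < r ->
  is_derive (fun z => z ^ S k * moment k f z y) x (x ^ k * f x y).
Proof.
intros Hf hx hy.
apply (is_derive_RInt (fun s => s ^ k * f s y) (fun z => z ^ S k * moment k f z y) 0 x).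
- assert (hd : 0 < r - Rabs x) by lra. exists (mkposreal _ hd). intros u hu.
  change (Rabs (u - x) < r - Rabs x) in hu. apply moment_FTC with r; auto.
  replace u with ((u - x) + x) by ring. eapply Rle_lt_trans. apply Rabs_triang. lra.
- apply (continuous_mult (fun s => s ^ k) (fun s => f s y)).
  + apply (ex_derive_continuous (V := R_NormedModule)). auto_derive. auto.
  + apply continuity_pt_filterlim. intros eps he.
    destruct (Hf x y hx hy) as [Hc _].
    specialize (Hc (mkposreal eps he)). apply locally_2d_1d_const_y in Hc. destruct Hc as [d Hd].
    exists d. split. apply cond_pos. intros u [_ hu]. apply Hd. exact hu.
Qed.

Lemma zero_der_const (g : R -> R) r : (forall x, Rabs x < r -> is_derive g x 0) ->
  forall x, Rabs x < r -> g x = g 0.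
Proof.
intros H x hx. assert (hr : 0 < r) by (pose proof (Rabs_pos x); lra).
assert (hin : forall t, Rmin 0 x <= t <= Rmax 0 x -> Rabs t < r).
{ intros t ht. apply Rabs_def2 in hx. unfold Rmin, Rmax in ht.
  destruct (Rle_dec 0 x); apply Rabs_def1; lra. }
destruct (MVT_gen g 0 x (fun _ => 0)) as [c [_ hc]].
- intros t ht. apply H, hin; lra.
- intros t ht. apply continuity_pt_filterlim. apply (ex_derive_continuous (V := R_NormedModule)).
  exists 0. apply H, hin; lra.
- lra.
Qed.

(** The expansion at order n + 1 of f comes from integrating in x the
    expansion at order n of f_x: both sides have the same x-derivative and
    agree at x = 0. *)
Lemma taylor_X f n : smooth2 f -> exists Rm, smooth2 Rm /\
  near (fun x y => f x y = sum_f_R0 (fun i => dX f i 0 y / INR (fact i) * x ^ i) n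
                           + x ^ S n * Rm x y).
Proof.
revert f. induction n; intros f Hf.
- exists (moment 0 (PX f)). split. apply smooth2_moment, smooth2_PX; auto.
  assert (HX := smooth2_PX f Hf).
  apply smooth2_box in Hf. destruct Hf as [r [hr Hf]].
  apply near_box. exists r. split; auto. intros x y hx hy.
  set (g := fun z => f z y - z ^ 1 * moment 0 (PX f) z y).
  assert (E : g x = g 0).
  { apply zero_der_const with r; auto. intros u hu. unfold g.
    replace 0 with (PX f u y - u ^ 0 * PX f u y) by (simpl; ring).
    apply (is_derive_minus (fun z => f z y)).
    - apply (Cn_derX 0 r); auto.
    - apply moment_der with r; auto. apply Cn_PX; auto. }
  unfold g in E. unfold dX. simpl in *. lra.
- destruct (IHn (PX f) (smooth2_PX f Hf)) as [Rm [HR E]].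
  exists (moment (S n) Rm). split. apply smooth2_moment; auto.
  apply near_box in E. destruct E as [r1 [hr1 E]].
  apply smooth2_box in Hf. destruct Hf as [r2 [hr2 Hf]].
  apply smooth2_box in HR. destruct HR as [r3 [hr3 HR]].
  apply near_box. exists (Rmin r1 (Rmin r2 r3)). split. repeat apply Rmin_pos; auto.
  pose proof (Rmin_l r1 (Rmin r2 r3)). pose proof (Rmin_r r1 (Rmin r2 r3)).
  pose proof (Rmin_l r2 r3). pose proof (Rmin_r r2 r3). intros x y hx hy.
  set (T := fun z => sum_f_R0 (fun i => dX f i 0 y / INR (fact i) * z ^ i) (S n)).
  set (g := fun z => f z y - (T z + z ^ S (S n) * moment (S n) Rm z y)).
  assert (E' : g x = g 0).
  { apply zero_der_const with (Rmin r1 (Rmin r2 r3)); auto. intros u hu. unfold g.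
    replace 0 with (PX f u y - (sum_f_R0 (fun i => dX f (S i) 0 y / INR (fact i) * u ^ i) n
       + u ^ S n * Rm u y)).
    - apply (is_derive_minus (fun z => f z y)).
      + apply (Cn_derX 0 r2); auto; lra.
      + apply (is_derive_plus T).
        * apply (is_derive_taylor_poly (fun i => dX f i 0 y)).
        * apply moment_der with r3; auto; lra.
    - rewrite (E u y) by lra.
      replace (sum_f_R0 (fun i => dX (PX f) i 0 y / INR (fact i) * u ^ i) n) with
        (sum_f_R0 (fun i => dX f (S i) 0 y / INR (fact i) * u ^ i) n).
      ring. apply sum_eq. intros i _. f_equal. f_equal.
      unfold dX, PX. symmetry. rewrite <- (Nat.add_1_r i).
      exact (Derive_n_comp (fun z => f z y) i 1 0). }
  assert (T0 : T 0 = f 0 y).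
  { unfold T. rewrite decomp_sum by lia.
    rewrite (sum_eq _ (fun _ => 0)). rewrite sum_cte. simpl. unfold dX; simpl. field.
    intros i _. simpl. ring. }
  unfold g in E'. rewrite T0 in E'. change (f x y = T x + x ^ S (S n) * moment (S n) Rm x y).
  simpl in *. lra.
Qed.

Lemma near_swap P : near P -> near (fun x y => P y x).
Proof. intros [d H]. exists d. intros u v hu hv. apply H; auto. Qed.

Lemma smooth2_swap f : smooth2 f -> smooth2 (fun x y => f y x).
Proof. intros H. apply (smooth2_comp f (fun _ y => y) (fun x _ => x)); auto. apply smooth2_snd. apply smooth2_fst. Qed.

Lemma taylor_Y f n : smooth2 f -> exists Rm, smooth2 Rm /\
  near (fun x y => f x y = sum_f_R0 (fun j => dY f j x 0 / INR (fact j) * y ^ j) n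
                           + y ^ S n * Rm x y).
Proof.
intros Hf. destruct (taylor_X (fun x y => f y x) n (smooth2_swap f Hf)) as [Rm [HR E]].
exists (fun x y => Rm y x). split. apply smooth2_swap; auto.
apply (near_swap _ E).
Qed.

(** * The inverse function theorem in the plane *)

(** Caratheodory's form of differentiability, convenient for an inverse
    function, whose slopes come from the mean value theorem as reciprocals of
    slopes. *)
Lemma is_derive_slope (g : R -> R) t l :
  (forall eps, 0 < eps -> exists d, 0 < d /\ forall h, h <> 0 -> Rabs h < d ->
     exists k, g (t + h) - g t = k * h /\ Rabs (k - l) < eps) -> is_derive g t l.
Proof.
intros H. apply is_derive_Reals. intros eps he.
destruct (H eps he) as [d [hd Hd]]. exists (mkposreal d hd). simpl. intros h h0 hh.
destruct (Hd h h0 hh) as [k [hk hk2]]. rewrite hk.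
replace (k * h / h) with k by (field; auto). auto.
Qed.

Lemma between_lt a b z c d : Rmin a b <= z <= Rmax a b -> Rabs (a - c) < d -> Rabs (b - c) < d ->
  Rabs (z - c) < d.
Proof.
intros hz ha hb. apply Rabs_def2 in ha. apply Rabs_def2 in hb.
unfold Rmin, Rmax in hz. destruct (Rle_dec a b); apply Rabs_def1; lra.
Qed.

Section ScalarInverse.
Variables (h X : R -> R -> R) (rho s : R).
Hypothesis (Hh : forall n, Cn n rho h).
Hypothesis (Hpos : on_box rho (fun x y => 0 < PX h x y)).
Hypothesis (hs : s <= rho).
Hypothesis (HX : on_box s (fun u y => Rabs (X u y) < rho /\ h (X u y) y = u)).

Lemma local_inverse_mvt a b y : Rabs a < rho -> Rabs b < rho -> Rabs y < rho ->
  exists c, Rmin a b <= c <= Rmax a b /\ Rabs c < rho /\ h b y - h a y = PX h c y * (b - a).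
Proof.
intros ha hb hy.
assert (hin : forall t, Rmin a b <= t <= Rmax a b -> Rabs t < rho).
{ intros t ht. replace t with (t - 0) by ring. apply between_lt with a b; auto;
  rewrite Rminus_0_r; auto. }
destruct (MVT_gen (fun z => h z y) a b (fun z => PX h z y)) as [c [hc E]].
- intros t ht. apply (Cn_derX 0 rho h t y); auto. apply hin; lra.
- intros t ht. apply continuity_pt_filterlim. apply (ex_derive_continuous (V := R_NormedModule) (fun z => h z y) t).
  exists (PX h t y). apply (Cn_derX 0 rho h t y); auto.
- exists c. auto.
Qed.

Lemma local_inverse_incr a b y : Rabs a < rho -> Rabs b < rho -> Rabs y < rho -> a < b -> h a y < h b y.
Proof.
intros ha hb hy hab. destruct (local_inverse_mvt a b y ha hb hy) as [c [_ [hc E]]].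
pose proof (Hpos c y hc hy). nra.
Qed.

Lemma local_inverse_reflects_lt a b y : Rabs a < rho -> Rabs b < rho -> Rabs y < rho -> h a y < h b y -> a < b.
Proof.
intros ha hb hy hab. destruct (Rlt_or_le a b) as [|[H|H]]; auto.
- pose proof (local_inverse_incr b a y hb ha hy H). lra.
- subst. lra.
Qed.

Lemma local_inverse_inj a b y : Rabs a < rho -> Rabs b < rho -> Rabs y < rho -> h a y = h b y -> a = b.
Proof.
intros ha hb hy hab. destruct (Rtotal_order a b) as [H|[H|H]]; auto.
- pose proof (local_inverse_incr a b y ha hb hy H). lra.
- pose proof (local_inverse_incr b a y hb ha hy H). lra.
Qed.

(** The values of h at (x0 - e, y) and (x0 + e, y) stay on both sides of u for
    (u, y) close to (u0, y0), so monotonicity traps X(u, y) between x0 - e and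
    x0 + e. *)
Lemma local_inverse_cont : on_box s (continuity_2d_pt X).
Proof.
intros u0 y0 hu hy eps. destruct (HX u0 y0 hu hy) as [hx0 E0]. set (x0 := X u0 y0) in *.
assert (he : 0 < Rmin (eps / 2) ((rho - Rabs x0) / 2)).
{ apply Rmin_pos; [destruct eps; simpl|]; lra. }
set (e := Rmin (eps / 2) ((rho - Rabs x0) / 2)) in *.
assert (e <= eps / 2) by apply Rmin_l. assert (e <= (rho - Rabs x0) / 2) by apply Rmin_r.
assert (hm : Rabs (x0 - e) < rho).
{ unfold Rminus. eapply Rle_lt_trans. apply Rabs_triang. rewrite Rabs_Ropp, (Rabs_pos_eq e); lra. }
assert (hp : Rabs (x0 + e) < rho).
{ eapply Rle_lt_trans. apply Rabs_triang. rewrite (Rabs_pos_eq e); lra. }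
assert (L1 : h (x0 - e) y0 < u0) by (rewrite <- E0; apply local_inverse_incr; auto; lra).
assert (L2 : u0 < h (x0 + e) y0) by (rewrite <- E0; apply local_inverse_incr; auto; lra).
assert (hd1 : 0 < (u0 - h (x0 - e) y0) / 2) by lra.
assert (hd2 : 0 < (h (x0 + e) y0 - u0) / 2) by lra.
assert (C1 := Cn_cont 0 rho h (x0 - e) y0 (Hh 0) hm ltac:(lra) (mkposreal _ hd1)).
assert (C2 := Cn_cont 0 rho h (x0 + e) y0 (Hh 0) hp ltac:(lra) (mkposreal _ hd2)).
destruct C1 as [d1 C1]. destruct C2 as [d2 C2]. simpl in C1, C2.
assert (hd : 0 < Rmin (Rmin d1 d2) (Rmin (Rmin (s - Rabs u0) (s - Rabs y0))
    (Rmin ((u0 - h (x0 - e) y0) / 2) ((h (x0 + e) y0 - u0) / 2)))).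
{ repeat apply Rmin_pos; try apply cond_pos; lra. }
exists (mkposreal _ hd). simpl. intros u y h1 h2.
assert (hy2 := h2). apply Rmin_Rgt_l in h1. destruct h1 as [h1a h1b].
apply Rmin_Rgt_l in h2. destruct h2 as [h2a h2b].
apply Rmin_Rgt_l in h1a. apply Rmin_Rgt_l in h1b. destruct h1b as [h1b h1c].
apply Rmin_Rgt_l in h1b. apply Rmin_Rgt_l in h1c.
apply Rmin_Rgt_l in h2a. apply Rmin_Rgt_l in h2b. destruct h2b as [h2b h2c].
apply Rmin_Rgt_l in h2b.
assert (hus : Rabs u < s).
{ replace u with ((u - u0) + u0) by ring. eapply Rle_lt_trans. apply Rabs_triang. lra. }
assert (hys : Rabs y < s).
{ replace y with ((y - y0) + y0) by ring. eapply Rle_lt_trans. apply Rabs_triang. lra. }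
destruct (HX u y hus hys) as [hxu Eu].
assert (D1 : Rabs (h (x0 - e) y - h (x0 - e) y0) < (u0 - h (x0 - e) y0) / 2).
{ apply C1. rewrite Rminus_eq_0, Rabs_R0; apply cond_pos. lra. }
assert (D2 : Rabs (h (x0 + e) y - h (x0 + e) y0) < (h (x0 + e) y0 - u0) / 2).
{ apply C2. rewrite Rminus_eq_0, Rabs_R0; apply cond_pos. lra. }
destruct h1c as [h1c h1d].
apply Rabs_def2 in D1. apply Rabs_def2 in D2.
assert (hu0 : Rabs (u - u0) < (u0 - h (x0 - e) y0) / 2) by lra.
assert (hu1 : Rabs (u - u0) < (h (x0 + e) y0 - u0) / 2) by lra.
apply Rabs_def2 in hu0. apply Rabs_def2 in hu1.
assert (x0 - e < X u y) by (apply local_inverse_reflects_lt with y; auto; try lra).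
assert (X u y < x0 + e) by (apply local_inverse_reflects_lt with y; auto; try lra).
destruct eps as [ep hep]. simpl in *.
apply Rabs_def1; lra.
Qed.

Definition recip_PX (x y : R) : R := / PX h x y.

Lemma Cn_recip_PX n : Cn n rho recip_PX.
Proof.
apply Cn_inv. apply Cn_PX, Hh. intros x y hx hy. pose proof (Hpos x y hx hy). lra.
Qed.

(** By the mean value theorem the slope of X is the reciprocal of h_x at a
    point that tends to (X, y), by continuity of X. *)
Lemma local_inverse_derX u y : Rabs u < s -> Rabs y < s ->
  is_derive (fun z => X z y) u (recip_PX (X u y) y).
Proof.
intros hu hy. destruct (HX u y hu hy) as [hx0 E0].
apply is_derive_slope. intros eps he.
assert (C := Cn_cont 0 rho recip_PX (X u y) y (Cn_recip_PX 0) hx0 ltac:(lra) (mkposreal _ he)).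
destruct C as [d1 C]. simpl in C.
assert (CX := local_inverse_cont u y hu hy d1). destruct CX as [d2 CX].
exists (Rmin d2 (s - Rabs u)). split. apply Rmin_pos; [apply cond_pos | lra].
intros k k0 hk. apply Rmin_Rgt_l in hk.
assert (hus : Rabs (u + k) < s) by (eapply Rle_lt_trans; [apply Rabs_triang | lra]).
destruct (HX (u + k) y hus hy) as [hx1 E1].
assert (D : Rabs (X (u + k) y - X u y) < d1).
{ apply CX. replace (u + k - u) with k by ring. lra. rewrite Rminus_eq_0, Rabs_R0; apply cond_pos. }
destruct (local_inverse_mvt (X u y) (X (u + k) y) y hx0 hx1 ltac:(lra)) as [c [hc [hcr Ec]]].
assert (hP := Hpos c y hcr ltac:(lra)).
exists (recip_PX c y). split.
- rewrite E0, E1 in Ec. unfold recip_PX. apply (Rmult_eq_reg_l (PX h c y)); [|lra].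
  rewrite <- Ec. field. lra.
- apply C.
  + apply between_lt with (X u y) (X (u + k) y); auto. rewrite Rminus_eq_0, Rabs_R0; apply cond_pos.
  + rewrite Rminus_eq_0, Rabs_R0; apply cond_pos.
Qed.

(** The increments of h in its two variables cancel, since h(X(u,y),y) = u
    does not depend on y; two mean values then give the slope - h_y / h_x. *)
Lemma local_inverse_derY u y : Rabs u < s -> Rabs y < s ->
  is_derive (fun z => X u z) y (-1 * (PY h (X u y) y * recip_PX (X u y) y)).
Proof.
intros hu hy. destruct (HX u y hu hy) as [hx0 E0].
apply is_derive_slope. intros eps he.
destruct (continuity_2d_pt_mult (fun a _ => a) (fun _ b => b) (PY h (X u y) y) (recip_PX (X u y) y)
  (continuity_2d_pt_id1 _ _) (continuity_2d_pt_id2 _ _) (mkposreal _ he)) as [d0 C0]. simpl in C0.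
destruct (Cn_cont 0 rho recip_PX (X u y) y (Cn_recip_PX 0) hx0 ltac:(lra) d0) as [d1 C1].
destruct (Cn_cont 0 rho (PY h) (X u y) y (Cn_PY _ _ _ (Hh 1)) hx0 ltac:(lra) d0) as [d3 C3].
destruct (local_inverse_cont u y hu hy d1) as [d2 CX].
exists (Rmin (Rmin d1 d3) (Rmin d2 (s - Rabs y))). split.
{ repeat apply Rmin_pos; try apply cond_pos; lra. }
intros k k0 hk. apply Rmin_Rgt_l in hk. destruct hk as [hk1 hk2].
apply Rmin_Rgt_l in hk1. apply Rmin_Rgt_l in hk2.
assert (Z : forall d : posreal, forall a, Rabs (a - a) < d).
{ intros d a. rewrite Rminus_eq_0, Rabs_R0; apply cond_pos. }
assert (hys : Rabs (y + k) < s) by (eapply Rle_lt_trans; [apply Rabs_triang | lra]).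
destruct (HX u (y + k) hu hys) as [hx1 E1].
assert (D : Rabs (X u (y + k) - X u y) < d1).
{ apply CX; auto. replace (y + k - y) with k by ring. lra. }
(* mean values of h_x on the segment of the x-increment, then of h_y on that of the y-increment *)
destruct (local_inverse_mvt (X u y) (X u (y + k)) (y + k) hx0 hx1 ltac:(lra)) as [c [hc [hcr Ec]]].
assert (hin : forall t, Rmin y (y + k) <= t <= Rmax y (y + k) -> Rabs t < rho).
{ intros t ht. replace t with (t - 0) by ring. apply between_lt with y (y + k); auto;
  rewrite Rminus_0_r; lra. }
destruct (MVT_gen (fun z => h (X u y) z) y (y + k) (fun z => PY h (X u y) z)) as [e [hee Ee]].
{ intros t ht. apply (Cn_derY 0 rho h (X u y) t); auto. apply hin; lra. }
{ intros t ht. apply continuity_pt_filterlim. apply (ex_derive_continuous (V := R_NormedModule) (fun z => h (X u y) z) t).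
  exists (PY h (X u y) t). apply (Cn_derY 0 rho h (X u y) t); auto. }
assert (hP := Hpos c (y + k) hcr ltac:(lra)).
exists (-1 * (PY h (X u y) e * recip_PX c (y + k))). split.
- unfold recip_PX. apply (Rmult_eq_reg_l (PX h c (y + k))); [|lra].
  rewrite E1 in Ec. rewrite <- Ec. replace u with (h (X u y) y) at 1 by auto.
  replace (y + k - y) with k in Ee by ring.
  replace (h (X u y) y - h (X u y) (y + k)) with (- (PY h (X u y) e * k)) by lra.
  field. lra.
- replace (_ - _) with (- (PY h (X u y) e * recip_PX c (y + k) - PY h (X u y) y * recip_PX (X u y) y)) by ring.
  rewrite Rabs_Ropp. apply C0.
  + apply C3; auto. apply between_lt with y (y + k); auto.
    replace (y + k - y) with k by ring. lra.
  + apply C1.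
    * apply between_lt with (X u y) (X u (y + k)); auto.
    * replace (y + k - y) with k by ring. lra.
Qed.

(** Bootstrapping: the partial derivatives of X are smooth functions composed
    with X, hence as regular as X. *)
Lemma Cn_local_inverse n : Cn n s X.
Proof.
induction n.
- intros u y hu hy. split; auto. apply local_inverse_cont; auto.
- assert (HB : on_box s (fun u y => Rabs (X u y) < rho /\ Rabs y < rho)).
  { intros u y hu hy. split. apply HX; auto. lra. }
  apply Cn_of_partials with (fun u y => recip_PX (X u y) y)
                  (fun u y => -1 * (PY h (X u y) y * recip_PX (X u y) y)).
  + exact local_inverse_cont.
  + intros u y. apply local_inverse_derX.
  + intros u y. apply local_inverse_derY.
  + apply (Cn_comp n s rho recip_PX X (fun _ y => y)); auto using Cn_recip_PX, Cn_snd.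
  + apply Cn_mult. apply Cn_const. apply Cn_mult.
    * apply (Cn_comp n s rho (PY h) X (fun _ y => y)); auto using Cn_snd. apply Cn_PY, Hh.
    * apply (Cn_comp n s rho recip_PX X (fun _ y => y)); auto using Cn_recip_PX, Cn_snd.
Qed.

End ScalarInverse.

(** For y close to 0, h(., y) increases on a fixed interval and takes values
    of both signs at its ends, so each small u has exactly one preimage. *)
Lemma scalar_inverse_pos h : germ2 h -> 0 < PX h 0 0 ->
  exists X, germ2 X /\ near (fun u y => h (X u y) y = u) /\ near (fun x y => X (h x y) y = x).
Proof.
intros [Hh h0] Hp.
assert (Hn := near_pos _ (smooth2_PX _ Hh) Hp).
assert (Hs := Hh).
apply smooth2_box in Hh. destruct Hh as [r1 [hr1 Hh]].
apply near_box in Hn. destruct Hn as [r2 [hr2 Hn]].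
set (r := Rmin r1 r2). assert (hr : 0 < r) by (apply Rmin_pos; auto).
assert (Hh' : forall n, Cn n r h).
{ intros n. apply Cn_shrink with r1; auto. apply Rmin_l. }
assert (Hn' : on_box r (fun x y => 0 < PX h x y)).
{ apply on_box_shrink with r2; auto. apply Rmin_r. }
set (b := r / 2).
assert (hb : Rabs b < r) by (unfold b; apply Rabs_def1; lra).
assert (hmb : Rabs (- b) < r) by (rewrite Rabs_Ropp; auto).
assert (h00 : Rabs 0 < r) by (rewrite Rabs_R0; auto).
assert (I := local_inverse_incr h r Hh' Hn').
assert (L1 : h (- b) 0 < 0) by (pose proof (I (- b) 0 0 hmb h00 h00 ltac:(unfold b; lra)); lra).
assert (L2 : 0 < h b 0) by (pose proof (I 0 b 0 h00 hb h00 ltac:(unfold b; lra)); lra).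
assert (p1 : 0 < - h (-b) 0 / 2) by lra. assert (p2 : 0 < h b 0 / 2) by lra.
destruct (Cn_cont 0 r h (-b) 0 (Hh' 0%nat) hmb h00 (mkposreal _ p1)) as [d1 C1].
destruct (Cn_cont 0 r h b 0 (Hh' 0%nat) hb h00 (mkposreal _ p2)) as [d2 C2]. simpl in C1, C2.
set (s := Rmin (Rmin r (Rmin d1 d2)) (Rmin (- h (-b) 0 / 2) (h b 0 / 2))).
assert (hs : 0 < s) by (unfold s; repeat apply Rmin_pos; try apply cond_pos; auto).
assert (s1 : s <= r) by (unfold s; eapply Rle_trans; [apply Rmin_l|]; apply Rmin_l).
assert (s2 : s <= d1).
{ unfold s. eapply Rle_trans; [apply Rmin_l|]. eapply Rle_trans; [apply Rmin_r|]. apply Rmin_l. }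
assert (s3 : s <= d2).
{ unfold s. eapply Rle_trans; [apply Rmin_l|]. eapply Rle_trans; [apply Rmin_r|]. apply Rmin_r. }
assert (s4 : s <= - h (-b) 0 / 2).
{ unfold s. eapply Rle_trans; [apply Rmin_r|]. apply Rmin_l. }
assert (s5 : s <= h b 0 / 2).
{ unfold s. eapply Rle_trans; [apply Rmin_r|]. apply Rmin_r. }
set (X := fun u y => epsilon (inhabits 0) (fun x => Rabs x < r /\ h x y = u)).
assert (HX : on_box s (fun u y => Rabs (X u y) < r /\ h (X u y) y = u)).
{ intros u y hu hy. unfold X. apply epsilon_spec.
  assert (D1 : Rabs (h (-b) y - h (-b) 0) < - h (-b) 0 / 2).
  { apply C1. rewrite Rminus_eq_0, Rabs_R0; apply cond_pos. rewrite Rminus_0_r; lra. }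
  assert (D2 : Rabs (h b y - h b 0) < h b 0 / 2).
  { apply C2. rewrite Rminus_eq_0, Rabs_R0; apply cond_pos. rewrite Rminus_0_r; lra. }
  apply Rabs_def2 in D1. apply Rabs_def2 in D2. apply Rabs_def2 in hu.
  destruct (f_interv_is_interv (fun x => h x y) (-b) b u) as [x [hx E]].
  - unfold b; lra.
  - lra.
  - intros x hx. apply continuity_pt_filterlim. apply (ex_derive_continuous (V := R_NormedModule) (fun z => h z y) x).
    exists (PX h x y). apply (Cn_derX 0 r h x y); auto; [apply Rabs_def1; unfold b in *; lra | lra].
  - exists x. split; auto. apply Rabs_def1; unfold b in *; lra. }
assert (Inj := local_inverse_inj h r Hh' Hn').
exists X. split; [split|split].
- apply smooth2_box. exists s. split; auto. intros n.
  apply (Cn_local_inverse h X r s); auto.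
- destruct (HX 0 0) as [hx E]; try (rewrite Rabs_R0; auto).
  apply Inj with 0; auto. rewrite h0; auto.
- apply near_box. exists s. split; auto. intros u y hu hy. apply HX; auto.
- apply (near_mp _ _ (near_bounded h s Hs h0 hs)). apply near_box. exists s. split; auto.
  intros x y hx hy hh. destruct (HX (h x y) y hh hy) as [h1 h2].
  apply Inj with y; auto; lra.
Qed.

Lemma PX_at f l : is_derive (fun z => f z 0) 0 l -> PX f 0 0 = l.
Proof. intros H. apply is_derive_unique; auto. Qed.
Lemma PY_at f l : is_derive (fun z => f 0 z) 0 l -> PY f 0 0 = l.
Proof. intros H. apply is_derive_unique; auto. Qed.
Lemma derX0 f : smooth2 f -> is_derive (fun z => f z 0) 0 (PX f 0 0).
Proof. intros H. apply smooth2_derX in H. apply (near_at _ H). Qed.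
Lemma derY0 f : smooth2 f -> is_derive (fun z => f 0 z) 0 (PY f 0 0).
Proof. intros H. apply smooth2_derY in H. apply (near_at _ H). Qed.

(** Solves h(x, y) = u for x, y being a parameter: this is the inverse
    function theorem for maps that preserve y, from which the general case
    follows. *)
Theorem scalar_inverse h : germ2 h -> PX h 0 0 <> 0 ->
  exists X, germ2 X /\ near (fun u y => h (X u y) y = u) /\ near (fun x y => X (h x y) y = x).
Proof.
intros [Hh h0] Hp. destruct (Rtotal_order 0 (PX h 0 0)) as [H|[H|H]].
- apply scalar_inverse_pos; auto. split; auto.
- congruence.
- destruct (scalar_inverse_pos (fun x y => - h x y)) as [X [[HX X0] [E1 E2]]].
  + split. apply smooth2_opp; auto. rewrite h0; ring.
  + rewrite (PX_at _ (- PX h 0 0)). lra.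
    apply (is_derive_opp (fun z => h z 0)). apply derX0; auto.
  + exists (fun u y => X (- u) y).
    assert (Hneg : smooth2 (fun x y => - x)) by (apply smooth2_opp, smooth2_fst).
    split; [split|split].
    * apply (smooth2_comp X (fun x y => - x) (fun _ y => y)); auto. apply smooth2_snd. ring.
    * simpl. rewrite Ropp_0; auto.
    * generalize (near_comp _ (fun x y => - x) (fun _ y => y) E1 Hneg smooth2_snd Ropp_0 eq_refl).
      intros E. apply (near_mp _ _ E), near_all. intros x y h1. lra.
    * exact E2.
Qed.

Lemma diffeo_ext p q p' q' : near (fun x y => p x y = p' x y) -> near (fun x y => q x y = q' x y) ->
  diffeo_germ p q -> diffeo_germ p' q'.
Proof.
intros Ep Eq [Hp [Hq [a [b [Ha [Hb [E1 E2]]]]]]].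
assert (Hp' : germ2 p').
{ split. apply smooth2_ext with p; auto. apply Hp. rewrite <- (near_at _ Ep). apply Hp. }
assert (Hq' : germ2 q').
{ split. apply smooth2_ext with q; auto. apply Hq. rewrite <- (near_at _ Eq). apply Hq. }
split; auto. split; auto. exists a, b. split; auto. split; auto. split.
- apply (near_mp _ _ Ep), (near_mp _ _ Eq), (near_mp _ _ E1), near_all.
  intros x y h1 h2 h3. rewrite <- h2, <- h3. auto.
- destruct Ha as [Ha a0], Hb as [Hb b0].
  apply (near_mp _ _ (near_comp _ a b Ep Ha Hb a0 b0)), (near_mp _ _ (near_comp _ a b Eq Ha Hb a0 b0)),
   (near_mp _ _ E2), near_all.
  intros x y h1 h2 h3. rewrite <- h2, <- h3. auto.
Qed.

Lemma diffeo_comp p q p' q' : diffeo_germ p q -> diffeo_germ p' q' ->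
  diffeo_germ (fun x y => p (p' x y) (q' x y)) (fun x y => q (p' x y) (q' x y)).
Proof.
intros [Hp [Hq [a [b [Ha [Hb [E1 E2]]]]]]] [Hp' [Hq' [a' [b' [Ha' [Hb' [E1' E2']]]]]]].
split; [apply germ2_comp; auto|]. split; [apply germ2_comp; auto|].
exists (fun x y => a' (a x y) (b x y)), (fun x y => b' (a x y) (b x y)).
split; [apply germ2_comp; auto|]. split; [apply germ2_comp; auto|].
destruct Ha as [Ha a0], Hb as [Hb b0], Hp' as [Hp' p0], Hq' as [Hq' q0]. split.
- apply (near_mp _ _ (near_comp _ p' q' E1 Hp' Hq' p0 q0)), (near_mp _ _ E1'), near_all.
  intros x y [h1 h2] [h3 h4]. rewrite h3, h4. auto.
- apply (near_mp _ _ (near_comp _ a b E2' Ha Hb a0 b0)), (near_mp _ _ E2), near_all.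
  intros x y [h1 h2] [h3 h4]. rewrite h3, h4. auto.
Qed.

Lemma diffeo_swap : diffeo_germ (fun _ y => y) (fun x _ => x).
Proof.
split; [apply germ2_snd|]. split; [apply germ2_fst|].
exists (fun _ y => y), (fun x _ => x). split; [apply germ2_snd|]. split; [apply germ2_fst|].
split; apply near_all; auto.
Qed.

Lemma diffeo_fst h : germ2 h -> PX h 0 0 <> 0 -> diffeo_germ h (fun _ y => y).
Proof.
intros Hh Hp. destruct (scalar_inverse h Hh Hp) as [X [HX [E1 E2]]].
split; auto. split; [apply germ2_snd|]. exists X, (fun _ y => y). split; auto.
split; [apply germ2_snd|]. split.
- apply (near_mp _ _ E2), near_all. auto.
- apply (near_mp _ _ E1), near_all. auto.
Qed.

Lemma diffeo_snd h : germ2 h -> PY h 0 0 <> 0 -> diffeo_germ (fun x _ => x) h.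
Proof.
intros [Hh h0] Hp.
assert (D : diffeo_germ (fun x y => h y x) (fun _ y => y)).
{ apply diffeo_fst; auto. split; auto. apply smooth2_swap; auto. }
exact (diffeo_comp _ _ _ _ diffeo_swap (diffeo_comp _ _ _ _ D diffeo_swap)).
Qed.

Definition jac (p q : R -> R -> R) : R := PX p 0 0 * PY q 0 0 - PY p 0 0 * PX q 0 0.

Lemma is_derive_comp_germ (g p q : R -> R) (G : R -> R -> R) l m : smooth2 G ->
  is_derive p 0 l -> is_derive q 0 m -> p 0 = 0 -> q 0 = 0 ->
  is_derive (fun z => G (p z) (q z)) 0 (PX G 0 0 * l + PY G 0 0 * m).
Proof.
intros HG Hp Hq p0 q0. apply is_derive_Reals.
apply (derivable_pt_lim_comp_2d G p q).
- rewrite p0, q0. apply smooth2_box in HG. destruct HG as [r [hr HG]].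
  apply Cn_differentiable with 0%nat r; auto; rewrite Rabs_R0; auto.
- apply is_derive_Reals; auto.
- apply is_derive_Reals; auto.
Qed.

(** The map factors as (x, k(x, y)) after (p(x, y), y), where k(u, y) = q(X(u,
    y), y) and X solves p = u. Each factor moves one variable only, and k_y(0)
    is the Jacobian divided by p_x(0). *)
Lemma inverse_function_PX p q : germ2 p -> germ2 q -> jac p q <> 0 -> PX p 0 0 <> 0 -> diffeo_germ p q.
Proof.
intros Hp Hq J P. destruct (scalar_inverse p Hp P) as [X [HX [E1 E2]]].
set (k := fun u y => q (X u y) y).
assert (Hk : germ2 k) by (apply (germ2_comp q X (fun _ y => y) Hq HX germ2_snd)).
assert (DX : PX p 0 0 * PY X 0 0 + PY p 0 0 = 0).
{ assert (D1 := is_derive_comp_germ (fun z => z) (fun z => X 0 z) (fun z => z) p (PY X 0 0) 1 (proj1 Hp)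
    (derY0 X (proj1 HX)) (is_derive_id 0) (proj2 HX) eq_refl).
  assert (D2 : is_derive (fun z => p (X 0 z) z) 0 0).
  { apply is_derive_ext_loc with (fun _ => 0).
    - apply locally_2d_1d_const_x in E1. revert E1. apply filter_imp. intros t ht. auto.
    - apply (is_derive_const 0). }
  apply is_derive_unique in D1. apply is_derive_unique in D2. rewrite D1 in D2. lra. }
assert (Dk : PY k 0 0 <> 0).
{ unfold k. rewrite (PY_at _ (PX q 0 0 * PY X 0 0 + PY q 0 0 * 1)).
  - intros E. apply J. unfold jac.
    replace (PY q 0 0) with (- PX q 0 0 * PY X 0 0) by lra.
    replace (PY p 0 0) with (- PX p 0 0 * PY X 0 0) by lra. ring.
  - apply (is_derive_comp_germ (fun z => z) (fun z => X 0 z) (fun z => z)); auto.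
    apply Hq. apply derY0, HX. apply (is_derive_id 0). apply HX. }
generalize (diffeo_comp _ _ _ _ (diffeo_snd k Hk Dk) (diffeo_fst p Hp P)).
apply diffeo_ext.
- apply near_all; auto.
- unfold k. apply (near_mp _ _ E2), near_all. intros x y h. rewrite h. auto.
Qed.

(** One of p_x, p_y is nonzero at 0; exchanging x and y covers the second
    possibility. *)
Theorem inverse_function p q : germ2 p -> germ2 q -> jac p q <> 0 -> diffeo_germ p q.
Proof.
intros Hp Hq J. destruct (Req_dec (PX p 0 0) 0) as [P|P].
- assert (D : diffeo_germ (fun x y => p y x) (fun x y => q y x)).
  { apply inverse_function_PX.
    - split. apply smooth2_swap, Hp. apply Hp.
    - split. apply smooth2_swap, Hq. apply Hq.
    - intros E. apply J. unfold jac in *. unfold PX, PY in *. lra.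
    - intros E. apply J. unfold jac. unfold PX, PY in *. rewrite E, P. ring. }
  exact (diffeo_comp _ _ _ _ D diffeo_swap).
- apply inverse_function_PX; auto.
Qed.

Theorem implicit_function h : germ2 h -> PX h 0 0 <> 0 ->
  exists psi : R -> R, germ2 (fun _ y => psi y) /\ near (fun _ y => h (psi y) y = 0).
Proof.
intros Hh P. destruct (scalar_inverse h Hh P) as [X [HX [E1 _]]].
exists (fun y => X 0 y). split.
- split. apply (smooth2_comp X (fun _ _ => 0) (fun _ y => y)); auto. apply HX.
  apply smooth2_const. apply smooth2_snd. apply HX.
- refine (near_comp _ (fun _ _ => 0) (fun _ y => y) E1 (smooth2_const 0) smooth2_snd eq_refl eq_refl).
Qed.

Definition coords (X Y : R -> R -> R) : Prop := germ2 X /\ germ2 Y /\ jac X Y <> 0.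

Lemma coords_id : coords (fun x _ => x) (fun _ y => y).
Proof.
split; [apply germ2_fst|]. split; [apply germ2_snd|]. unfold jac.
assert (E1 : PX (fun x _ : R => x) 0 0 = 1) by exact (PX_at _ 1 (is_derive_id 0)).
assert (E2 : PY (fun _ y : R => y) 0 0 = 1) by exact (PY_at (fun _ y : R => y) 1 (is_derive_id 0)).
assert (E3 : PX (fun _ y : R => y) 0 0 = 0) by exact (PX_at (fun _ y : R => y) 0 (is_derive_const 0 0)).
rewrite E1, E2, E3. lra.
Qed.

Lemma coords_swap X Y : coords X Y -> coords Y X.
Proof. intros [H1 [H2 J]]. split; auto. split; auto. unfold jac in *. lra. Qed.

Lemma PX_mult_germ f X : smooth2 f -> germ2 X -> is_derive (fun z => f z 0 * X z 0) 0 (f 0 0 * PX X 0 0).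
Proof.
intros Hf [HX X0]. evar_last.
apply (is_derive_mult (fun z => f z 0) (fun z => X z 0) 0); [apply derX0; auto| apply derX0; auto|].
intros; apply Rmult_comm. unfold plus, mult; simpl. rewrite X0. unfold mult; simpl. ring.
Qed.
Lemma PY_mult_germ f X : smooth2 f -> germ2 X -> is_derive (fun z => f 0 z * X 0 z) 0 (f 0 0 * PY X 0 0).
Proof.
intros Hf [HX X0]. evar_last.
apply (is_derive_mult (fun z => f 0 z) (fun z => X 0 z) 0); [apply derY0; auto| apply derY0; auto|].
intros; apply Rmult_comm. unfold plus, mult; simpl. rewrite X0. unfold mult; simpl. ring.
Qed.

(** X and Y vanish at 0, so the derivatives of the coefficients do not
    contribute to the Jacobian, which is multiplied by the determinant of the
    coefficient matrix at 0. Every coordinate change below is of this form. *)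
Lemma coords_linear X Y a b c d : coords X Y -> smooth2 a -> smooth2 b -> smooth2 c -> smooth2 d ->
  a 0 0 * d 0 0 - b 0 0 * c 0 0 <> 0 ->
  coords (fun x y => a x y * X x y + b x y * Y x y) (fun x y => c x y * X x y + d x y * Y x y).
Proof.
intros [HX [HY J]] Ha Hb Hc Hd D.
split; [|split].
- split. apply smooth2_plus; apply smooth2_mult; auto; [apply HX|apply HY].
  rewrite (proj2 HX), (proj2 HY). ring.
- split. apply smooth2_plus; apply smooth2_mult; auto; [apply HX|apply HY].
  rewrite (proj2 HX), (proj2 HY). ring.
- unfold jac in *.
  rewrite (PX_at _ _ (is_derive_plus (fun z => a z 0 * X z 0) _ 0 _ _ (PX_mult_germ a X Ha HX) (PX_mult_germ b Y Hb HY))).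
  rewrite (PY_at _ _ (is_derive_plus (fun z => a 0 z * X 0 z) _ 0 _ _ (PY_mult_germ a X Ha HX) (PY_mult_germ b Y Hb HY))).
  rewrite (PX_at _ _ (is_derive_plus (fun z => c z 0 * X z 0) _ 0 _ _ (PX_mult_germ c X Hc HX) (PX_mult_germ d Y Hd HY))).
  rewrite (PY_at _ _ (is_derive_plus (fun z => c 0 z * X 0 z) _ 0 _ _ (PY_mult_germ c X Hc HX) (PY_mult_germ d Y Hd HY))).
  unfold plus; simpl. intros E.
  apply (Rmult_integral_contrapositive_currified _ _ D J). refine (eq_trans _ E). ring.
Qed.

Lemma coords_diffeo X Y : coords X Y -> diffeo_germ X Y.
Proof. intros [HX [HY J]]. apply inverse_function; auto. Qed.

(** * Recognition of the simple singularities *)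

Lemma coords_change X Y X' Y' a b c d : coords X Y ->
  smooth2 a -> smooth2 b -> smooth2 c -> smooth2 d -> a 0 0 * d 0 0 - b 0 0 * c 0 0 <> 0 ->
  (forall x y, X' x y = a x y * X x y + b x y * Y x y) ->
  (forall x y, Y' x y = c x y * X x y + d x y * Y x y) -> coords X' Y'.
Proof.
intros H Ha Hb Hc Hd D EX EY.
replace X' with (fun x y => a x y * X x y + b x y * Y x y).
replace Y' with (fun x y => c x y * X x y + d x y * Y x y).
apply coords_linear; auto.
- extensionality x; extensionality y; auto.
- extensionality x; extensionality y; auto.
Qed.

Lemma coords_scale_fst X Y f : coords X Y -> smooth2 f -> f 0 0 <> 0 ->
  coords (fun x y => f x y * X x y) Y.
Proof.
intros H Hf f0. apply (coords_change X Y _ _ f (fun _ _ => 0) (fun _ _ => 0) (fun _ _ => 1)); auto;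
  try apply smooth2_const; try (intros; ring). lra.
Qed.
Lemma coords_scale_snd X Y f : coords X Y -> smooth2 f -> f 0 0 <> 0 ->
  coords X (fun x y => f x y * Y x y).
Proof. intros H Hf f0. apply coords_swap, coords_scale_fst; auto. apply coords_swap; auto. Qed.

Lemma coords_shear_fst X Y f : coords X Y -> smooth2 f ->
  coords (fun x y => X x y + f x y * Y x y) Y.
Proof.
intros H Hf. apply (coords_change X Y _ _ (fun _ _ => 1) f (fun _ _ => 0) (fun _ _ => 1)); auto;
  try apply smooth2_const; try (intros; ring). lra.
Qed.
Lemma coords_shear_snd X Y f : coords X Y -> smooth2 f ->
  coords X (fun x y => Y x y + f x y * X x y).
Proof. intros H Hf. apply coords_swap, coords_shear_fst; auto. apply coords_swap; auto. Qed.

Lemma coords_smooth_fst X Y : coords X Y -> smooth2 X.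
Proof. intros H; apply H. Qed.
Lemma coords_smooth_snd X Y : coords X Y -> smooth2 Y.
Proof. intros H; apply H. Qed.

(** The shape in which all the recognition lemmas produce a K-equivalence. *)
Lemma K_equiv_coords F nf X Y M : coords X Y -> smooth2 M -> M 0 0 <> 0 ->
  near (fun x y => M x y * F x y = nf (X x y) (Y x y)) -> K_equiv F nf.
Proof.
intros H HM M0 E. exists X, Y, M. split. apply coords_diffeo; auto. split; auto. split; auto.
apply near_neq0; auto.
Qed.

Lemma K_equiv_ext F G nf : near (fun x y => F x y = G x y) -> K_equiv F nf -> K_equiv G nf.
Proof.
intros E [p [q [M [D [HM [M0 H]]]]]]. exists p, q, M. repeat split; try apply D; auto.
apply (near_mp _ _ E), (near_mp _ _ H), near_all. intros x y h1 h2. rewrite <- h2; auto.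
Qed.

(** Lets F be studied in any coordinates. *)
Lemma K_equiv_diffeo F nf p q : diffeo_germ p q ->
  K_equiv (fun x y => F (p x y) (q x y)) nf -> K_equiv F nf.
Proof.
intros [Hp [Hq [a [b [Ha [Hb [E1 E2]]]]]]] [P [Q [M [D [HM [M0 H]]]]]].
assert (D' : diffeo_germ a b).
{ split; auto. split; auto. exists p, q. auto. }
destruct Ha as [Ha a0], Hb as [Hb b0].
exists (fun x y => P (a x y) (b x y)), (fun x y => Q (a x y) (b x y)), (fun x y => M (a x y) (b x y)).
split; [apply diffeo_comp; auto|]. split; [apply smooth2_comp; auto|].
split; [apply (near_comp _ a b M0); auto|].
apply (near_mp _ _ (near_comp _ a b H Ha Hb a0 b0)), (near_mp _ _ E2), near_all.
intros x y [h1 h2] h. rewrite h1, h2 in h. exact h.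
Qed.

Lemma sign_of c : c <> 0 -> exists s, is_sign s /\ 0 < s * c.
Proof.
intros hc. destruct (Rtotal_order c 0) as [H|[H|H]].
- exists (-1). split; [right; auto|lra].
- congruence.
- exists 1. split; [left; auto|lra].
Qed.
Lemma sign_sq s : is_sign s -> s * s = 1.
Proof. intros [->| ->]; ring. Qed.

Lemma unit_root n g : (0 < n)%nat -> smooth2 g -> 0 < g 0 0 ->
  exists rho, smooth2 rho /\ rho 0 0 <> 0 /\ near (fun x y => rho x y ^ n = g x y).
Proof.
intros hn Hg g0. exists (fun x y => root n (g x y)).
split; [apply smooth2_root; auto|].
split; [pose proof (root_pos n (g 0 0)); lra|].
apply (near_mp _ _ (near_pos g Hg g0)), near_all. intros x y h. apply root_pow; auto.
Qed.

(** Odd roots exist for either sign of g, which is why x^3 + y^4, x^3 + y^5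
    and x^3 + x y^3 carry no sign. *)
Lemma unit_root_odd m g : smooth2 g -> g 0 0 <> 0 ->
  exists rho, smooth2 rho /\ rho 0 0 <> 0 /\ near (fun x y => rho x y ^ (2 * m + 1) = g x y).
Proof.
intros Hg g0. destruct (sign_of _ g0) as [s [hs hp]].
destruct (unit_root (2 * m + 1) (fun x y => s * g x y)) as [rho [H1 [H2 H3]]].
- lia.
- apply smooth2_mult; auto. apply smooth2_const.
- exact hp.
- exists (fun x y => s * rho x y). split; [apply smooth2_mult; auto; apply smooth2_const|].
  split.
  + apply Rmult_integral_contrapositive_currified; auto. destruct hs; lra.
  + apply (near_mp _ _ H3), near_all. intros x y h. rewrite Rpow_mult_distr, h.
    rewrite pow_add, pow_mult. replace (s ^ 2) with 1 by (rewrite <- (sign_sq s hs); ring).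
    rewrite pow1. pose proof (sign_sq s hs). simpl.
    transitivity ((s * s) * g x y); [ring | rewrite H; ring].
Qed.

Lemma prod_neq a b s : 0 < s * (a * b) -> a <> 0 /\ b <> 0.
Proof. intros H. split; intros E; rewrite E in H; lra. Qed.

Lemma sign_div s a c : 0 < s * (a * c) -> 0 < s * (a / c).
Proof.
intros H. assert (Hc := proj2 (prod_neq _ _ _ H)).
replace (s * (a / c)) with (s * (a * c) * (/ c * / c)) by (field; auto).
apply Rmult_lt_0_compat; auto. assert (/ c <> 0) by (apply Rinv_neq_0_compat; auto).
nra.
Qed.

Lemma A_recognition_pure k X Y A C F s : coords X Y -> smooth2 A -> smooth2 C -> is_sign s ->
  0 < s * (A 0 0 * C 0 0) ->
  near (fun x y => F x y = C x y * Y x y ^ 2 + A x y * X x y ^ (k + 1)) -> K_equiv F (nf_A s k).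
Proof.
intros H HA HC hs hp E. destruct (prod_neq _ _ _ hp) as [A0 C0].
destruct (unit_root (k + 1) (fun x y => s * (A x y / C x y))) as [rho [R1 [R2 R3]]].
- lia.
- smooth.
- apply sign_div; auto.
- apply (K_equiv_coords F _ Y (fun x y => rho x y * X x y) (fun x y => / C x y)).
  + apply coords_swap, coords_scale_fst; auto.
  + smooth.
  + apply Rinv_neq_0_compat; auto.
  + apply (near_mp _ _ E), (near_mp _ _ R3), (near_mp _ _ (near_neq0 C HC C0)), near_all.
    intros x y c0 r e. unfold nf_A. rewrite e, Rpow_mult_distr, r.
    replace (s * (s * (A x y / C x y) * X x y ^ (k + 1))) with
      ((s * s) * (A x y / C x y) * X x y ^ (k + 1)) by ring.
    rewrite (sign_sq s hs). field; auto.
Qed.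

(** Completing the square in Y changes A by a multiple of X^d, where d = 2m -
    k - 1. For d > 0 this does not affect the value at 0; for d = 0 it
    subtracts B^2 / 4C, and the convention 0^0 = 1 covers both cases. *)
Lemma A_recognition k m d X Y A B C F s : coords X Y -> smooth2 A -> smooth2 B -> smooth2 C ->
  is_sign s -> (1 <= m)%nat -> (2 * m = k + 1 + d)%nat -> C 0 0 <> 0 ->
  0 < s * ((A 0 0 - B 0 0 ^ 2 / (4 * C 0 0) * 0 ^ d) * C 0 0) ->
  near (fun x y => F x y = C x y * Y x y ^ 2 + B x y * X x y ^ m * Y x y + A x y * X x y ^ (k + 1)) ->
  K_equiv F (nf_A s k).
Proof.
intros H HA HB HC hs hm hd C0 hp E.
assert (HX := coords_smooth_fst X Y H).
assert (X0 : X 0 0 = 0) by apply H.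
set (e := fun x y => B x y / (2 * C x y) * X x y ^ (m - 1)).
apply (A_recognition_pure k X (fun x y => Y x y + e x y * X x y)
  (fun x y => A x y - B x y ^ 2 / (4 * C x y) * X x y ^ d) C); auto.
- apply coords_shear_snd; auto. unfold e. smooth. lra.
- smooth. lra.
- rewrite X0. exact hp.
- apply (near_mp _ _ E), (near_mp _ _ (near_neq0 C HC C0)), near_all. intros x y c0 e1.
  rewrite e1. unfold e.
  assert (Em : X x y ^ m = X x y ^ (m - 1) * X x y).
  { replace m with (S (m - 1)) at 1 by lia. simpl. ring. }
  assert (E2 : X x y ^ d * X x y ^ (k + 1) = (X x y ^ (m - 1) * X x y) ^ 2).
  { rewrite <- Em, <- pow_add, <- pow_mult. f_equal. lia. }
  rewrite Em. rewrite Rmult_minus_distr_r.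
  replace (B x y ^ 2 / (4 * C x y) * X x y ^ d * X x y ^ (k + 1)) with
    (B x y ^ 2 / (4 * C x y) * (X x y ^ d * X x y ^ (k + 1))) by ring.
  rewrite E2. field; auto.
Qed.

(** The second factor is of type A_(k-3) with W as parameter: completing its
    square in U preserves the factor W. As in [A_recognition], the factor 0^d
    tells whether B affects the coefficient of W^(k-2) at 0. *)
Lemma D_recognition k m d W U A B C F s : coords U W -> smooth2 A -> smooth2 B -> smooth2 C ->
  is_sign s -> (2 <= k)%nat -> (1 <= m)%nat -> (2 * m = k - 2 + d)%nat -> A 0 0 <> 0 ->
  0 < s * (A 0 0 * (C 0 0 - B 0 0 ^ 2 / (4 * A 0 0) * 0 ^ d)) ->
  near (fun x y => F x y = W x y * (A x y * U x y ^ 2 + B x y * W x y ^ m * U x y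
                                    + C x y * W x y ^ (k - 2))) ->
  K_equiv F (nf_D s k).
Proof.
intros H HA HB HC hs hk hm hd A0 hp E.
assert (HW := coords_smooth_snd U W H).
assert (W0 : W 0 0 = 0) by apply H.
set (e := fun x y => B x y / (2 * A x y) * W x y ^ (m - 1)).
assert (He : smooth2 e) by (unfold e; smooth; lra).
set (C' := fun x y => C x y - B x y ^ 2 / (4 * A x y) * W x y ^ d).
assert (HC' : smooth2 C') by (unfold C'; smooth; lra).
assert (hp' : 0 < s * (A 0 0 * C' 0 0)) by (unfold C'; rewrite W0; auto).
assert (C0 : C' 0 0 <> 0) by apply (prod_neq _ _ _ hp').
destruct (unit_root 2 (fun x y => s * (A x y / C' x y))) as [rho [R1 [R2 R3]]].
- lia.
- smooth.
- apply sign_div; auto.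
- apply (K_equiv_coords F _ (fun x y => rho x y * (U x y + e x y * W x y)) W (fun x y => s / C' x y)).
  + apply (coords_scale_fst (fun x y => U x y + e x y * W x y)); auto. apply coords_shear_fst; auto.
  + smooth.
  + apply Rmult_integral_contrapositive_currified. destruct hs; lra. apply Rinv_neq_0_compat; auto.
  + apply (near_mp _ _ E), (near_mp _ _ R3), (near_mp _ _ (near_neq0 C' HC' C0)),
      (near_mp _ _ (near_neq0 A HA A0)), near_all.
    intros x y a0 c0 r e1. unfold nf_D. rewrite e1, Rpow_mult_distr, r.
    assert (Em : W x y ^ m = W x y ^ (m - 1) * W x y).
    { replace m with (S (m - 1)) at 1 by lia. simpl. ring. }
    assert (E2 : W x y ^ d * W x y ^ (k - 2) = (W x y ^ (m - 1) * W x y) ^ 2).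
    { rewrite <- Em, <- pow_add, <- pow_mult. f_equal. lia. }
    replace (W x y ^ (k - 1)) with (W x y * W x y ^ (k - 2))
      by (replace (k - 1)%nat with (S (k - 2)) by lia; reflexivity).
    assert (EC : C x y * W x y ^ (k - 2) =
       C' x y * W x y ^ (k - 2) + B x y ^ 2 / (4 * A x y) * (W x y ^ (m - 1) * W x y) ^ 2).
    { rewrite <- E2. unfold C'. ring. }
    rewrite EC, Em. unfold e. field; auto.
Qed.

Lemma cube_recognition n X Y A C F : coords X Y -> smooth2 A -> smooth2 C ->
  A 0 0 <> 0 -> C 0 0 <> 0 ->
  near (fun x y => F x y = A x y * X x y ^ 3 + C x y * Y x y ^ n) ->
  K_equiv F (fun x y => x ^ 3 + y ^ n).
Proof.
intros H HA HC A0 C0 E.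
destruct (unit_root_odd 1 (fun x y => A x y / C x y)) as [rho [R1 [R2 R3]]].
- smooth.
- apply Rmult_integral_contrapositive_currified; auto. apply Rinv_neq_0_compat; auto.
- apply (K_equiv_coords F _ (fun x y => rho x y * X x y) Y (fun x y => / C x y)).
  + apply coords_scale_fst; auto.
  + smooth.
  + apply Rinv_neq_0_compat; auto.
  + apply (near_mp _ _ E), (near_mp _ _ R3), (near_mp _ _ (near_neq0 C HC C0)), near_all.
    intros x y c0 r e. change (2 * 1 + 1)%nat with 3%nat in r.
    rewrite e, Rpow_mult_distr, r. field; auto.
Qed.

(** X^3 + Y^3 = (X + Y) (3/4 (X - Y)^2 + 1/4 (X + Y)^2): a line times a
    definite quadratic form. *)
Lemma D4_recognition X Y A C F : coords X Y -> smooth2 A -> smooth2 C ->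
  A 0 0 <> 0 -> C 0 0 <> 0 ->
  near (fun x y => F x y = A x y * X x y ^ 3 + C x y * Y x y ^ 3) ->
  K_equiv F (nf_D 1 4).
Proof.
intros H HA HC A0 C0 E.
destruct (unit_root_odd 1 (fun x y => A x y / C x y)) as [rho [R1 [R2 R3]]].
- smooth.
- apply Rmult_integral_contrapositive_currified; auto. apply Rinv_neq_0_compat; auto.
- apply (D_recognition 4 1 0 (fun x y => rho x y * X x y + Y x y) (fun x y => rho x y * X x y - Y x y)
    (fun x y => 3 / 4 * C x y) (fun _ _ => 0) (fun x y => 1 / 4 * C x y)); try lia.
  + apply (coords_change X Y _ _ rho (fun _ _ => -1) rho (fun _ _ => 1)); smooth; auto;
     try (intros; ring). lra.
  + smooth.
  + smooth.
  + smooth.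
  + left; auto.
  + lra.
  + simpl. replace (_ * _) with (3 / 16 * (C 0 0 * C 0 0)) by (field; lra). nra.
  + apply (near_mp _ _ E), (near_mp _ _ R3), (near_mp _ _ (near_neq0 C HC C0)), near_all.
    intros x y c0 r e. change (2 * 1 + 1)%nat with 3%nat in r. rewrite e.
    replace (A x y) with (C x y * rho x y ^ 3) by (rewrite r; field; auto).
    simpl. field.
Qed.

Lemma E7_recognition X Y A C F : coords X Y -> smooth2 A -> smooth2 C ->
  A 0 0 <> 0 -> C 0 0 <> 0 ->
  near (fun x y => F x y = X x y * (A x y * X x y ^ 2 + C x y * Y x y ^ 3)) ->
  K_equiv F nf_E7.
Proof.
intros H HA HC A0 C0 E.
destruct (unit_root_odd 1 (fun x y => C x y / A x y)) as [rho [R1 [R2 R3]]].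
- smooth.
- apply Rmult_integral_contrapositive_currified; auto. apply Rinv_neq_0_compat; auto.
- apply (K_equiv_coords F _ X (fun x y => rho x y * Y x y) (fun x y => / A x y)).
  + apply coords_scale_snd; auto.
  + smooth.
  + apply Rinv_neq_0_compat; auto.
  + apply (near_mp _ _ E), (near_mp _ _ R3), (near_mp _ _ (near_neq0 A HA A0)), near_all.
    intros x y c0 r e. change (2 * 1 + 1)%nat with 3%nat in r. unfold nf_E7.
    rewrite e, Rpow_mult_distr, r. field; auto.
Qed.

Lemma E_star_recognition_pure X Y A C F s : coords X Y -> smooth2 A -> smooth2 C -> is_sign s ->
  0 < s * (C 0 0 * A 0 0) ->
  near (fun x y => F x y = X x y * (A x y * X x y ^ 2 + C x y * Y x y ^ 4)) ->
  K_equiv F (fun x y => x ^ 3 + s * x * y ^ 4).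
Proof.
intros H HA HC hs hp E. destruct (prod_neq _ _ _ hp) as [C0 A0].
destruct (unit_root 4 (fun x y => s * (C x y / A x y))) as [rho [R1 [R2 R3]]].
- lia.
- smooth.
- apply sign_div; auto.
- apply (K_equiv_coords F _ X (fun x y => rho x y * Y x y) (fun x y => / A x y)).
  + apply coords_scale_snd; auto.
  + smooth.
  + apply Rinv_neq_0_compat; auto.
  + apply (near_mp _ _ E), (near_mp _ _ R3), (near_mp _ _ (near_neq0 A HA A0)), near_all.
    intros x y c0 r e. rewrite e, Rpow_mult_distr, r.
    replace (s * X x y * (s * (C x y / A x y) * Y x y ^ 4)) with
      ((s * s) * (C x y / A x y) * X x y * Y x y ^ 4) by ring.
    rewrite (sign_sq s hs). field; auto.
Qed.

(** Completing the fourth power in y absorbs D x y^3 together with B x^2 y^3,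
    and creates multiples of x^3 and of x^2 Y^2; completing the cube in x
    absorbs the latter and creates multiples of Y^4 only. *)
Lemma E6_recognition A B D C F : smooth2 A -> smooth2 B -> smooth2 D -> smooth2 C ->
  A 0 0 <> 0 -> C 0 0 <> 0 ->
  near (fun x y => F x y = A x y * x ^ 3 + B x y * y ^ 3 * x ^ 2 + D x y * y ^ 3 * x + C x y * y ^ 4) ->
  K_equiv F nf_E6.
Proof.
intros HA HB HD HC A0 C0 E.
set (e := fun x y => (D x y + B x y * x) / (4 * C x y)).
assert (He : smooth2 e) by (unfold e; smooth; lra).
set (Y := fun x y => y + e x y * x).
assert (HY : coords (fun x _ => x) Y) by (apply coords_shear_snd; auto; apply coords_id).
assert (sY := coords_smooth_snd _ _ HY).
assert (Y0 : Y 0 0 = 0) by apply HY.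
set (A' := fun x y => A x y - 4 * C x y * e x y ^ 3 * y - C x y * e x y ^ 4 * x
                      + 12 * C x y * e x y ^ 3 * Y x y - 6 * C x y * e x y ^ 4 * x).
assert (HA' : smooth2 A') by (unfold A'; smooth).
assert (A0' : A' 0 0 <> 0) by (unfold A'; rewrite Y0; intros Z; apply A0; lra).
set (B' := fun x y => -6 * C x y * e x y ^ 2).
assert (HB' : smooth2 B') by (unfold B'; smooth).
set (g := fun x y => B' x y / (3 * A' x y) * Y x y).
assert (Hg : smooth2 g) by (unfold g; smooth; lra).
apply (cube_recognition 4 (fun x y => x + g x y * Y x y) Y A'
  (fun x y => C x y - B' x y ^ 2 / (3 * A' x y) * x - B' x y ^ 3 / (27 * A' x y ^ 2) * Y x y ^ 2)); auto.
- apply (coords_shear_fst (fun x _ => x)); auto.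
- smooth; try lra.
  apply Rmult_integral_contrapositive_currified; [lra|]. apply pow_nonzero; auto.
- rewrite Y0. intros Z. apply C0. simpl in Z. lra.
- apply (near_mp _ _ E), (near_mp _ _ (near_neq0 A' HA' A0')), (near_mp _ _ (near_neq0 C HC C0)), near_all.
  intros x y c0 a0 h. rewrite h. unfold g. clear h.
  transitivity (A' x y * x ^ 3 + B' x y * x ^ 2 * Y x y ^ 2 + C x y * Y x y ^ 4); [|field; auto].
  unfold A', B', Y.
  replace (D x y) with (4 * C x y * e x y - B x y * x) by (unfold e; field; auto). ring.
Qed.

(** The same two steps as for [E6_recognition]. The cube now creates the terms
    x Y^6 and Y^9, which are multiples of Y^5. *)
Lemma E8_recognition A B D C F : smooth2 A -> smooth2 B -> smooth2 D -> smooth2 C ->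
  A 0 0 <> 0 -> C 0 0 <> 0 ->
  near (fun x y => F x y = A x y * x ^ 3 + B x y * y ^ 3 * x ^ 2 + D x y * y ^ 4 * x + C x y * y ^ 5) ->
  K_equiv F nf_E8.
Proof.
intros HA HB HD HC A0 C0 E.
set (e := fun x y => D x y / (5 * C x y)).
assert (He : smooth2 e) by (unfold e; smooth; lra).
set (Y := fun x y => y + e x y * x).
assert (HY : coords (fun x _ => x) Y) by (apply coords_shear_snd; auto; apply coords_id).
assert (sY := coords_smooth_snd _ _ HY).
assert (Y0 : Y 0 0 = 0) by apply HY.
set (B' := fun x y => B x y - 10 * C x y * e x y ^ 2).
assert (HB' : smooth2 B') by (unfold B'; smooth).
set (A' := fun x y => A x y - 10 * C x y * e x y ^ 3 * y ^ 2 - 5 * C x y * e x y ^ 4 * y * x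
     - C x y * e x y ^ 5 * x ^ 2
     - B' x y * (3 * e x y * Y x y ^ 2 - 3 * e x y ^ 2 * x * Y x y + e x y ^ 3 * x ^ 2)).
assert (HA' : smooth2 A') by (unfold A'; smooth).
assert (A0' : A' 0 0 <> 0) by (unfold A'; rewrite Y0; intros Z; apply A0; ring_simplify in Z; auto).
set (g := fun x y => B' x y / (3 * A' x y) * Y x y ^ 2).
assert (Hg : smooth2 g) by (unfold g; smooth; lra).
apply (cube_recognition 5 (fun x y => x + g x y * Y x y) Y A'
  (fun x y => C x y - B' x y ^ 2 / (3 * A' x y) * x * Y x y - B' x y ^ 3 / (27 * A' x y ^ 2) * Y x y ^ 4)); auto.
- apply (coords_shear_fst (fun x _ => x)); auto.
- smooth; try lra.
  apply Rmult_integral_contrapositive_currified; [lra|]. apply pow_nonzero; auto.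
- rewrite Y0. intros Z. apply C0. simpl in Z. lra.
- apply (near_mp _ _ E), (near_mp _ _ (near_neq0 A' HA' A0')), (near_mp _ _ (near_neq0 C HC C0)), near_all.
  intros x y c0 a0 h. rewrite h. unfold g. clear h.
  transitivity (A' x y * x ^ 3 + B' x y * x ^ 2 * Y x y ^ 3 + C x y * Y x y ^ 5); [|field; auto].
  unfold A', B', Y.
  replace (D x y) with (5 * C x y * e x y) by (unfold e; field; auto). ring.
Qed.

(** Completing the fourth power in y absorbs B x^2 y^3 and creates multiples
    of x^3; the factor x is kept. *)
Lemma E_star_recognition A B D F s : smooth2 A -> smooth2 B -> smooth2 D -> is_sign s ->
  0 < s * (D 0 0 * A 0 0) ->
  near (fun x y => F x y = A x y * x ^ 3 + B x y * y ^ 3 * x ^ 2 + D x y * y ^ 4 * x) ->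
  K_equiv F (fun x y => x ^ 3 + s * x * y ^ 4).
Proof.
intros HA HB HD hs hp E. destruct (prod_neq _ _ _ hp) as [D0 A0].
set (e := fun x y => B x y / (4 * D x y)).
assert (He : smooth2 e) by (unfold e; smooth; lra).
set (A' := fun x y => A x y - 6 * D x y * e x y ^ 2 * y ^ 2 - 4 * D x y * e x y ^ 3 * y * x
     - D x y * e x y ^ 4 * x ^ 2).
assert (HA' : smooth2 A') by (unfold A'; smooth).
assert (EA : A' 0 0 = A 0 0) by (unfold A'; ring).
apply (E_star_recognition_pure (fun x _ => x) (fun x y => y + e x y * x) A' D); auto.
- apply (coords_shear_snd (fun x _ => x) (fun _ y => y)); auto; apply coords_id.
- rewrite EA; auto.
- apply (near_mp _ _ E), (near_mp _ _ (near_neq0 D HD D0)), near_all.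
  intros x y d0 h. rewrite h. unfold A'.
  replace (B x y) with (4 * D x y * e x y) by (unfold e; field; auto). ring.
Qed.

(** * Expansions along curves and the choice of the base curve *)

Lemma smooth2_dY h j : smooth2 h -> smooth2 (fun x _ => dY h j x 0).
Proof.
intros H. apply (smooth2_comp (partial_derive 0 j h) (fun x _ => x) (fun _ _ => 0)); auto.
apply smooth2_partial; auto. apply smooth2_fst. apply smooth2_const.
Qed.
Lemma smooth2_dX h i : smooth2 h -> smooth2 (dX h i).
Proof. intros H. exact (smooth2_partial h i 0 H). Qed.

Lemma taylor_dY h j n (c : nat -> nat -> R) : smooth2 h ->
  (forall i j, c i j = partial_derive i j h 0 0) -> exists Rm, smooth2 Rm /\
  near (fun x y => dY h j x 0 = sum_f_R0 (fun i => c i j / INR (fact i) * x ^ i) n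
                                + x ^ S n * Rm x y).
Proof.
intros H Hc. destruct (taylor_X (fun x _ => dY h j x 0) n (smooth2_dY h j H)) as [Rm [HR E]].
exists Rm. split; auto. apply (near_mp _ _ E), near_all. intros x y e. rewrite e. f_equal.
apply sum_eq. intros i _. rewrite Hc. reflexivity.
Qed.

(** Weighs x and y equally: on x = y xi, with xi any smooth function, the
    terms of total degree d become y^d times a polynomial in xi. This
    evaluates derivatives of f along curves, and also blows up the origin
    (with xi as new variable). *)
Lemma taylor_along_line h xi n (c : nat -> nat -> R) : smooth2 h -> smooth2 xi ->
  (forall i j, c i j = partial_derive i j h 0 0) ->
  exists Rm, smooth2 Rm /\
  near (fun x y => h (y * xi x y) y =
    sum_f_R0 (fun j => sum_f_R0 (fun i =>
      c i j / (INR (fact i) * INR (fact j)) * xi x y ^ i * y ^ (i + j)) (n - j)) n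
    + y ^ S n * Rm x y).
Proof.
intros Hh Hxi Hc.
set (p := fun x y => y * xi x y).
assert (Hp : smooth2 p) by (unfold p; smooth).
assert (p0 : p 0 0 = 0) by (unfold p; ring).
destruct (taylor_Y h n Hh) as [R0 [HR0 E0]].
assert (E0' := near_comp _ p (fun _ y => y) E0 Hp smooth2_snd p0 eq_refl).
assert (S : forall m, (m <= n)%nat -> exists Rm, smooth2 Rm /\ near (fun x y =>
   sum_f_R0 (fun j => dY h j (p x y) 0 / INR (fact j) * y ^ j) m =
   sum_f_R0 (fun j => sum_f_R0 (fun i =>
      c i j / (INR (fact i) * INR (fact j)) * xi x y ^ i * y ^ (i + j)) (n - j)) m
    + y ^ S n * Rm x y)).
{ assert (T : forall j, (j <= n)%nat -> exists Rm, smooth2 Rm /\ near (fun x y =>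
     dY h j (p x y) 0 / INR (fact j) * y ^ j = sum_f_R0 (fun i =>
      c i j / (INR (fact i) * INR (fact j)) * xi x y ^ i * y ^ (i + j)) (n - j)
      + y ^ S n * Rm x y)).
  { intros j hj. destruct (taylor_dY h j (n - j) c Hh Hc) as [R1 [HR1 E1]].
    assert (E1' := near_comp _ p (fun _ y => y) E1 Hp smooth2_snd p0 eq_refl).
    exists (fun x y => xi x y ^ S (n - j) * R1 (p x y) y / INR (fact j)). split.
    - smooth; auto. apply INR_fact_neq_0.
    - apply (near_mp _ _ E1'), near_all. cbv beta. intros x y e. rewrite e.
      assert (F0 := INR_fact_neq_0 j).
      replace (y ^ S n) with (y ^ S (n - j) * y ^ j) by (rewrite <- pow_add; f_equal; lia).
      unfold Rdiv at 1. rewrite 2!Rmult_plus_distr_r. f_equal.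
      + rewrite Rmult_assoc, Rmult_comm, scal_sum. apply sum_eq. intros i _.
        unfold p. rewrite Rpow_mult_distr, pow_add.
        field. split; [exact F0 | apply INR_fact_neq_0].
      + unfold p. rewrite Rpow_mult_distr. field; auto. }
  induction m; intros hm.
  - destruct (T 0%nat hm) as [R1 [HR1 E1]]. exists R1. auto.
  - destruct (T (S m) hm) as [R1 [HR1 E1]]. destruct IHm as [R2 [HR2 E2]]; [lia|].
    exists (fun x y => R2 x y + R1 x y). split; [smooth|].
    apply (near_mp _ _ E1), (near_mp _ _ E2), near_all. intros x y e2 e1.
    rewrite !tech5. rewrite e1, e2. ring. }
destruct (S n (le_n n)) as [R1 [HR1 E1]].
exists (fun x y => R1 x y + R0 (p x y) y). split.
- smooth; auto.
- apply (near_mp _ _ E0'), (near_mp _ _ E1), near_all. cbv beta. intros x y e1 e0.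
  change (y * xi x y) with (p x y). rewrite e0, e1. ring.
Qed.

(** By symmetry of second derivatives, the Taylor coefficients of f_x are
    those of f with the first index shifted. *)
Lemma partial_derive_PX f i j : smooth2 f ->
  partial_derive i j (PX f) 0 0 = partial_derive (S i) j f 0 0.
Proof.
intros Hf.
assert (E : near (fun x y => partial_derive 0 j (PX f) x y = partial_derive 1 j f x y)).
{ apply smooth2_box in Hf. destruct Hf as [r [hr Hf]]. apply near_box. exists r. split; auto.
  intros x y hx hy. symmetry. apply (Derive_partial_derive_aux1 j f x y).
  apply on_box_loc with r; auto. apply Hf. }
transitivity (partial_derive i 0 (partial_derive 1 j f) 0 0).
- exact (partial_derive_ext_loc _ _ i 0 0 0 E).
- unfold partial_derive at 1 2. simpl.
  rewrite <- (Nat.add_1_r i) at 1.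
  exact (Derive_n_comp (fun t => Derive_n (fun z => f t z) j 0) i 1 0).
Qed.

(** Taylor expansion in x after the shear that moves the curve x = psi(y) to
    the y-axis. *)
Lemma taylor_along_curve f psi : smooth2 f -> germ2 (fun _ y => psi y) ->
  exists a, smooth2 a /\ a 0 0 = partial_derive 3 0 f 0 0 / 6 /\
  near (fun x y => f (x + psi y) y = f (psi y) y + PX f (psi y) y * x
     + PX (PX f) (psi y) y / 2 * x ^ 2 + a x y * x ^ 3).
Proof.
intros Hf [Hpsi psi0].
set (g := fun x y => f (x + psi y) y).
assert (Hg : smooth2 g).
{ apply (smooth2_comp f (fun x y => x + psi y) (fun _ y => y)); auto; smooth. lra. }
destruct (taylor_X g 3 Hg) as [Rm [HR E]].
exists (fun x y => dX f 3 (psi y) y / 6 + x * Rm x y).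
assert (H3 := smooth2_dX f 3 Hf).
split; [|split].
- assert (smooth2 (fun x y => dX f 3 (psi y) y)).
  { apply (smooth2_comp (dX f 3) (fun _ y => psi y) (fun _ y => y)); auto; smooth. }
  smooth. lra.
- rewrite psi0. change (dX f 3 0 0) with (partial_derive 3 0 f 0 0). field.
- apply (near_mp _ _ E), near_all. intros x y e. change (f (x + psi y) y) with (g x y). rewrite e.
  assert (D : forall i, dX g i 0 y = dX f i (psi y) y).
  { intros i. unfold dX, g. rewrite (Derive_n_comp_trans (fun z => f z y)). rewrite Rplus_0_l. auto. }
  cbn [sum_f_R0]. rewrite !D.
  change (dX f 0 (psi y) y) with (f (psi y) y).
  change (dX f 1 (psi y) y) with (PX f (psi y) y).
  change (dX f 2 (psi y) y) with (PX (PX f) (psi y) y).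
  rewrite !INR_IZR_INZ. cbn -[dX PX]. field.
Qed.

Lemma diffeo_shear psi : germ2 (fun _ y => psi y) -> diffeo_germ (fun x y => x + psi y) (fun _ y => y).
Proof.
intros [H H0]. apply diffeo_fst.
- split. smooth. lra.
- rewrite (PX_at _ 1). lra. auto_derive; auto; ring.
Qed.

(** The base curve gamma(y) = f(psi(y), y) - r(y) replaces the pure y-part of
    f, in the coordinates adapted to x = psi(y), by the prescribed r. *)
Lemma contact_reduction f psi r : germ2 f -> germ2 (fun _ y => psi y) -> germ2 (fun _ y => r y) ->
  exists gamma, germ1 gamma /\ forall nf,
    K_equiv (fun x y => f (x + psi y) y - f (psi y) y + r y) nf ->
    K_equiv (contact f (cyl_surface v_dir (base_curve gamma))) nf.
Proof.
intros [Hf f0] Hpsi [Hr r0]. exists (fun y => f (psi y) y - r y). split.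
- split.
  + apply smooth1_of_smooth2. apply smooth2_minus; auto.
    apply (smooth2_comp f (fun _ y => psi y) (fun _ y => y)); auto; try apply Hpsi. apply smooth2_snd.
  + cbv beta. rewrite (proj2 Hpsi), f0, r0. ring.
- intros nf H. apply (K_equiv_diffeo _ _ _ _ (diffeo_shear psi Hpsi)).
  refine (K_equiv_ext _ _ _ _ H).
  apply near_all. intros x y. cbv beta. rewrite contact_cyl. ring.
Qed.

(** * Contact functions at points with a cubic term, and the D series *)

Ltac unfold_taylor E :=
  cbn [sum_f_R0 Nat.sub Nat.add] in E; rewrite !INR_IZR_INZ in E; cbn -[pow] in E.

(** psi(y) = s y + t y^2, where s kills the linear term of f_xx(psi(y), y) and
    t its quadratic term. The three coefficients of f_x(psi(y), y) are then
    the invariants of the statement, up to the powers of a30 that clear the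
    denominators of s and t. *)
Lemma cubic_expansion f a : parabolic_monge f -> a = taylor_coef f -> a 3%nat 0%nat <> 0 ->
  exists psi A B p, germ2 (fun _ y => psi y) /\ smooth2 A /\ smooth2 B /\ smooth2 p /\
   A 0 0 = a 3%nat 0%nat / 6 /\ p 0 0 = Q_Estar a / (24 * a 3%nat 0%nat ^ 5) /\
   near (fun x y => f (x + psi y) y - f (psi y) y =
     (- Q_D4 a / (2 * a 3%nat 0%nat) * y ^ 2 + Q_E7 a / (6 * a 3%nat 0%nat ^ 3) * y ^ 3
      + p x y * y ^ 4) * x + B x y * y ^ 3 * x ^ 2 + A x y * x ^ 3).
Proof.
intros [[Hf f0] Hm] Ha h30. rewrite <- Ha in Hm. destruct Hm as [a10 [a01 [a20 [a11 a02]]]].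
set (s := - a 2%nat 1%nat / a 3%nat 0%nat).
set (t := - (a 4%nat 0%nat * s ^ 2 / 2 + a 3%nat 1%nat * s + a 2%nat 2%nat / 2) / a 3%nat 0%nat).
set (xi := fun x y : R => s + t * y).
assert (Hxi : smooth2 xi) by (unfold xi; smooth).
assert (HX := smooth2_PX f Hf). assert (HXX := smooth2_PX _ HX).
destruct (taylor_along_line (PX f) xi 4 (fun i j => a (S i) j) HX Hxi) as [R1 [HR1 E1]].
{ intros i j. rewrite Ha, (partial_derive_PX f i j Hf). reflexivity. }
destruct (taylor_along_line (PX (PX f)) xi 2 (fun i j => a (S (S i)) j) HXX Hxi) as [R2 [HR2 E2]].
{ intros i j. rewrite Ha, (partial_derive_PX _ i j HX), (partial_derive_PX f _ j Hf). reflexivity. }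
set (psi := fun y => y * (s + t * y)).
assert (Hpsi : germ2 (fun _ y => psi y)) by (split; unfold psi; [smooth | ring]).
destruct (taylor_along_curve f psi Hf Hpsi) as [A [HA [A0 EA]]].
exists psi, A,
 (fun x y => (a 4%nat 0%nat * (2 * s * t + t ^ 2 * y) / 2 + a 3%nat 1%nat * t + R2 0 y) / 2),
 (fun x y => a 3%nat 0%nat * t ^ 2 / 2
   + (a 4%nat 0%nat * s ^ 2 / 2 + a 3%nat 1%nat * s + a 2%nat 2%nat / 2) * t
   + y * ((a 4%nat 0%nat * s + a 3%nat 1%nat) * t ^ 2 / 2 + y * (a 4%nat 0%nat * t ^ 3 / 6))
   + (a 5%nat 0%nat * xi x y ^ 4 / 24 + a 4%nat 1%nat * xi x y ^ 3 / 6 + a 3%nat 2%nat * xi x y ^ 2 / 4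
      + a 2%nat 3%nat * xi x y / 6 + a 1%nat 4%nat / 24) + y * R1 0 y).
assert (HR1' : smooth2 (fun _ y => R1 0 y)).
{ apply (smooth2_comp R1 (fun _ _ => 0) (fun _ y => y)); auto; smooth. }
assert (HR2' : smooth2 (fun _ y => R2 0 y)).
{ apply (smooth2_comp R2 (fun _ _ => 0) (fun _ y => y)); auto; smooth. }
split; [exact Hpsi|]. split; [exact HA|].
split; [smooth; lra|]. split; [smooth; lra|]. split; [|split].
- rewrite A0, Ha. reflexivity.
- unfold xi, t, s, Q_Estar. field; auto.
- assert (Z2 : smooth2 (fun _ _ => 0)) by smooth.
  apply (near_mp _ _ EA), (near_mp _ _ (near_comp _ _ _ E1 Z2 smooth2_snd eq_refl eq_refl)),
   (near_mp _ _ (near_comp _ _ _ E2 Z2 smooth2_snd eq_refl eq_refl)), near_all.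
  intros x y e2 e1 e. rewrite e. clear e.
  change (y * xi 0 y) with (psi y) in e1, e2. unfold_taylor e1. unfold_taylor e2.
  rewrite e1, e2, a10, a20, a11. unfold Q_D4, Q_E7, xi.
  assert (E21 : a 2%nat 1%nat = - a 3%nat 0%nat * s) by (unfold s; field; auto).
  assert (E22 : a 2%nat 2%nat = - 2 * (a 3%nat 0%nat * t + a 4%nat 0%nat * s ^ 2 / 2 + a 3%nat 1%nat * s))
    by (unfold t; field; auto).
  clearbody s t. rewrite E21, E22. field. auto.
Qed.

Lemma realizes_mono f (P Q : (R -> R -> R) -> Prop) : (forall F, P F -> Q F) -> realizes f P -> realizes f Q.
Proof. intros H [g [Hg Hp]]. exists g; auto. Qed.

(** [cubic_expansion] combined with the freedom to choose r: the realizations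
    that follow take one value of r each. *)
Lemma cubic_realizes f a : parabolic_monge f -> a = taylor_coef f -> a 3%nat 0%nat <> 0 ->
  exists A B p, smooth2 A /\ smooth2 B /\ smooth2 p /\
   A 0 0 = a 3%nat 0%nat / 6 /\ p 0 0 = Q_Estar a / (24 * a 3%nat 0%nat ^ 5) /\
   forall r nf, germ2 (fun _ y => r y) ->
   (forall F, near (fun x y => F x y =
     (- Q_D4 a / (2 * a 3%nat 0%nat) * y ^ 2 + Q_E7 a / (6 * a 3%nat 0%nat ^ 3) * y ^ 3
      + p x y * y ^ 4) * x + B x y * y ^ 3 * x ^ 2 + A x y * x ^ 3 + r y) -> K_equiv F nf) ->
   realizes f (fun F => K_equiv F nf).
Proof.
intros Hm Ha h30.
destruct (cubic_expansion f a Hm Ha h30) as [psi [A [B [p [Hpsi [HA [HB [Hp [A0 [p0 E]]]]]]]]]].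
exists A, B, p. repeat (split; auto). intros r nf Hr H.
destruct (contact_reduction f psi r (proj1 Hm) Hpsi Hr) as [g [Hg HK]].
exists g. split; auto. apply HK, H. apply (near_mp _ _ E), near_all. intros x y e.
rewrite e. reflexivity.
Qed.

(** With r = y^2, all the terms other than A x^3 are multiples of y^2. *)
Lemma realizes_A2 f : parabolic_monge f -> taylor_coef f 3 0 <> 0 -> realizes f (sing_A 2).
Proof.
intros Hm h30. destruct (cubic_realizes f _ Hm eq_refl h30) as [A [B [p [HA [HB [Hp [A0 [_ H]]]]]]]].
destruct (sign_of _ h30) as [s [hs hp]].
apply realizes_mono with (fun F => K_equiv F (nf_A s 2)).
{ intros F HF. exists s; auto. }
apply (H (fun y => y ^ 2)). split; [smooth | simpl; ring].
intros F E. set (a := taylor_coef f) in *.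
apply (A_recognition_pure 2 (fun x _ => x) (fun _ y => y) A
 (fun x y => 1 + (- Q_D4 a / (2 * a 3%nat 0%nat) + Q_E7 a / (6 * a 3%nat 0%nat ^ 3) * y + p x y * y ^ 2) * x
             + B x y * y * x ^ 2)); auto.
- apply coords_id.
- smooth.
- rewrite A0. ring_simplify. lra.
- apply (near_mp _ _ E), near_all. intros x y e. rewrite e. simpl (2 + 1)%nat. ring.
Qed.

(** With r = 0 the germ is x (A x^2 + k2 y^2 + ...), where k2 / a30 has the
    sign opposite to that of Q_D4. *)
Lemma realizes_D4 f : parabolic_monge f -> taylor_coef f 3 0 <> 0 -> Q_D4 (taylor_coef f) <> 0 ->
  forall s, is_sign s -> s * Q_D4 (taylor_coef f) < 0 -> realizes f (fun F => K_equiv F (nf_D s 4)).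
Proof.
intros Hm h30 hQ s hs hsQ.
destruct (cubic_realizes f _ Hm eq_refl h30) as [A [B [p [HA [HB [Hp [A0 [_ H]]]]]]]].
set (a := taylor_coef f) in *.
apply (H (fun _ => 0)). split; [smooth | simpl; ring].
intros F E.
apply (D_recognition 4 1 0 (fun x _ => x) (fun _ y => y)
 (fun x y => - Q_D4 a / (2 * a 3%nat 0%nat) + Q_E7 a / (6 * a 3%nat 0%nat ^ 3) * y + p x y * y ^ 2
             + B x y * y * x) (fun _ _ => 0) A); auto.
- apply coords_swap, coords_id.
- smooth.
- smooth.
- replace (_ + _) with (- Q_D4 a / (2 * a 3%nat 0%nat)) by (simpl; ring).
  unfold Rdiv. apply Rmult_integral_contrapositive_currified. lra.
  apply Rinv_neq_0_compat. lra.
- rewrite A0. simpl pow.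
  replace (_ * _) with (- (s * Q_D4 a) / 12) by (field; auto). lra.
- apply (near_mp _ _ E), near_all. intros x y e. rewrite e. simpl. ring.
Qed.

(** With r = y^3, the terms other than A x^3 are multiples of y^3 as soon as
    k2 = 0. *)
Lemma realizes_D4_plus_degenerate f : parabolic_monge f -> taylor_coef f 3 0 <> 0 ->
  Q_D4 (taylor_coef f) = 0 -> realizes f (sing_D_plus 4).
Proof.
intros Hm h30 hQ.
destruct (cubic_realizes f _ Hm eq_refl h30) as [A [B [p [HA [HB [Hp [A0 [_ H]]]]]]]].
set (a := taylor_coef f) in *.
apply (H (fun y => y ^ 3)). split; [smooth | simpl; ring].
intros F E.
apply (D4_recognition (fun x _ => x) (fun _ y => y) A
 (fun x y => 1 + (Q_E7 a / (6 * a 3%nat 0%nat ^ 3) + p x y * y) * x + B x y * x ^ 2)); auto.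
- apply coords_id.
- smooth.
- rewrite A0. lra.
- match goal with |- ?u <> 0 => replace u with 1 by ring end. lra.
- apply (near_mp _ _ E), near_all. intros x y e. rewrite e, hQ. field. auto.
Qed.

Lemma realizes_E6 f : parabolic_monge f -> taylor_coef f 3 0 <> 0 ->
  Q_D4 (taylor_coef f) = 0 -> realizes f sing_E6.
Proof.
intros Hm h30 hQ.
destruct (cubic_realizes f _ Hm eq_refl h30) as [A [B [p [HA [HB [Hp [A0 [_ H]]]]]]]].
set (a := taylor_coef f) in *.
apply (H (fun y => y ^ 4)). split; [smooth | simpl; ring].
intros F E.
apply (E6_recognition A B (fun x y => Q_E7 a / (6 * a 3%nat 0%nat ^ 3) + p x y * y) (fun _ _ => 1)); auto.
- smooth.
- smooth.
- rewrite A0. lra.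
- apply (near_mp _ _ E), near_all. intros x y e. rewrite e, hQ. field. auto.
Qed.

Lemma realizes_E7 f : parabolic_monge f -> taylor_coef f 3 0 <> 0 ->
  Q_D4 (taylor_coef f) = 0 -> Q_E7 (taylor_coef f) <> 0 -> realizes f sing_E7.
Proof.
intros Hm h30 hQ hE.
destruct (cubic_realizes f _ Hm eq_refl h30) as [A [B [p [HA [HB [Hp [A0 [_ H]]]]]]]].
set (a := taylor_coef f) in *.
apply (H (fun _ => 0)). split; [smooth | simpl; ring].
intros F E.
apply (E7_recognition (fun x _ => x) (fun _ y => y) A
  (fun x y => Q_E7 a / (6 * a 3%nat 0%nat ^ 3) + p x y * y + B x y * x)); auto.
- apply coords_id.
- smooth.
- rewrite A0. lra.
- rewrite 2!Rmult_0_r, 2!Rplus_0_r. apply Rmult_integral_contrapositive_currified; auto.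
  apply Rinv_neq_0_compat. apply Rmult_integral_contrapositive_currified; [lra|]. apply pow_nonzero; auto.
- apply (near_mp _ _ E), near_all. intros x y e. rewrite e, hQ. field. auto.
Qed.

Lemma realizes_E8 f : parabolic_monge f -> taylor_coef f 3 0 <> 0 ->
  Q_D4 (taylor_coef f) = 0 -> Q_E7 (taylor_coef f) = 0 -> realizes f sing_E8.
Proof.
intros Hm h30 hQ hE.
destruct (cubic_realizes f _ Hm eq_refl h30) as [A [B [p [HA [HB [Hp [A0 [_ H]]]]]]]].
set (a := taylor_coef f) in *.
apply (H (fun y => y ^ 5)). split; [smooth | simpl; ring].
intros F E.
apply (E8_recognition A B p (fun _ _ => 1)); auto.
- smooth.
- rewrite A0. lra.
- apply (near_mp _ _ E), near_all. intros x y e. rewrite e, hQ, hE. field. auto.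
Qed.

Lemma realizes_E_star_form f s : parabolic_monge f -> taylor_coef f 3 0 <> 0 ->
  Q_D4 (taylor_coef f) = 0 -> Q_E7 (taylor_coef f) = 0 -> is_sign s -> 0 < s * Q_Estar (taylor_coef f) ->
  realizes f (fun F => K_equiv F (fun x y => x ^ 3 + s * x * y ^ 4)).
Proof.
intros Hm h30 hQ hE hs hp.
destruct (cubic_realizes f _ Hm eq_refl h30) as [A [B [p [HA [HB [Hp [A0 [p0 H]]]]]]]].
set (a := taylor_coef f) in *.
apply (H (fun _ => 0)). split; [smooth | simpl; ring].
intros F E.
apply (E_star_recognition A B p); auto.
- rewrite A0, p0.
  replace (_ * _) with (s * Q_Estar a * / (144 * (a 3%nat 0%nat ^ 2) ^ 2)) by (field; auto).
  apply Rmult_lt_0_compat; auto. apply Rinv_0_lt_compat.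
  assert (0 < a 3%nat 0%nat ^ 2) by (apply pow2_gt_0; auto). nra.
- apply (near_mp _ _ E), near_all. intros x y e. rewrite e, hQ, hE. field. auto.
Qed.

(** What multiplies w t^2 in (w + t)^(j+3) - t^(j+3) once the two highest
    powers of w are set apart ([binom_rem_spec]); it vanishes at 0 for j >
    0. *)
Fixpoint binom_rem (j : nat) (w t : R) : R :=
  match j with
  | O => 3
  | S i => (w + t) * binom_rem i w t + INR (i + 3) * w ^ (i + 1) + t ^ (i + 1)
  end.

Lemma binom_rem_spec j w t :
  (w + t) ^ (j + 3) = t ^ (j + 3)
    + w * (w ^ (j + 2) + INR (j + 3) * t * w ^ (j + 1) + t ^ 2 * binom_rem j w t).
Proof.
induction j.
- simpl. ring.
- change (S j + 3)%nat with (S (j + 3)). rewrite <- tech_pow_Rmult, IHj, S_INR.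
  change (S j + 2)%nat with (S (j + 2)). change (S j + 1)%nat with (S (j + 1)).
  cbn [binom_rem]. rewrite (Nat.add_comm j 3), (Nat.add_comm j 2), (Nat.add_comm j 1).
  simpl Nat.add. simpl pow. ring.
Qed.

Lemma smooth2_binom_rem j p q : smooth2 p -> smooth2 q -> smooth2 (fun x y => binom_rem j (p x y) (q x y)).
Proof.
intros Hp Hq. induction j; simpl; smooth.
Qed.

(** The germ vanishes on a smooth curve y = x Y(x): after the substitution y =
    x Y and division by x^3, the equation becomes g + m Y + x^(n-3) Y^n = 0,
    with a simple root Y(0) = - g / m. In the coordinate w = y - x Y(x) the
    germ has the form of [D_recognition], with U = x and W = w. For n = 3 the
    last term contributes at x = 0, and the hypothesis on g ensures Y(0) =
    0. *)
Lemma D_recognition_critical_curve g m F n : smooth2 g -> smooth2 m -> m 0 0 <> 0 -> (3 <= n)%nat ->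
  ((4 <= n)%nat \/ g 0 0 = 0) ->
  near (fun x y => F x y = x ^ 2 * (g x y * x + m x y * y) + y ^ n) ->
  sing_D (S n) F.
Proof.
intros Hg Hm m0 hn hcase E.
destruct (sign_of _ m0) as [s [hs hp]]. exists s. split; auto.
set (Y0 := - g 0 0 / m 0 0).
assert (Z : 0 ^ (n - 3) = 0 \/ Y0 = 0).
{ destruct hcase as [h|h]; [left; apply pow_i; lia | right; unfold Y0; rewrite h; field; auto]. }
(* the unknown is u = Y - Y0, with x = v as parameter *)
set (Th := fun u v => g v (v * (Y0 + u)) + (Y0 + u) * m v (v * (Y0 + u)) + v ^ (n - 3) * (Y0 + u) ^ n).
assert (HTh : germ2 Th).
{ split.
  - unfold Th. smooth; ring.
  - unfold Th. rewrite Rmult_0_l, Rplus_0_r.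
    replace (g 0 0 + Y0 * m 0 0) with 0 by (unfold Y0; field; auto).
    destruct Z as [Z|Z]; rewrite Z; [ring|]. rewrite (pow_i n) by lia. ring. }
assert (PTh : PX Th 0 0 = m 0 0).
{ apply PX_at. apply is_derive_ext with (fun u => g 0 0 + (Y0 + u) * m 0 0 + 0 ^ (n - 3) * (Y0 + u) ^ n).
  - intros u. unfold Th. rewrite Rmult_0_l. reflexivity.
  - destruct Z as [Z|Z]; rewrite Z.
    + auto_derive; auto. ring.
    + auto_derive; auto. rewrite Rplus_0_l. rewrite (pow_i (Init.Nat.pred n)) by lia. ring. }
destruct (implicit_function Th HTh) as [psi [Hpsi Epsi]]. rewrite PTh; auto.
assert (Epsi' := near_swap _ Epsi). cbv beta in Epsi'.
set (Y := fun x => Y0 + psi x).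
assert (HY : smooth2 (fun x _ => Y x)).
{ unfold Y. smooth. apply (smooth2_swap _ (proj1 Hpsi)). }
assert (Y00 : Y 0 = Y0) by (unfold Y; rewrite (proj2 Hpsi); ring).
assert (Dif : diffeo_germ (fun x _ => x) (fun x y => y + Y x * x)).
{ apply coords_diffeo. apply (coords_shear_snd (fun x _ => x) (fun _ y => y) (fun x _ => Y x)); auto.
  apply coords_id. }
apply (K_equiv_diffeo _ _ _ _ Dif).
set (gt := fun x y => g x (y + Y x * x)). set (mt := fun x y => m x (y + Y x * x)).
assert (Hgt : smooth2 gt) by (unfold gt; smooth; ring).
assert (Hmt : smooth2 mt) by (unfold mt; smooth; ring).
destruct (taylor_Y gt 0 Hgt) as [g' [Hg' Eg]]. destruct (taylor_Y mt 0 Hmt) as [m' [Hm' Em]].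
assert (Hmt0 : smooth2 (fun x _ => mt x 0)).
{ apply (smooth2_comp mt (fun x _ => x) (fun _ _ => 0)); auto; smooth. }
set (A := fun x w => x * g' x w + mt x 0 + (w + Y x * x) * m' x w
                     + Y x ^ 2 * binom_rem (n - 3) w (Y x * x)).
assert (HA : smooth2 A).
{ unfold A. smooth. apply smooth2_binom_rem; smooth. }
assert (HB : smooth2 (fun x _ => INR n * Y x)) by (smooth).
assert (A0 : A 0 0 = m 0 0).
{ unfold A, mt. rewrite !Y00, !Rmult_0_r, Rmult_0_l, !Rplus_0_r, !Rplus_0_l, Rmult_0_l, Rplus_0_r.
  assert (Y0 ^ 2 * binom_rem (n - 3) 0 0 = 0); [|lra].
  destruct hcase as [h|h].
  - replace (n - 3)%nat with (S (n - 4)) by lia. simpl binom_rem.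
    rewrite (pow_i (n - 4 + 1)) by lia. ring.
  - unfold Y0. rewrite h. field; auto. }
apply (D_recognition (S n) (n - 2) (n - 3) (fun _ y => y) (fun x _ => x) A (fun x _ => INR n * Y x) (fun _ _ => 1));
 auto; try lia.
- apply coords_id.
- smooth.
- rewrite A0; auto.
- rewrite A0, Y00.
  replace (_ - _) with 1. lra.
  destruct Z as [Z|Z]; rewrite Z; field; auto.
- apply (near_mp _ _ (near_comp _ (fun x _ => x) (fun x y => y + Y x * x) E smooth2_fst
     (proj1 (proj1 (proj2 Dif))) eq_refl (proj2 (proj1 (proj2 Dif))))),
    (near_mp _ _ Eg), (near_mp _ _ Em), (near_mp _ _ Epsi'), near_all.
  intros x w eT em eg e. cbv beta in e. rewrite e. clear e.
  change (g x (w + Y x * x)) with (gt x w). change (m x (w + Y x * x)) with (mt x w).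
  assert (eg' : gt x w = gt x 0 + w * g' x w).
  { rewrite eg. cbn [sum_f_R0]. unfold dY. simpl. field. }
  assert (em' : mt x w = mt x 0 + w * m' x w).
  { rewrite em. cbn [sum_f_R0]. unfold dY. simpl. field. }
  assert (eT' : gt x 0 = - Y x * mt x 0 - x ^ (n - 3) * Y x ^ n).
  { unfold gt, mt. rewrite Rplus_0_l. unfold Th in eT. fold (Y x) in eT. rewrite (Rmult_comm x) in eT. lra. }
  replace ((w + Y x * x) ^ n) with ((w + Y x * x) ^ ((n - 3) + 3)) by (f_equal; lia).
  rewrite binom_rem_spec.
  replace (S n - 2)%nat with (n - 3 + 2)%nat by lia.
  replace (n - 2)%nat with (n - 3 + 1)%nat by lia.
  rewrite eg', em', eT'. unfold A.
  replace (INR n) with (INR (n - 3 + 3)) by (f_equal; lia).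
  rewrite (Rpow_mult_distr (Y x) x).
  replace (Y x ^ n) with (Y x ^ (n - 3 + 3)) by (f_equal; lia).
  rewrite !pow_add. ring.
Qed.

(** On x = y W the function f_x is y^2 times a smooth function, whose value at
    y = 0 is the quadratic polynomial of the hypothesis; a simple root W0
    continues to a smooth curve of critical points of f(., y), along which
    f_xx = (a30 W0 + a21) y + ... *)
Lemma realizes_D_series f W0 a : parabolic_monge f -> a = taylor_coef f ->
  a 3%nat 0%nat / 2 * W0 ^ 2 + a 2%nat 1%nat * W0 + a 1%nat 2%nat / 2 = 0 ->
  a 3%nat 0%nat * W0 + a 2%nat 1%nat <> 0 ->
  forall k, (4 <= k)%nat -> ((5 <= k)%nat \/ a 3%nat 0%nat = 0) -> realizes f (sing_D k).
Proof.
intros Hmonge Ha hW hW' k hk hcase. assert (Hgf := proj1 Hmonge).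
destruct Hmonge as [[Hf f0] Hm]. rewrite <- Ha in Hm. destruct Hm as [a10 [a01 [a20 [a11 a02]]]].
assert (HX := smooth2_PX f Hf). assert (HXX := smooth2_PX _ HX).
destruct (taylor_along_line (PX f) (fun x _ => W0 + x) 2 (fun i j => a (S i) j) HX) as [R1 [HR1 E1]].
{ smooth. }
{ intros i j. rewrite Ha, (partial_derive_PX f i j Hf). reflexivity. }
set (Th := fun x y => a 3%nat 0%nat / 2 * (W0 + x) ^ 2 + a 2%nat 1%nat * (W0 + x) + a 1%nat 2%nat / 2
                      + y * R1 x y).
assert (E1' : near (fun x y => PX f (y * (W0 + x)) y = y ^ 2 * Th x y)).
{ apply (near_mp _ _ E1), near_all. intros x y e. unfold_taylor e. rewrite e, a10, a20, a11.
  unfold Th. field. }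
destruct (implicit_function Th) as [w [Hw Ew]].
{ split. unfold Th. smooth. unfold Th. rewrite Rplus_0_r, hW. ring. }
{ rewrite (PX_at _ (a 3%nat 0%nat * W0 + a 2%nat 1%nat)); auto.
  apply is_derive_ext with (fun x => a 3%nat 0%nat / 2 * (W0 + x) ^ 2 + a 2%nat 1%nat * (W0 + x) + a 1%nat 2%nat / 2).
  - intros x. unfold Th. rewrite Rmult_0_l, Rplus_0_r. reflexivity.
  - auto_derive; auto. field. }
set (phi := fun y => y * (W0 + w y)).
assert (Hw' := proj1 Hw).
assert (Hphi : germ2 (fun _ y => phi y)) by (split; unfold phi; [smooth | ring]).
assert (E2 : near (fun _ y => PX f (phi y) y = 0)).
{ apply (near_mp _ _ (near_comp _ (fun _ y => w y) (fun _ y => y) E1' Hw' smooth2_snd (proj2 Hw) eq_refl)),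
   (near_mp _ _ Ew), near_all. intros x y e1 e2. unfold phi. rewrite e2, e1. ring. }
destruct (taylor_along_line (PX (PX f)) (fun _ y => W0 + w y) 1 (fun i j => a (S (S i)) j) HXX) as [R2 [HR2 E3]].
{ smooth. }
{ intros i j. rewrite Ha, (partial_derive_PX _ i j HX), (partial_derive_PX f _ j Hf). reflexivity. }
destruct (taylor_along_curve f phi Hf Hphi) as [g [Hg [g0 Eg]]].
set (m := fun x y => (a 3%nat 0%nat * (W0 + w y) + a 2%nat 1%nat + y * R2 x y) / 2).
destruct (contact_reduction f phi (fun y => y ^ (k - 1)) Hgf Hphi) as [gam [Hgam HK]].
{ split. smooth. rewrite pow_i; auto. lia. }
exists gam. split; auto.
assert (HD : sing_D (S (k - 1)) (fun x y => f (x + phi y) y - f (phi y) y + y ^ (k - 1))).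
{ apply (D_recognition_critical_curve g m); auto; try lia.
  - unfold m. smooth. lra.
  - unfold m. rewrite (proj2 Hw), Rmult_0_l, !Rplus_0_r. lra.
  - destruct hcase as [h|h]; [left; lia | right]. rewrite g0.
    change (partial_derive 3 0 f 0 0) with (taylor_coef f 3 0). rewrite <- Ha, h. field.
  - apply (near_mp _ _ Eg), (near_mp _ _ E2), (near_mp _ _ E3), near_all.
    intros x y e3 e2 e. unfold_taylor e3. change (y * (W0 + w y)) with (phi y) in e3.
    rewrite e, e2, e3, a20. unfold m. field. }
replace (S (k - 1)) with k in HD by lia.
destruct HD as [s [hs HD]]. exists s. auto.
Qed.

(** * Contact functions at points without a cubic term *)

(** With weights 1 for x and 2 for y, this is f up to weight seven: the
    precision at which the A_6 condition is read. *)
Lemma weighted_expansion f a : parabolic_monge f -> a = taylor_coef f -> a 3%nat 0%nat = 0 ->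
  exists R0 R1 R2 R3 R4, smooth2 R0 /\ smooth2 R1 /\ smooth2 R2 /\ smooth2 R3 /\ smooth2 R4 /\
  near (fun x y => f x y =
    (a 4%nat 0%nat / 24 + a 5%nat 0%nat / 120 * x + a 6%nat 0%nat / 720 * x ^ 2
     + a 7%nat 0%nat / 5040 * x ^ 3 + x ^ 4 * R0 x y) * x ^ 4
    + (a 2%nat 1%nat / 2 + a 3%nat 1%nat / 6 * x + a 4%nat 1%nat / 24 * x ^ 2
       + a 5%nat 1%nat / 120 * x ^ 3 + x ^ 4 * R1 x y) * x ^ 2 * y
    + (a 0%nat 2%nat / 2 + a 1%nat 2%nat / 2 * x + a 2%nat 2%nat / 4 * x ^ 2
       + a 3%nat 2%nat / 12 * x ^ 3 + x ^ 4 * R2 x y) * y ^ 2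
    + (a 0%nat 3%nat / 6 + a 1%nat 3%nat / 6 * x + x ^ 2 * R3 x y) * y ^ 3
    + R4 x y * y ^ 4).
Proof.
intros [[Hf f0] Hm] Ha a30. rewrite <- Ha in Hm. destruct Hm as [a10 [a01 [a20 [a11 a02]]]].
assert (a00 : a 0%nat 0%nat = 0) by (rewrite Ha; exact f0).
assert (Hc : forall i j, a i j = partial_derive i j f 0 0) by (intros; rewrite Ha; reflexivity).
destruct (taylor_Y f 3 Hf) as [R4 [H4 E4]].
destruct (taylor_dY f 0 7 a Hf Hc) as [R0 [H0 E0]].
destruct (taylor_dY f 1 5 a Hf Hc) as [R1 [H1 E1]].
destruct (taylor_dY f 2 3 a Hf Hc) as [R2 [H2 E2]].
destruct (taylor_dY f 3 1 a Hf Hc) as [R3 [H3 E3]].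
exists R0, R1, (fun x y => R2 x y / 2), (fun x y => R3 x y / 6), R4.
split; auto. split; auto. split; [smooth; lra|]. split; [smooth; lra|]. split; auto.
apply (near_mp _ _ E0), (near_mp _ _ E1), (near_mp _ _ E2), (near_mp _ _ E3), (near_mp _ _ E4), near_all.
intros x y e e3 e2 e1 e0.
cbn [sum_f_R0] in e, e0, e1, e2, e3.
rewrite e, e0, e1, e2, e3, a00, a10, a20, a30, a01, a11.
rewrite !INR_IZR_INZ. cbn -[pow]. field.
Qed.

(** The coefficients of y^2 and y^3 in the contact function are free: they
    become c / 2 and e / 6 for a polynomial gamma. *)
Lemma quadratic_realizes f a c e : parabolic_monge f -> a = taylor_coef f -> a 3%nat 0%nat = 0 ->
  exists R0 R1 R2 R3 R4, smooth2 R0 /\ smooth2 R1 /\ smooth2 R2 /\ smooth2 R3 /\ smooth2 R4 /\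
  forall nf, (forall F, near (fun x y => F x y =
    (a 4%nat 0%nat / 24 + a 5%nat 0%nat / 120 * x + a 6%nat 0%nat / 720 * x ^ 2
     + a 7%nat 0%nat / 5040 * x ^ 3 + x ^ 4 * R0 x y) * x ^ 4
    + (a 2%nat 1%nat / 2 + a 3%nat 1%nat / 6 * x + a 4%nat 1%nat / 24 * x ^ 2
       + a 5%nat 1%nat / 120 * x ^ 3 + x ^ 4 * R1 x y) * x ^ 2 * y
    + (c / 2 + a 1%nat 2%nat / 2 * x + a 2%nat 2%nat / 4 * x ^ 2
       + a 3%nat 2%nat / 12 * x ^ 3 + x ^ 4 * R2 x y) * y ^ 2
    + (e / 6 + a 1%nat 3%nat / 6 * x + x ^ 2 * R3 x y) * y ^ 3
    + R4 x y * y ^ 4) -> K_equiv F nf) -> realizes f (fun F => K_equiv F nf).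
Proof.
intros Hm Ha a30.
destruct (weighted_expansion f a Hm Ha a30) as [R0 [R1 [R2 [R3 [R4 [H0 [H1 [H2 [H3 [H4 E]]]]]]]]]].
exists R0, R1, R2, R3, R4. repeat (split; auto). intros nf H.
exists (fun y => (a 0%nat 2%nat - c) / 2 * y ^ 2 + (a 0%nat 3%nat - e) / 6 * y ^ 3).
split.
- split; [apply smooth1_of_smooth2; smooth; lra | ring].
- apply H. apply (near_mp _ _ E), near_all. intros x y h. rewrite contact_cyl, h. field.
Qed.

(** Eliminating y from c y^2 / 2 + a21 x^2 y / 2 + a40 x^4 / 24 leaves the
    x^4-coefficient of the hypothesis. *)
Lemma realizes_A3_form f a c s : parabolic_monge f -> a = taylor_coef f -> a 3%nat 0%nat = 0 ->
  c <> 0 -> is_sign s -> 0 < s * ((a 4%nat 0%nat / 24 - a 2%nat 1%nat ^ 2 / (8 * c)) * c) ->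
  realizes f (fun F => K_equiv F (nf_A s 3)).
Proof.
intros Hm Ha a30 c0 hs hp.
destruct (quadratic_realizes f a c 0 Hm Ha a30) as [R0 [R1 [R2 [R3 [R4 [H0 [H1 [H2 [H3 [H4 H]]]]]]]]]].
apply H. intros F E.
apply (A_recognition 3 2 0 (fun x _ => x) (fun _ y => y)
 (fun x y => a 4%nat 0%nat / 24 + a 5%nat 0%nat / 120 * x + a 6%nat 0%nat / 720 * x ^ 2
     + a 7%nat 0%nat / 5040 * x ^ 3 + x ^ 4 * R0 x y)
 (fun x y => a 2%nat 1%nat / 2 + a 3%nat 1%nat / 6 * x + a 4%nat 1%nat / 24 * x ^ 2
       + a 5%nat 1%nat / 120 * x ^ 3 + x ^ 4 * R1 x y)
 (fun x y => c / 2 + a 1%nat 2%nat / 2 * x + a 2%nat 2%nat / 4 * x ^ 2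
       + a 3%nat 2%nat / 12 * x ^ 3 + x ^ 4 * R2 x y
    + (0 / 6 + a 1%nat 3%nat / 6 * x + x ^ 2 * R3 x y) * y + R4 x y * y ^ 2)); auto; try lia.
- apply coords_id.
- smooth; lra.
- smooth; lra.
- smooth; lra.
- match goal with |- ?u <> 0 => replace u with (c / 2) by field end. lra.
- match goal with |- 0 < ?u =>
   replace u with (s * ((a 4%nat 0%nat / 24 - a 2%nat 1%nat ^ 2 / (8 * c)) * c) / 2) end. lra.
  simpl pow. field. exact c0.
- apply (near_mp _ _ E), near_all. intros x y h. rewrite h. simpl (3 + 1)%nat. ring.
Qed.

(** In the coordinate Y = y - eta2 x^2 - eta3 x^3 the terms Y x^2 and Y x^3
    disappear, by the choice of eta2 and eta3, so the term Y x^4 and the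
    completion of the square only act from x^8 on. Hence the type is read on
    the restriction to Y = 0, of the form k5 x^5 + k6 x^6 + k7 x^7 + ... by
    the third equation. *)
Lemma realizes_A_higher f a c e k s eta2 eta3 k5 k6 k7 :
  parabolic_monge f -> a = taylor_coef f -> a 3%nat 0%nat = 0 ->
  c <> 0 -> is_sign s ->
  c * eta2 + a 2%nat 1%nat / 2 = 0 ->
  c * eta3 + a 3%nat 1%nat / 6 + a 1%nat 2%nat * eta2 = 0 ->
  a 4%nat 0%nat / 24 + a 2%nat 1%nat / 2 * eta2 + c / 2 * eta2 ^ 2 = 0 ->
  k5 = a 5%nat 0%nat / 120 + a 3%nat 1%nat / 6 * eta2 + a 1%nat 2%nat / 2 * eta2 ^ 2 ->
  k6 = a 6%nat 0%nat / 720 + a 4%nat 1%nat / 24 * eta2 + a 3%nat 1%nat / 6 * eta3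
       + a 2%nat 2%nat / 4 * eta2 ^ 2 + a 1%nat 2%nat * eta2 * eta3 + c / 2 * eta3 ^ 2 + e / 6 * eta2 ^ 3 ->
  k7 = a 7%nat 0%nat / 5040 + a 5%nat 1%nat / 120 * eta2 + a 4%nat 1%nat / 24 * eta3
       + a 3%nat 2%nat / 12 * eta2 ^ 2 + a 2%nat 2%nat / 2 * eta2 * eta3 + a 1%nat 2%nat / 2 * eta3 ^ 2
       + a 1%nat 3%nat / 6 * eta2 ^ 3 + e / 2 * eta2 ^ 2 * eta3 ->
  (k = 4%nat /\ 0 < s * (k5 * c) \/ k = 5%nat /\ k5 = 0 /\ 0 < s * (k6 * c) \/
   k = 6%nat /\ k5 = 0 /\ k6 = 0 /\ 0 < s * (k7 * c)) ->
  realizes f (fun F => K_equiv F (nf_A s k)).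
Proof.
intros Hm Ha a30 c0 hs h2 h3 h4 E5 E6 E7 hcase.
destruct (quadratic_realizes f a c e Hm Ha a30) as [R0 [R1 [R2 [R3 [R4 [H0 [H1 [H2 [H3 [H4 H]]]]]]]]]].
apply H. intros F E. clear H.
set (pi := fun x : R => eta2 + eta3 * x).
assert (Dif : diffeo_germ (fun x _ => x) (fun x y => y + pi x * x * x)).
{ apply coords_diffeo. apply (coords_shear_snd (fun x _ => x) (fun _ y => y) (fun x _ => pi x * x)).
  apply coords_id. unfold pi. smooth. }
apply (K_equiv_diffeo _ _ _ _ Dif).
assert (E' := near_comp _ (fun x _ => x) (fun x y => y + pi x * x * x) E smooth2_fst
     (proj1 (proj1 (proj2 Dif))) eq_refl (proj2 (proj1 (proj2 Dif)))). cbv beta in E'.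
set (q := fun x y => y + pi x * x * x) in *.
assert (Hq : smooth2 q) by (unfold q, pi; smooth).
assert (q0 : q 0 0 = 0) by (unfold q; ring).
set (S0 := fun x y => R0 x (q x y)). assert (HS0 : smooth2 S0) by (unfold S0; smooth; auto).
set (S1 := fun x y => R1 x (q x y)). assert (HS1 : smooth2 S1) by (unfold S1; smooth; auto).
set (S2 := fun x y => R2 x (q x y)). assert (HS2 : smooth2 S2) by (unfold S2; smooth; auto).
set (S3 := fun x y => R3 x (q x y)). assert (HS3 : smooth2 S3) by (unfold S3; smooth; auto).
set (S4 := fun x y => R4 x (q x y)). assert (HS4 : smooth2 S4) by (unfold S4; smooth; auto).
(* after the shift the germ is C y^2 + B x^4 y + k5 x^5 + k6 x^6 + K x^7 *)
set (C3 := fun x y => e / 6 + a 1%nat 3%nat / 6 * x + x ^ 2 * S3 x y).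
assert (HC3 : smooth2 C3) by (unfold C3; smooth; lra).
set (C2 := fun x y => c / 2 + a 1%nat 2%nat / 2 * x + a 2%nat 2%nat / 4 * x ^ 2
       + a 3%nat 2%nat / 12 * x ^ 3 + x ^ 4 * S2 x y).
assert (HC2 : smooth2 C2) by (unfold C2; smooth; lra).
set (C := fun x y => C2 x y + 3 * x ^ 2 * pi x * C3 x y + 6 * x ^ 4 * pi x ^ 2 * S4 x y
   + y * (C3 x y + 4 * x ^ 2 * pi x * S4 x y) + y ^ 2 * S4 x y).
assert (HC : smooth2 C) by (unfold C, pi; smooth).
set (B := fun x y =>
   (a 4%nat 1%nat / 24 + a 1%nat 2%nat * eta3 + a 2%nat 2%nat / 2 * pi x + a 3%nat 2%nat / 6 * pi x * x)
   + x * (a 5%nat 1%nat / 120 + x * S1 x y) + 2 * x ^ 2 * pi x * S2 x y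
   + 3 * pi x ^ 2 * C3 x y + 4 * x ^ 2 * pi x ^ 3 * S4 x y).
assert (HB : smooth2 B) by (unfold B, pi; smooth; lra).
set (K := fun x y => k7
   + x * (S0 x y + a 5%nat 1%nat / 120 * eta3 + pi x * S1 x y + a 2%nat 2%nat / 4 * eta3 ^ 2
     + a 3%nat 2%nat / 12 * (2 * eta2 * eta3 + eta3 ^ 2 * x) + pi x ^ 2 * S2 x y
     + e / 6 * (3 * eta2 * eta3 ^ 2 + eta3 ^ 3 * x)
     + a 1%nat 3%nat / 6 * (3 * eta2 ^ 2 * eta3 + 3 * eta2 * eta3 ^ 2 * x + eta3 ^ 3 * x ^ 2)
     + pi x ^ 3 * S3 x y + pi x ^ 4 * S4 x y)).
assert (HK : smooth2 K) by (unfold K, pi; smooth; lra).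
assert (EF : near (fun x y => F x (q x y) = C x y * y ^ 2 + B x y * x ^ 4 * y
   + (k5 * x ^ 5 + k6 * x ^ 6 + K x y * x ^ 7))).
{ apply (near_mp _ _ E'), near_all. intros x y h. change (y + pi x * x * x) with (q x y) in h.
  rewrite h. clear h. change (R0 x (q x y)) with (S0 x y). change (R1 x (q x y)) with (S1 x y).
  change (R2 x (q x y)) with (S2 x y). change (R3 x (q x y)) with (S3 x y).
  change (R4 x (q x y)) with (S4 x y).
  unfold K, B, C, C2, C3, q, pi.
  assert (E21 : a 2%nat 1%nat = - 2 * c * eta2) by lra.
  assert (E31 : a 3%nat 1%nat = - 6 * c * eta3 - 6 * a 1%nat 2%nat * eta2) by lra.
  assert (E40 : a 4%nat 0%nat = 12 * c * eta2 ^ 2) by (rewrite E21 in h4; lra).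
  rewrite E7, E6, E5, E21, E31, E40. field. }
assert (K0 : K 0 0 = k7) by (unfold K; ring).
clearbody K B.
assert (C00 : C 0 0 = c / 2) by (unfold C, C2, C3; field).
assert (G : forall A d, smooth2 A -> (2 * 4 = k + 1 + S d)%nat -> 0 < s * (A 0 0 * c) ->
  near (fun x y => k5 * x ^ 5 + k6 * x ^ 6 + K x y * x ^ 7 = A x y * x ^ (k + 1)) ->
  K_equiv (fun x y => F x (q x y)) (nf_A s k)).
{ intros A d HA hd hp EA.
  apply (A_recognition k 4 (S d) (fun x _ => x) (fun _ y => y) A B C); auto; try lia.
  - apply coords_id.
  - rewrite C00. lra.
  - rewrite C00. rewrite (pow_i (S d)) by lia. lra.
  - apply (near_mp _ _ EF), (near_mp _ _ EA), near_all. intros x y h1 h. rewrite h, h1. ring. }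
destruct hcase as [[-> hp]|[[-> [z5 hp]]|[-> [z5 [z6 hp]]]]].
- apply (G (fun x y => k5 + k6 * x + K x y * x ^ 2) 2%nat); [smooth | lia | |].
  + match goal with |- 0 < ?u => replace u with (s * (k5 * c)) by ring end. exact hp.
  + apply near_all. intros x y. simpl. ring.
- apply (G (fun x y => k6 + K x y * x) 1%nat); [smooth | lia | |].
  + match goal with |- 0 < ?u => replace u with (s * (k6 * c)) by ring end. exact hp.
  + apply near_all. intros x y. rewrite z5. simpl. ring.
- apply (G K 0%nat); [smooth | lia | |].
  + rewrite K0. exact hp.
  + apply near_all. intros x y. rewrite z5, z6. simpl. ring.
Qed.

Lemma realizes_A_sign f k s : is_sign s -> realizes f (fun F => K_equiv F (nf_A s k)) ->
  realizes f (sing_A k).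
Proof. intros hs. apply realizes_mono. intros F HF. exists s; auto. Qed.

(** The value c = 3 a21^2 / a40 is the one for which the x^4-coefficient a40 /
    24 - a21^2 / (8 c) of the eliminated function vanishes. *)
Lemma realizes_A456 f a e k k5 k6 k7 : parabolic_monge f -> a = taylor_coef f ->
  a 3%nat 0%nat = 0 -> a 2%nat 1%nat * a 4%nat 0%nat <> 0 ->
  let c := 3 * a 2%nat 1%nat ^ 2 / a 4%nat 0%nat in
  let eta2 := - a 4%nat 0%nat / (6 * a 2%nat 1%nat) in
  let eta3 := - (a 3%nat 1%nat / 6 + a 1%nat 2%nat * eta2) / c in
  k5 = R_A4 a / (360 * a 2%nat 1%nat ^ 2) ->
  k6 = a 6%nat 0%nat / 720 + a 4%nat 1%nat / 24 * eta2 + a 3%nat 1%nat / 6 * eta3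
       + a 2%nat 2%nat / 4 * eta2 ^ 2 + a 1%nat 2%nat * eta2 * eta3 + c / 2 * eta3 ^ 2 + e / 6 * eta2 ^ 3 ->
  k7 = a 7%nat 0%nat / 5040 + a 5%nat 1%nat / 120 * eta2 + a 4%nat 1%nat / 24 * eta3
       + a 3%nat 2%nat / 12 * eta2 ^ 2 + a 2%nat 2%nat / 2 * eta2 * eta3 + a 1%nat 2%nat / 2 * eta3 ^ 2
       + a 1%nat 3%nat / 6 * eta2 ^ 3 + e / 2 * eta2 ^ 2 * eta3 ->
  (k = 4%nat /\ k5 <> 0 \/ k = 5%nat /\ k5 = 0 /\ k6 <> 0 \/
   k = 6%nat /\ k5 = 0 /\ k6 = 0 /\ k7 <> 0) -> realizes f (sing_A k).
Proof.
intros Hm Ha h3 h24 c eta2 eta3 E5 E6 E7 hcase.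
set (a21 := a 2%nat 1%nat) in *. set (a40 := a 4%nat 0%nat) in *.
assert (h2 : a21 <> 0) by (intros E; apply h24; rewrite E; ring).
assert (h4 : a40 <> 0) by (intros E; apply h24; rewrite E; ring).
assert (c0 : c <> 0).
{ unfold c. apply Rmult_integral_contrapositive_currified; [|apply Rinv_neq_0_compat; auto].
  apply Rmult_integral_contrapositive_currified; [lra | apply pow_nonzero; auto]. }
assert (M : forall s, is_sign s ->
  (k = 4%nat /\ 0 < s * (k5 * c) \/ k = 5%nat /\ k5 = 0 /\ 0 < s * (k6 * c) \/
   k = 6%nat /\ k5 = 0 /\ k6 = 0 /\ 0 < s * (k7 * c)) -> realizes f (sing_A k)).
{ intros s hs hc. apply (realizes_A_sign f k s hs).
  apply (realizes_A_higher f a c e k s eta2 eta3 k5 k6 k7); auto.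
  - fold a21. unfold c, eta2. field; auto.
  - unfold eta3. field; auto.
  - fold a40 a21. unfold c, eta2. field; auto.
  - rewrite E5. unfold R_A4, eta2. fold a21 a40. field; auto. }
destruct hcase as [[hk hn]|[[hk [z5 hn]]|[hk [z5 [z6 hn]]]]].
- destruct (sign_of (k5 * c)) as [s [hs hp]]; [apply Rmult_integral_contrapositive_currified; auto|].
  apply (M s hs). auto.
- destruct (sign_of (k6 * c)) as [s [hs hp]]; [apply Rmult_integral_contrapositive_currified; auto|].
  apply (M s hs). auto.
- destruct (sign_of (k7 * c)) as [s [hs hp]]; [apply Rmult_integral_contrapositive_currified; auto|].
  apply (M s hs). auto 6.
Qed.

(** With gamma(y) = f(0,y) the contact function is x (a40 / 24 x^3 + B y x^2 +
    a12 / 2 y^2 + ...). *)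
Lemma realizes_D5 f a : parabolic_monge f -> a = taylor_coef f -> a 3%nat 0%nat = 0 ->
  a 2%nat 1%nat = 0 -> a 1%nat 2%nat <> 0 -> a 4%nat 0%nat <> 0 -> realizes f (sing_D 5).
Proof.
intros Hm Ha a30 a21 a12 a40.
destruct (weighted_expansion f a Hm Ha a30) as [R0 [R1 [R2 [R3 [R4 [H0 [H1 [H2 [H3 [H4 E]]]]]]]]]].
destruct (taylor_X R4 0 H4) as [T [HT ET]].
destruct (contact_reduction f (fun _ => 0) (fun _ => 0) (proj1 Hm)) as [g [Hg HK]].
{ split; [smooth | reflexivity]. }
{ split; [smooth | reflexivity]. }
exists g. split; auto.
assert (hp' : a 1%nat 2%nat / 2 * (a 4%nat 0%nat / 24) <> 0).
{ apply Rmult_integral_contrapositive_currified; lra. }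
destruct (sign_of _ hp') as [s [hs hp]].
exists s. split; auto. apply HK.
apply (D_recognition 5 2 1 (fun x _ => x) (fun _ y => y)
  (fun x y => a 1%nat 2%nat / 2 + a 2%nat 2%nat / 4 * x + a 3%nat 2%nat / 12 * x ^ 2 + x ^ 3 * R2 x y
     + (a 1%nat 3%nat / 6 + x * R3 x y) * y + T x y * y ^ 2)
  (fun x y => a 3%nat 1%nat / 6 + a 4%nat 1%nat / 24 * x
       + a 5%nat 1%nat / 120 * x ^ 2 + x ^ 3 * R1 x y)
  (fun x y => a 4%nat 0%nat / 24 + a 5%nat 0%nat / 120 * x + a 6%nat 0%nat / 720 * x ^ 2
     + a 7%nat 0%nat / 5040 * x ^ 3 + x ^ 4 * R0 x y)); auto; try lia.
- apply coords_swap, coords_id.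
- smooth; lra.
- smooth; lra.
- smooth; lra.
- match goal with |- ?u <> 0 => replace u with (a 1%nat 2%nat / 2) by field end. lra.
- match goal with |- 0 < s * (?u * ?v) =>
   replace v with (a 4%nat 0%nat / 24);
   [replace u with (a 1%nat 2%nat / 2) by field; exact hp | rewrite pow_1, Rmult_0_r; field; exact a12] end.
- assert (Z : smooth2 (fun _ _ => 0)) by smooth.
  apply (near_mp _ _ E), (near_mp _ _ (near_comp _ _ _ E Z smooth2_snd eq_refl eq_refl)),
   (near_mp _ _ ET), near_all.
  intros x y t e0 e. cbv beta in e0. rewrite !Rplus_0_r, e, e0, t, a21.
  cbn [sum_f_R0]. unfold dX. simpl Derive_n. rewrite INR_IZR_INZ. cbn -[pow]. field.
Qed.

Theorem theorem3p3 :
  forall f : R -> R -> R,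
  parabolic_monge f ->
  let a := taylor_coef f in
  let a12 := a 1%nat 2%nat in
  let a21 := a 2%nat 1%nat in
  let a30 := a 3%nat 0%nat in
  let a40 := a 4%nat 0%nat in
  (* (i) *)
  (a30 <> 0 -> Q_D4 a > 0 ->
     realizes f (sing_A 2) /\
     (forall k : nat, (4 <= k)%nat -> realizes f (sing_D k))) /\
  (* (ii) *)
  (a30 <> 0 -> Q_D4 a < 0 ->
     realizes f (sing_A 2) /\ realizes f (sing_D_plus 4)) /\
  (* (iii) *)
  (a30 <> 0 -> Q_D4 a = 0 -> Q_E7 a <> 0 ->
     realizes f (sing_A 2) /\ realizes f (sing_D_plus 4) /\
     realizes f sing_E6 /\ realizes f sing_E7) /\
  (* (iv) *)
  (a30 = 0 -> a21 * a40 <> 0 -> R_A4 a <> 0 ->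
     realizes f (sing_A 3) /\ realizes f (sing_A 4) /\
     (forall k : nat, (4 <= k)%nat -> realizes f (sing_D k))) /\
  (* (v) *)
  (a30 <> 0 -> Q_D4 a = 0 -> Q_E7 a = 0 -> Q_Estar a <> 0 ->
     realizes f (sing_A 2) /\ realizes f (sing_D_plus 4) /\
     realizes f sing_E6 /\ realizes f sing_E8 /\
     (Q_Estar a > 0 -> realizes f sing_E_star) /\
     (Q_Estar a < 0 -> realizes f sing_E_star_minus)) /\
  (* (vi) *)
  (a30 = 0 -> a21 * a40 <> 0 -> R_A4 a = 0 -> R_A6 a <> 0 ->
     realizes f (sing_A 3) /\ realizes f (sing_A 5) /\
     realizes f (sing_A 6) /\
     (forall k : nat, (4 <= k)%nat -> realizes f (sing_D k))) /\
  (* (vii) *)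
  (a30 = 0 -> a40 = 0 -> a21 <> 0 ->
     realizes f (sing_A_minus 3) /\
     (forall k : nat, (4 <= k)%nat -> realizes f (sing_D k))) /\
  (* (viii) *)
  (a30 = 0 -> a21 = 0 -> a12 * a40 <> 0 ->
     realizes f (sing_A 3) /\ realizes f (sing_D 5)).
Proof.
intros f Hm a a12 a21 a30 a40.
assert (Ha : a = taylor_coef f) by reflexivity.
assert (HDz : a30 = 0 -> a21 <> 0 -> forall k, (4 <= k)%nat -> realizes f (sing_D k)).
{ intros h3 h2 k hk. apply (realizes_D_series f (- a12 / (2 * a21)) a); auto.
  - fold a30 a21 a12. rewrite h3. field; auto.
  - fold a30 a21. rewrite h3. lra. }
assert (HA3 : a30 = 0 -> a21 * a40 <> 0 -> realizes f (sing_A 3)).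
{ intros h3 h24. assert (h2 : a21 <> 0) by (intros E; apply h24; rewrite E; ring).
  assert (h4 : a40 <> 0) by (intros E; apply h24; rewrite E; ring).
  apply (realizes_A_sign f 3 (-1)); [right; auto|].
  (* the opposite of the value of c that would kill the x^4 term *)
  apply (realizes_A3_form f a (-3 * a21 ^ 2 / a40)); auto.
  - intros E. apply (pow_nonzero a21 2 h2). apply (Rmult_eq_reg_r (-3 / a40)).
    + rewrite Rmult_0_l, <- E. field; auto.
    + apply Rmult_integral_contrapositive_currified; [lra | apply Rinv_neq_0_compat; auto].
  - right; auto.
  - fold a40 a21. replace (-1 * _) with (a21 ^ 2 / 4) by (field; auto).
    assert (0 < a21 ^ 2) by (apply pow2_gt_0; auto). lra. }
split; [|split; [|split; [|split; [|split; [|split; [|split]]]]]].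
- intros h3 hQ. split; [apply realizes_A2; auto|]. intros k hk.
  destruct (Nat.eq_dec k 4) as [->|hk4].
  + apply realizes_mono with (fun F => K_equiv F (nf_D (-1) 4)).
    { intros F HF. exists (-1). split; auto. right; auto. }
    apply realizes_D4; auto; fold a; try lra. right; auto.
  + assert (hs : sqrt (Q_D4 a) * sqrt (Q_D4 a) = Q_D4 a) by (apply sqrt_sqrt; lra).
    assert (hs0 : 0 < sqrt (Q_D4 a)) by (apply sqrt_lt_R0; lra).
    (* a root of the quadratic part of f_x, whose discriminant is Q_D4 *)
    apply (realizes_D_series f ((sqrt (Q_D4 a) - a21) / a30) a); auto.
    * fold a30 a21 a12.
      replace (_ + _) with ((sqrt (Q_D4 a) * sqrt (Q_D4 a) - a21 ^ 2 + a12 * a30) / (2 * a30))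
        by (field; auto).
      rewrite hs. unfold Q_D4. fold a30 a21 a12. field; auto.
    * fold a30 a21. replace (_ + _) with (sqrt (Q_D4 a)) by (field; auto). lra.
    * left. lia.
- intros h3 hQ. split; [apply realizes_A2; auto|].
  apply realizes_D4; auto; fold a; try lra. left; auto.
- intros h3 hQ hE. split; [apply realizes_A2; auto|].
  split; [apply realizes_D4_plus_degenerate; auto|].
  split; [apply realizes_E6; auto | apply realizes_E7; auto].
- intros h3 h24 hR. split; [auto|].
  assert (h2 : a21 <> 0) by (intros E; apply h24; rewrite E; ring).
  split; [|auto].
  eapply (realizes_A456 f a 0 _ _ _ _ Hm Ha h3 h24); try reflexivity. left. split; auto.
  apply Rmult_integral_contrapositive_currified; auto. apply Rinv_neq_0_compat.
  apply Rmult_integral_contrapositive_currified; [lra | apply pow_nonzero; auto].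
- intros h3 hQ hE hS. split; [apply realizes_A2; auto|].
  split; [apply realizes_D4_plus_degenerate; auto|].
  split; [apply realizes_E6; auto|]. split; [apply realizes_E8; auto|].
  assert (G : forall s, is_sign s -> germ2 (fun x y => x ^ 3 + s * x * y ^ 4)).
  { intros s _. split; [smooth | ring]. }
  split; intros hS'.
  + apply realizes_mono with (fun F => K_equiv F (fun x y => x ^ 3 + 1 * x * y ^ 4)).
    * intros F HF. exists (fun x y => x ^ 3 + 1 * x * y ^ 4). split; [apply G; left; auto|]. split; auto.
      intros i j _. apply partial_derive_ext_loc, near_all. intros; ring.
    * apply realizes_E_star_form; auto. left; auto. fold a. lra.
  + apply realizes_mono with (fun F => K_equiv F (fun x y => x ^ 3 + -1 * x * y ^ 4)).
    * intros F HF. exists (fun x y => x ^ 3 + -1 * x * y ^ 4). split; [apply G; right; auto|]. split; auto.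
      intros i j _. apply partial_derive_ext_loc, near_all. intros; ring.
    * apply realizes_E_star_form; auto. right; auto. fold a. lra.
- intros h3 h24 hR4 hR6. split; [auto|].
  assert (h2 : a21 <> 0) by (intros E; apply h24; rewrite E; ring).
  assert (h4 : a40 <> 0) by (intros E; apply h24; rewrite E; ring).
  set (c := 3 * a 2%nat 1%nat ^ 2 / a 4%nat 0%nat). set (eta2 := - a 4%nat 0%nat / (6 * a 2%nat 1%nat)).
  set (eta3 := - (a 3%nat 1%nat / 6 + a 1%nat 2%nat * eta2) / c).
  assert (heta : eta2 <> 0).
  { unfold eta2. fold a21 a40. apply Rmult_integral_contrapositive_currified; [lra|]. apply Rinv_neq_0_compat. lra. }
  assert (c0 : c <> 0).
  { unfold c. fold a21 a40. apply Rmult_integral_contrapositive_currified; [|apply Rinv_neq_0_compat; auto].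
    apply Rmult_integral_contrapositive_currified; [lra | apply pow_nonzero; auto]. }
  set (k60 := a 6%nat 0%nat / 720 + a 4%nat 1%nat / 24 * eta2 + a 3%nat 1%nat / 6 * eta3
       + a 2%nat 2%nat / 4 * eta2 ^ 2 + a 1%nat 2%nat * eta2 * eta3 + c / 2 * eta3 ^ 2).
  split; [|split; [|auto]].
  (* this y^3-coefficient makes the x^6-coefficient equal to 1 *)
  + eapply (realizes_A456 f a (6 * (1 - k60) / eta2 ^ 3) _ _ _ _ Hm Ha h3 h24); try reflexivity. right; left. split; auto.
    split; [rewrite hR4; unfold Rdiv; ring|].
    fold c eta2. fold eta3. fold k60.
    replace (k60 + _) with 1 by (field; auto). lra.
  (* this one makes it vanish, and R_A6 is left at order seven *)
  + eapply (realizes_A456 f a (- 6 * k60 / eta2 ^ 3) _ _ _ _ Hm Ha h3 h24); try reflexivity. right; right. split; auto.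
    split; [rewrite hR4; unfold Rdiv; ring|].
    fold c eta2. fold eta3. fold k60. split; [field; auto|].
    intros Z. apply hR6.
    (* R_A4 = 0 eliminates a12, which does not occur in R_A6 *)
    assert (E12 : a12 = (10 * a21 * a 3%nat 1%nat * a40 - 3 * a21 ^ 2 * a 5%nat 0%nat) / (5 * a40 ^ 2)).
    { unfold R_A4 in hR4. fold a12 a21 a40 in hR4. apply (Rmult_eq_reg_r (5 * a40 ^ 2)).
      - unfold Rdiv. rewrite Rmult_assoc, Rinv_l; [lra|].
        apply Rmult_integral_contrapositive_currified; [lra | apply pow_nonzero; auto].
      - apply Rmult_integral_contrapositive_currified; [lra | apply pow_nonzero; auto]. }
    apply (Rmult_eq_reg_r (/ (875 * 1296 * a21 ^ 3 * a40 ^ 2))).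
    * rewrite Rmult_0_l, <- Z. unfold R_A6, k60, eta3, c, eta2. fold a12 a21 a40.
      rewrite E12. field; auto.
    * apply Rinv_neq_0_compat. repeat apply Rmult_integral_contrapositive_currified; try lra;
      apply pow_nonzero; auto.
- intros h3 h4 h2. split; [|auto].
  apply (realizes_A3_form f a 1); auto; [right; auto |].
  fold a40 a21. rewrite h4. assert (0 < a21 ^ 2) by (apply pow2_gt_0; auto). lra.
- intros h3 h2 h14.
  assert (h1 : a12 <> 0) by (intros E; apply h14; rewrite E; ring).
  assert (h4 : a40 <> 0) by (intros E; apply h14; rewrite E; ring).
  split.
  + destruct (sign_of a40 h4) as [s [hs hp]]. apply (realizes_A_sign f 3 s hs).
    apply (realizes_A3_form f a 1); auto. fold a40 a21. rewrite h2. lra.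
  + apply (realizes_D5 f a); auto.
Qed.
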